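(* Let $q$ be a prime and $r\geqslant 2$ a fixed integer. Let $M,N\geqslant 1$ be real numbers with $MN\ll q$, let $\boldsymbol\alpha=(\alpha_m)_{m\leqslant M}$ be complex weights with $\alpha_m\ll 1$, let $\mathcal N=(N_m)_{m\leqslant M}$ be real numbers with $N_m\leqslant N$, and let $\boldsymbol\varphi=(\varphi_m)_{m\leqslant M}$ be smooth functions $\varphi_m:\mathbb{R}\to\mathbb{C}$ with $\operatorname{supp}\varphi_m\subseteq[0,N_m]$ and \[ \|\varphi_m^{(j)}\|_\infty\leqslant C_jN_m^{-j},\qquad m\leqslant M,\ j=0,1,2,\ldots, \] for constants $C_j$ depending only on $j$. For integers $a,b,\lambda$ with $\gcd(a\lambda,q)=1$ define \[ V_{a,b,\lambda}(\boldsymbol\alpha,\boldsymbol\varphi;M,\mathcal N)=\sum_{m\leqslant M}\sum_{n\in\mathbb Z}\alpha_m\varphi_m(n)\sum_{\substack{x\in\{0,\ldots,q-1\}\\ x^2\equiv amn+b\bmod q}}\exp(2\pi i\lambda x/q). \] Then \[ |V_{a,b,\lambda}(\boldsymbol\alpha,\boldsymbol\varphi;M,\mathcal N)|\leqslant\left(M^{3/2-1/(2r)}N^{1/2+1/(2r)}+M^{1-1/(2r)}N^{1/(2r)}q^{1/2-1/(4r)}\right)q^{o(1)}, \] uniformly over integers $a,b,\lambda$ with $\gcd(a\lambda,q)=1$.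
   Context: $q$ is a (large) prime; $m$ runs over positive integers $m\leqslant M$. $X\ll Y$ means $|X|\leqslant cY$ for a constant $c$. The term $q^{o(1)}$ denotes a quantity bounded by $q^{\varepsilon}$ for any fixed $\varepsilon>0$ once $q$ is sufficiently large, uniformly in the other parameters (the implied quantities may depend on $r$ and the constants $C_j$). *)

(* Defs.v *)
From Stdlib Require Import Reals ZArith Znumtheory.
From Coquelicot Require Import Coquelicot.
Open Scope R_scope.

Definition smooth (f : R -> R) : Prop :=
  forall (j : nat) (x : R), ex_derive (Derive_n f j) x.

Definition cfun (u v : R -> R) (x : R) : C := (u x, v x).

Definition cderiv (u v : R -> R) (j : nat) (x : R) : C :=
  (Derive_n u j x, Derive_n v j x).

Definition e_C (t : R) : C := (cos (2 * PI * t), sin (2 * PI * t)).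

Definition Csum (lo hi : nat) (f : nat -> C) : C :=
  sum_n_m (G := C_AbelianMonoid) f lo hi.

Definition inner_sum (q a b lam m n : Z) : C :=
  Csum 0 (Z.to_nat (q - 1)) (fun k =>
    let x := Z.of_nat k in
    if Z.eqb ((x * x - (a * m * n + b)) mod q) 0
    then e_C (IZR (lam * x) / IZR q) else RtoC 0).

(* V_{a,b,lam}(alpha, phi; M, N).  m runs over positive integers m <= M;
   n runs over the integers.  Since supp phi_m is contained in [0, N_m]
   and N_m <= N, only 0 <= n <= floor N contribute, so the sum over Z is
   written as the (equal) finite sum over 0 <= n <= floor N. *)
Definition V (q a b lam : Z) (M N : R) (alpha : nat -> C)
    (phiRe phiIm : nat -> R -> R) : C :=
  Csum 1 (Z.to_nat (Int_part M)) (fun m =>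
    Csum 0 (Z.to_nat (Int_part N)) (fun n =>
      Cmult (Cmult (alpha m) (cfun (phiRe m) (phiIm m) (INR n)))
            (inner_sum q a b lam (Z.of_nat m) (Z.of_nat n)))).

(* Main.v *)
(* Detecting n by additive characters turns the sum over n and x into
   (1/q) sum_h w_m(h) Gamma(h/m), where w_m(h) = sum_n phi_m(n) e(-hn/q) and
   Gamma(v) = sum_x e((lam x + (v/a)(x^2 - b))/q).  Completing the square, Gamma(v) is a
   Gauss sum times chi(v) e((A/v + B v)/q).  If N_m ~ N, then w_m is negligible outside
   |h| <= q^(1+eps)/N and varies slowly, so h may be replaced by h + k m and averaged over
   k <= K ~ q/(MN): this moves h/m to h/m + k.  After Abel summation in k, Hoelder's
   inequality separates the number of solutions of h1 m2 = h2 m1 (mod q), which is a divisor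
   count, from the 2r-th moment over v of the sums of chi(v + k) e((A/(v+k) + B(v+k))/q) over
   k <= K.  The off-diagonal terms of the moment are mixed character sums, to which Weil's
   bound applies.  The N_m are sorted into dyadic classes; those with N <= M are trivial.

   Weil's bound: the mixed sum is S_1 for a multiplicative function Lam on monic polynomials
   whose L-function sum_F Lam(F) T^(deg F) is a polynomial.  By Newton's identities the sums
   S_n over the fields of p^n elements are, up to sign, the power sums of its reciprocal
   roots.  Stepanov's method gives S_(2n) = O(p^n), which bounds every reciprocal root by
   sqrt p. *)

Require Import Defs.
From Stdlib Require Import Reals ZArith Znumtheory.
From Coquelicot Require Import Coquelicot.
From Stdlib Require Import Lra Lia.
Open Scope R_scope.

(** * Real functions *)

(** The length K ~ q/(MN) is forced from two sides. A shift by k m with k <= K moves h by at most K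
    M ~ q/N, so it stays in the effective range of w_m; and one shift by m changes w_m by O(MN/q)
    times its size, so the total variation over K steps is no larger than w_m itself. A collision is
    a congruence, but both of its sides are O(M H), which for M <= N exceeds q by at most a factor
    q^eps; at that cost it becomes an equality of integers. This is where the classes with N <= M
    have to be set apart. The decay of w_m comes from repeated differences of phi_m, which multiply
    w_m(h) by powers of 1 - e(-h/q). Stepanov's method is run over F_(Q^2) only. There the trace is
    g + g^Q, with g the sum of half of the conjugates, so on a fibre of trace t the Q-th power of g
    is t - g and its degree does not grow; f^((Q-1)/2) plays the same part for the quadratic
    character. This is why the sums of even index are the ones estimated, and they control the
    squares of the reciprocal roots. *)

Definition dif (f : R -> R) (x : R) : R := f x - f (x - 1).

Lemma Derive_n_dif (f : R -> R) (k : nat) (x : R) : smooth f ->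
  Derive_n (dif f) k x = Derive_n f k x - Derive_n f k (x - 1).
Proof.
intros Hf.
assert (Hn : forall n y, ex_derive_n f n y).
{ intros [|n] y; simpl; [exact I | apply Hf]. }
assert (Hs : forall n y, ex_derive_n (fun z => f (z + -1)) n y).
{ intros n y; apply ex_derive_n_comp_trans, Hn. }
rewrite (Derive_n_ext (dif f) (fun z => f z - f (z + -1))).
2: { intros t; unfold dif; f_equal. }
rewrite Derive_n_minus.
- rewrite Derive_n_comp_trans; f_equal.
- apply filter_forall; intros; apply Hn.
- apply filter_forall; intros; apply Hs.
Qed.

Lemma smooth_dif (f : R -> R) : smooth f -> smooth (dif f).
Proof.
intros Hf j x.
apply ex_derive_ext with (fun y => Derive_n f j y - Derive_n f j (y + -1)).
{ intros t; rewrite Derive_n_dif by assumption; f_equal. }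
apply (ex_derive_minus (V := R_NormedModule)); [apply Hf|].
apply (ex_derive_comp (V := R_NormedModule) (Derive_n f j) (fun y => y + -1)); [apply Hf|].
auto_derive; exact I.
Qed.

Lemma derive_step_bound (g : R -> R) (B x : R) : (forall y, ex_derive g y) ->
  (forall y, Rabs (Derive g y) <= B) -> Rabs (g x - g (x - 1)) <= B.
Proof.
intros Hg HB.
destruct (MVT_gen g (x - 1) x (Derive g)) as [c [_ Hc]].
- intros y _; apply Derive_correct, Hg.
- intros y _; apply continuity_pt_filterlim, (ex_derive_continuous (V := R_NormedModule)), Hg.
- rewrite Hc. replace (x - (x - 1)) with 1 by ring. rewrite Rmult_1_r; apply HB.
Qed.

(** Mean value theorem, [j] times. Differences commute with derivatives, so the innermost [dif] is
    traded for one derivative of [f]; the induction therefore runs over all functions at once. *)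
Lemma dif_iter_bound (j : nat) : forall (f : R -> R) (B : R), smooth f ->
  (forall x, Rabs (Derive_n f j x) <= B) -> forall x, Rabs (Nat.iter j dif f x) <= B.
Proof.
induction j as [|j IH]; intros f B Hf HB x; [apply HB|].
replace (Nat.iter (S j) dif f) with (Nat.iter j dif (dif f)).
2: { clear; induction j as [|j IH]; [reflexivity|]. simpl; rewrite IH; reflexivity. }
apply IH; [apply smooth_dif, Hf|].
intros y; rewrite Derive_n_dif by assumption.
apply (derive_step_bound (Derive_n f j)); [apply Hf | apply HB].
Qed.

Lemma dif_iter_support (j : nat) (f : R -> R) (L : R) :
  (forall x, x < 0 \/ L <= x -> f x = 0) ->
  forall x, x < 0 \/ L + INR j <= x -> Nat.iter j dif f x = 0.
Proof.
intros Hf; induction j as [|j IH]; intros x Hx.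
- apply Hf; simpl in Hx; lra.
- simpl Nat.iter; unfold dif at 1. rewrite S_INR in Hx.
  rewrite !IH; [ring| |]; lra.
Qed.

(** The Taylor lower bound a - a^3/6 + a^5/120 - a^7/5040 suffices: [PI <= 4] gives a^2 <= 4, so the
    first two terms leave at least a/3 and the last two are nonnegative together. *)
Lemma sin_ge_third (a : R) : 0 <= a <= PI / 2 -> a / 3 <= sin a.
Proof.
intros [H0 H1].
assert (HPI := PI_4).
destruct (SIN a) as [Hs _]; [lra|lra|].
apply Rle_trans with (2 := Hs).
unfold sin_lb, sin_approx, sin_term; simpl.
assert (a2 : a * a <= 4) by nra.
assert (a3 : 0 <= a * a) by nra.
field_simplify.
assert (Ha5 : 0 <= a ^ 5) by (apply pow_le; lra).
assert (Ha3 : 0 <= a ^ 3) by (apply pow_le; lra).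
assert (E1 : a ^ 3 <= 4 * a) by (simpl; nra).
assert (E2 : a ^ 7 <= 4 * a ^ 5) by (replace (a ^ 7) with (a * a * a ^ 5) by ring; nra).
lra.
Qed.

Lemma sin_abs_le (x : R) : Rabs (sin x) <= Rabs x.
Proof.
assert (P : forall y, 0 <= y -> Rabs (sin y) <= y).
{ intros y [Hy| <-].
  - destruct (Rle_lt_dec 1 y) as [H|H].
    + apply Rle_trans with 1; [|exact H].
      apply Rabs_le; destruct (SIN_bound y); lra.
    + rewrite Rabs_right; [apply Rlt_le, sin_lt_x, Hy|].
      apply Rle_ge, sin_ge_0; [lra|]. assert (H3 := PI2_3_2); lra.
  - rewrite sin_0, Rabs_R0; lra. }
destruct (Rle_lt_dec 0 x) as [H|H].
- rewrite (Rabs_right x) by lra; apply P, H.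
- rewrite (Rabs_left x) by lra. rewrite <- (Ropp_involutive x) at 1.
  rewrite sin_neg, Rabs_Ropp; apply P; lra.
Qed.

Lemma one_minus_cos (x : R) : 1 - cos (2 * x) = 2 * sin x ^ 2.
Proof. rewrite cos_2a_sin; ring. Qed.

Lemma PI_ge3 : 3 <= PI.
Proof. assert (H := PI2_3_2); lra. Qed.

(** * Size of the parameters *)

Ltac Rnonneg := repeat first [assumption | lra | apply pow_le | apply Rmult_le_pos].

Lemma pow_lt_mono (x y : R) (n : nat) : 0 <= x -> x < y -> x ^ S n < y ^ S n.
Proof.
intros Hx Hxy; induction n as [|n IH]; [simpl; lra|].
change (x * x ^ S n < y * y ^ S n).
apply Rmult_le_0_lt_compat; try assumption. apply pow_le, Hx.
Qed.

Lemma pow_le_inv (x y : R) (n : nat) : 0 <= y -> x ^ S n <= y ^ S n -> x <= y.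
Proof.
intros Hy H; destruct (Rle_lt_dec x y) as [Hl|Hl]; [exact Hl|].
assert (H' := pow_lt_mono y x n Hy Hl); lra.
Qed.

Lemma pow_sum_le (x y : R) (n : nat) : 0 <= x -> 0 <= y -> x ^ S n + y ^ S n <= (x + y) ^ S n.
Proof.
intros Hx Hy; induction n as [|n IH]; [simpl; lra|].
change (x * x ^ S n + y * y ^ S n <= (x + y) * (x + y) ^ S n).
assert (0 <= x ^ S n) by (apply pow_le; lra).
assert (0 <= y ^ S n) by (apply pow_le; lra).
nra.
Qed.

Lemma le_pow_self (x : R) (n : nat) : 1 <= x -> x <= x ^ S n.
Proof.
intros Hx; simpl. assert (H := pow_R1_Rle x n Hx). nra.
Qed.

(** The two terms of the final bound, with the parameter of the theorem written as [S r]: Hoelder's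
    inequality uses both [S r] and its predecessor. *)
Definition target1 (r : nat) (M N : R) : R :=
  Rpower M (3/2 - 1 / (2 * INR (S r))) * Rpower N (1/2 + 1 / (2 * INR (S r))).
Definition target2 (r : nat) (M N q : R) : R :=
  Rpower M (1 - 1 / (2 * INR (S r))) * Rpower N (1 / (2 * INR (S r)))
       * Rpower q (1/2 - 1 / (4 * INR (S r))).

Lemma INR_double_S (r : nat) : INR (2 * S r) = 2 * INR (S r).
Proof. rewrite mult_INR; reflexivity. Qed.

Lemma INR_S_neq0 (r : nat) : INR (S r) <> 0.
Proof. apply not_0_INR; lia. Qed.

(** The exponents of the theorem come out here. At their nominal sizes there are M q/N pairs (m, h)
    and about as many collisions, and K = q/(MN). The diagonal part K^(r+1) q of the moment then
    yields [target1], and the off-diagonal part K^(2r+2) sqrt q yields [target2]. *)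
Lemma target_pow (r : nat) (M N q : R) : 0 < M -> 0 < N -> 0 < q ->
  let c := (M * N ^ 2 / (q * sqrt q)) ^ (2 * S r) * (M * q / N) ^ (2 * r) * (M * q / N) in
  c * (q / (M * N)) ^ (S r) * q = target1 r M N ^ (2 * S r) /\
  c * (q / (M * N)) ^ (2 * S r) * sqrt q = target2 r M N q ^ (2 * S r).
Proof.
intros HM HN Hq; cbv zeta.
assert (Hpos : forall x, 0 < x -> x = exp (ln x)) by (intros; symmetry; apply exp_ln; assumption).
assert (Hexp : forall x n, exp x ^ n = exp (INR n * x)).
{ intros x n; induction n as [|n IH]; [simpl; rewrite Rmult_0_l, exp_0; reflexivity|].
  rewrite S_INR, <- tech_pow_Rmult, IH, <- exp_plus; f_equal; ring. }
assert (Hs := INR_S_neq0 r).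
rewrite <- (Rpower_sqrt q Hq). unfold target1, target2, Rpower.
set (lM := ln M); set (lN := ln N); set (lq := ln q).
rewrite (Hpos M HM), (Hpos N HN), (Hpos q Hq); fold lM lN lq.
unfold Rdiv; rewrite !Hexp, <- ?exp_plus, <- ?exp_Ropp, <- ?exp_plus, ?Hexp, <- ?exp_plus.
rewrite INR_double_S, !mult_INR, S_INR in *. simpl (INR 2).
split; f_equal; field; exact Hs.
Qed.

Lemma target1_pos r M N : 0 < target1 r M N.
Proof. unfold target1, Rpower; apply Rmult_lt_0_compat; apply exp_pos. Qed.

Lemma target2_pos r M N q : 0 < target2 r M N q.
Proof. unfold target2, Rpower; repeat apply Rmult_lt_0_compat; apply exp_pos. Qed.

Lemma div_le (x y z : R) : 0 < y -> x <= z * y -> x / y <= z.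
Proof. intros Hy H; apply Rmult_le_reg_r with y; [exact Hy|]. unfold Rdiv; rewrite Rmult_assoc, Rinv_l; lra. Qed.

Lemma le_div (x y z : R) : 0 < y -> x * y <= z -> x <= z / y.
Proof. intros Hy H; apply Rmult_le_reg_r with y; [exact Hy|]. unfold Rdiv; rewrite Rmult_assoc, Rinv_l; lra. Qed.

(** Takes the 2(r+1)-th root in Hoelder's inequality. The three factors bounding X^(2(r+1)) are the
    number of pairs (m, h), their collisions and the moment; [y] is a small power of q and [l] a
    logarithm. Everything is compared with the nominal sizes of [target_pow]. *)
Lemma moment_power_bound (r : nat) (c1 : R) : 1 <= c1 -> exists A, 1 <= A /\
  forall q M N y l K H X Mn : R,
  1 <= q -> 1 <= M -> M <= N -> M * N <= c1 * q -> 1 <= y -> 1 <= l -> l * l <= y ->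
  0 <= K -> K <= c1 * (q / (M * N)) -> 0 <= H -> H <= (1 + c1) * y * (q / N) ->
  0 <= X -> 0 <= Mn -> Mn <= M ->
  X ^ (2 * S r) <= (Mn * (2 * H + 1)) ^ (2 * r) *
     (2 * (Mn * H / q + 1) * (Mn ^ 2 + 4 * (Mn * l * (H * l)))) *
     (INR (S r) ^ S r * K ^ S r * q + K ^ (2 * S r) * (4 * INR (S r)) * sqrt q) ->
  M * N ^ 2 / (q * sqrt q) * X <= A * y ^ 2 * (target1 r M N + target2 r M N q).
Proof.
intros Hc1.
set (s := S r).
set (A1 := INR s ^ s * c1 ^ s). set (A2 := 4 * INR s * c1 ^ (2 * s)).
set (c2 := 2 + 3 * c1). set (c3 := 2 * (2 + c1) * (4 + 5 * c1)).
assert (Hs1 : 1 <= INR s) by (unfold s; rewrite S_INR; assert (Hr := pos_INR r); lra).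
assert (HA1 : 1 <= A1).
{ unfold A1; assert (H1 := pow_R1_Rle (INR s) s Hs1); assert (H2 := pow_R1_Rle c1 s Hc1); nra. }
assert (HA2 : 0 <= A2).
{ unfold A2; assert (H2 := pow_R1_Rle c1 (2 * s) Hc1); nra. }
assert (Hc2 : 1 <= c2 ^ (2 * r)) by (apply pow_R1_Rle; unfold c2; lra).
assert (Hc3 : 1 <= c3) by (unfold c3; nra).
assert (Hc2' : 0 < c2) by (unfold c2; lra).
set (A := c2 ^ (2 * r) * c3 * (A1 + A2)).
assert (HA : 1 <= A).
{ unfold A. assert (1 <= c2 ^ (2 * r) * c3) by nra. nra. }
exists A; split; [exact HA|].
intros q M N y l K H X Mn Hq HM HMN HMNq Hy Hl Hly HK0 HK HH0 HH HX HMn0 HMn HXb.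
set (t := sqrt q). set (E := M * N ^ 2 / (q * t)).
assert (Ht : 0 < t) by (apply sqrt_lt_R0; lra).
set (T1 := target1 r M N). set (T2 := target2 r M N q).
assert (HT1 : 0 < T1) by apply target1_pos.
assert (HT2 : 0 < T2) by apply target2_pos.
assert (HE : 0 < E).
{ unfold E; apply Rdiv_lt_0_compat; [|nra]. apply Rmult_lt_0_compat; [lra|]. apply pow_lt; lra. }
set (k := q / (M * N)) in *. set (g := q / N) in *.
assert (Hk : 0 < k) by (unfold k; apply Rdiv_lt_0_compat; nra).
assert (Hg : 0 < g) by (unfold g; apply Rdiv_lt_0_compat; lra).
assert (Hg1 : 1 <= c1 * g).
{ unfold g; replace (c1 * (q / N)) with (c1 * q / N) by (field; lra).
  apply le_div; [lra|]. nra. }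
assert (HMg : M <= c1 * g).
{ unfold g; replace (c1 * (q / N)) with (c1 * q / N) by (field; lra).
  apply le_div; [lra|]. nra. }
assert (HMgq : M * g <= q).
{ unfold g; replace (M * (q / N)) with (M * q / N) by (field; lra).
  apply div_le; [lra|]. nra. }
set (P := M * g).
assert (HP : 0 < P) by (unfold P; nra).
assert (Hyg : g <= y * g) by nra.
assert (F1 : 0 <= Mn * (2 * H + 1) <= c2 * y * P).
{ split; [nra|].
  assert (2 * H + 1 <= c2 * y * g).
  { unfold c2. assert (c1 * g <= c1 * (y * g)) by nra. nra. }
  unfold P. assert (0 <= c2 * y * g) by (unfold c2; nra). nra. }
assert (F2a : 0 <= Mn * H / q + 1 <= (2 + c1) * y).
{ assert (0 <= Mn * H / q) by (apply Rmult_le_pos; [nra | apply Rlt_le, Rinv_0_lt_compat; lra]).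
  split; [lra|].
  assert (Mn * H / q <= (1 + c1) * y); [|nra].
  apply div_le; [lra|].
  assert (Mn * H <= M * ((1 + c1) * y * g)) by (apply Rmult_le_compat; lra).
  assert (M * ((1 + c1) * y * g) = (1 + c1) * y * (M * g)) by ring.
  assert (0 <= (1 + c1) * y) by nra. nra. }
assert (F2b : 0 <= Mn ^ 2 + 4 * (Mn * l * (H * l)) <= (4 + 5 * c1) * y ^ 2 * P).
{ assert (0 <= Mn * H) by nra. assert (0 <= l * l) by nra.
  replace (Mn * l * (H * l)) with (Mn * H * (l * l)) by ring.
  split; [nra|].
  assert (Mn * H <= (1 + c1) * y * P).
  { unfold P. replace ((1 + c1) * y * (M * g)) with (M * ((1 + c1) * y * g)) by ring.
    apply Rmult_le_compat; lra. }
  assert (Mn * H * (l * l) <= (1 + c1) * y * P * y) by (apply Rmult_le_compat; lra).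
  assert (Mn ^ 2 <= c1 * P) by (unfold P; nra).
  assert (1 <= y * y) by nra.
  assert (c1 * P <= c1 * P * (y * y)) by (assert (0 <= c1 * P) by nra; nra).
  nra. }
assert (F2 : 0 <= 2 * (Mn * H / q + 1) * (Mn ^ 2 + 4 * (Mn * l * (H * l))) <= c3 * y ^ 3 * P).
{ split; [apply Rmult_le_pos; lra|].
  replace (c3 * y ^ 3 * P) with (2 * ((2 + c1) * y) * ((4 + 5 * c1) * y ^ 2 * P)) by (unfold c3; ring).
  apply Rmult_le_compat; lra. }
assert (Ks : forall n, 0 <= K ^ n <= c1 ^ n * k ^ n).
{ intros n; split; [apply pow_le, HK0|]. rewrite <- Rpow_mult_distr; apply pow_incr; lra. }
assert (F3 : 0 <= INR s ^ s * K ^ s * q + K ^ (2 * s) * (4 * INR s) * t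
   <= A1 * (k ^ s * q) + A2 * (k ^ (2 * s) * t)).
{ assert (H1 := Ks s); assert (H2 := Ks (2 * s)%nat).
  assert (H3 := pow_R1_Rle (INR s) s Hs1).
  split.
  - apply Rplus_le_le_0_compat; (apply Rmult_le_pos; [apply Rmult_le_pos|]); lra.
  - apply Rplus_le_compat.
    + unfold A1. replace (INR s ^ s * c1 ^ s * (k ^ s * q)) with (INR s ^ s * (c1 ^ s * k ^ s) * q) by ring.
      apply Rmult_le_compat_r; [lra|]. apply Rmult_le_compat_l; lra.
    + unfold A2. replace (4 * INR s * c1 ^ (2 * s) * (k ^ (2 * s) * t))
        with (c1 ^ (2 * s) * k ^ (2 * s) * (4 * INR s) * t) by ring.
      apply Rmult_le_compat_r; [lra|]. apply Rmult_le_compat_r; lra. }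
assert (G : (E * X) ^ (2 * s) <= A * y ^ (2 * r + 3) * (T1 ^ (2 * s) + T2 ^ (2 * s))).
{ rewrite Rpow_mult_distr.
  assert (HE2 : 0 <= E ^ (2 * s)) by Rnonneg.
  apply Rle_trans with (E ^ (2 * s) * ((c2 * y * P) ^ (2 * r) * (c3 * y ^ 3 * P) *
     (A1 * (k ^ s * q) + A2 * (k ^ (2 * s) * t)))).
  { apply Rmult_le_compat_l; [exact HE2|]. apply Rle_trans with (1 := HXb).
    assert (HF1 : 0 <= (Mn * (2 * H + 1)) ^ (2 * r) <= (c2 * y * P) ^ (2 * r)).
    { split; [apply pow_le; lra | apply pow_incr; lra]. }
    apply Rmult_le_compat; [apply Rmult_le_pos; lra | apply F3 | | apply F3].
    apply Rmult_le_compat; lra. }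
  destruct (target_pow r M N q) as [Z1 Z2]; try lra.
  fold s T1 t E in Z1; fold s T2 t E in Z2. rewrite <- Z1, <- Z2. clear Z1 Z2.
  replace (M * q / N) with P by (unfold P, g; field; lra). fold k.
  rewrite !Rpow_mult_distr, pow_add.
  set (e1 := E ^ (2 * s) * c2 ^ (2 * r) * y ^ (2 * r) * P ^ (2 * r) * c3 * y ^ 3 * P).
  assert (He1 : 0 <= e1).
  { unfold e1; Rnonneg. }
  set (z1 := k ^ s * q). set (z2 := k ^ (2 * s) * t).
  assert (Hz1 : 0 <= z1) by (unfold z1; Rnonneg).
  assert (Hz2 : 0 <= z2) by (unfold z2; Rnonneg).
  apply Rle_trans with (e1 * ((A1 + A2) * (z1 + z2))).
  - replace (E ^ (2 * s) * (c2 ^ (2 * r) * y ^ (2 * r) * P ^ (2 * r) * (c3 * y ^ 3 * P) * (A1 * z1 + A2 * z2)))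
      with (e1 * (A1 * z1 + A2 * z2)) by (unfold e1; ring).
    apply Rmult_le_compat_l; [exact He1|]. nra.
  - right; unfold e1, A, z1, z2; ring. }
assert (HT : 0 < T1 + T2) by lra.
apply pow_le_inv with (n := (2 * s - 1)%nat).
{ Rnonneg. }
replace (S (2 * s - 1)) with (2 * s)%nat by (unfold s; lia).
apply Rle_trans with (1 := G).
rewrite !Rpow_mult_distr.
assert (HTT : T1 ^ (2 * s) + T2 ^ (2 * s) <= (T1 + T2) ^ (2 * s)).
{ replace (2 * s)%nat with (S (2 * s - 1)) by (unfold s; lia). apply pow_sum_le; lra. }
assert (HAA : A <= A ^ (2 * s)).
{ replace (2 * s)%nat with (S (2 * s - 1)) by (unfold s; lia). apply le_pow_self, HA. }
(* The pairs contribute y^(2r) and the collisions y^3. Since 2r + 3 <= 4(r + 1), the root leaves at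
   most [y ^ 2]. *)
assert (Hyy : y ^ (2 * r + 3) <= (y ^ 2) ^ (2 * s)).
{ rewrite <- pow_mult. apply Rle_pow; [exact Hy|]. unfold s; lia. }
assert (0 <= T1 ^ (2 * s)) by Rnonneg. assert (0 <= T2 ^ (2 * s)) by Rnonneg.
assert (0 <= y ^ (2 * r + 3)) by Rnonneg.
apply Rmult_le_compat; try lra; [Rnonneg | apply Rmult_le_compat; lra].
Qed.

(** [Sg] is the sum over one dyadic class and [D] the size of w_m beyond the effective range. Both
    Abel weights, the size of w_m and its total variation, are O(N) because K M N <= c1 q: this
    gives 68 = 4 + 64. Dividing by K q uses K >= q/(2MN), which doubles 68 to 136 and leaves the
    factor M N^2/(q sqrt q) of [moment_power_bound]. *)
Lemma class_numerics (r : nat) (c1 : R) : 1 <= c1 -> exists A, 0 <= A /\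
  forall q M N y l K H L B0 X Mn Sg D : R,
  1 <= q -> 1 <= M -> M <= N -> M * N <= c1 * q -> 1 <= y -> 1 <= l -> l * l <= y ->
  0 < K -> K <= c1 * (q / (M * N)) -> q <= K * (2 * (M * N)) ->
  0 <= H -> H <= (1 + c1) * y * (q / N) ->
  0 <= L -> L <= 2 * N -> 0 <= B0 -> 0 <= X -> 0 <= Mn -> Mn <= M -> 0 <= D ->
  X ^ (2 * S r) <= (Mn * (2 * H + 1)) ^ (2 * r) *
     (2 * (Mn * H / q + 1) * (Mn ^ 2 + 4 * (Mn * l * (H * l)))) *
     (INR (S r) ^ S r * K ^ S r * q + K ^ (2 * S r) * (4 * INR (S r)) * sqrt q) ->
  K * (q * Sg) <= sqrt q * ((L * (2 * B0) + K * (L * (2 * B0 * (8 * (Mn * L / q))))) * X +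
     Mn * q * K * D) ->
  Sg <= A * B0 * y ^ 2 * (target1 r M N + target2 r M N q) + M * sqrt q * D.
Proof.
intros Hc1. destruct (moment_power_bound r c1 Hc1) as [A [HA HAb]].
exists (136 * c1 * A); split; [nra|].
intros q M N y l K H L B0 X Mn Sg D Hq HM HMN HMNq Hy Hl Hly HK0 HK HKl HH0 HH HL0 HL HB0 HX
  HMn0 HMn HD HXb HS.
assert (HE := HAb q M N y l K H X Mn Hq HM HMN HMNq Hy Hl Hly (Rlt_le _ _ HK0) HK HH0 HH HX HMn0 HMn HXb).
clear HAb HXb. set (TT := target1 r M N + target2 r M N q) in *.
set (t := sqrt q) in *. assert (Ht : 0 < t) by (apply sqrt_lt_R0; lra).
assert (Htt : t * t = q) by (apply sqrt_sqrt; lra).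
set (E := M * N ^ 2 / (q * t)) in *.
assert (HEq : E * (q * t) = M * N ^ 2) by (unfold E; field; split; lra).
assert (HE0 : 0 <= E).
{ unfold E; apply Rmult_le_pos; [Rnonneg|]. apply Rlt_le, Rinv_0_lt_compat; nra. }
assert (HKMN : K * (M * N) <= c1 * q).
{ apply Rle_trans with (c1 * (q / (M * N)) * (M * N)).
  - apply Rmult_le_compat_r; [nra|exact HK].
  - right; field; split; lra. }
assert (HWV : L * (2 * B0) + K * (L * (2 * B0 * (8 * (Mn * L / q)))) <= 68 * c1 * B0 * N).
{ assert (L * (2 * B0) <= 4 * c1 * B0 * N).
  { assert (L * B0 <= 2 * N * B0) by (apply Rmult_le_compat_r; lra).
    assert (0 <= N * B0) by (apply Rmult_le_pos; lra).
    assert (N * B0 <= c1 * (N * B0)) by nra. lra. }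
  assert (K * (L * (2 * B0 * (8 * (Mn * L / q)))) <= 64 * c1 * B0 * N); [|lra].
  replace (K * (L * (2 * B0 * (8 * (Mn * L / q))))) with (16 * B0 * (K * Mn * (L * L)) / q) by (field; lra).
  apply div_le; [lra|].
  assert (HLL : L * L <= 4 * (N * N)) by nra.
  assert (HKM : K * Mn <= K * M) by (apply Rmult_le_compat_l; lra).
  assert (0 <= K * Mn) by (apply Rmult_le_pos; lra).
  assert (K * Mn * (L * L) <= K * M * (4 * (N * N))).
  { apply Rmult_le_compat; try lra. apply Rmult_le_pos; lra. }
  assert (K * M * (4 * (N * N)) <= 4 * (c1 * q) * N).
  { replace (K * M * (4 * (N * N))) with (4 * (K * (M * N)) * N) by ring.
    apply Rmult_le_compat_r; lra. }
  replace (64 * c1 * B0 * N * q) with (16 * B0 * (4 * (c1 * q) * N)) by ring.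
  apply Rmult_le_compat_l; lra. }
assert (HEX : 0 <= E * X) by (apply Rmult_le_pos; assumption).
apply Rle_trans with (136 * c1 * B0 * (E * X) + M * t * D).
- apply Rmult_le_reg_l with (K * q); [apply Rmult_lt_0_compat; lra|].
  replace (K * q * Sg) with (K * (q * Sg)) by ring. apply Rle_trans with (1 := HS).
  assert (H1 : (L * (2 * B0) + K * (L * (2 * B0 * (8 * (Mn * L / q))))) * X <= 68 * c1 * B0 * N * X)
    by (apply Rmult_le_compat_r; lra).
  assert (H2 : Mn * q * K * D <= M * q * K * D).
  { apply Rmult_le_compat_r; [exact HD|]. apply Rmult_le_compat_r; [lra|].
    apply Rmult_le_compat_r; lra. }
  apply Rle_trans with (t * (68 * c1 * B0 * N * X + M * q * K * D)).
  { apply Rmult_le_compat_l; lra. }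
  replace (K * q * (136 * c1 * B0 * (E * X) + M * t * D))
    with (136 * c1 * B0 * X * (K * q * E) + t * (M * q * K * D)) by ring.
  rewrite Rmult_plus_distr_l; apply Rplus_le_compat_r.
  replace (t * (68 * c1 * B0 * N * X)) with (136 * c1 * B0 * X * (t * N / 2)) by field.
  apply Rmult_le_compat_l.
  { Rnonneg. }
  apply Rmult_le_reg_r with t; [exact Ht|].
  replace (K * q * E * t) with (K * (M * N ^ 2)) by (rewrite <- HEq; ring).
  replace (t * N / 2 * t) with (q * N / 2) by (rewrite <- Htt; field).
  replace (K * (M * N ^ 2)) with (K * (2 * (M * N)) * N / 2) by field.
  unfold Rdiv; apply Rmult_le_compat_r; [lra|]. apply Rmult_le_compat_r; lra.
- apply Rplus_le_compat_r.
  replace (136 * c1 * A * B0 * y ^ 2 * TT) with (136 * c1 * B0 * (A * y ^ 2 * TT)) by ring.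
  apply Rmult_le_compat_l; [Rnonneg|exact HE].
Qed.

(** K is the integer part of q/(MN), but at least 1: MN <= c1 q allows q/(MN) < 1, and [c1] absorbs
    the difference. [H1] is the integer part of y q/N, and K M is at most c1 q/N. *)
Lemma class_parameters (q M N c1 y : R) (Mn : nat) : 1 <= q -> 1 <= M -> 1 <= N -> 1 <= c1 ->
  1 <= y -> M * N <= c1 * q -> INR Mn <= M ->
  exists K H1 : nat, (0 < K)%nat /\ INR K <= q /\ INR K <= c1 * (q / (M * N)) /\
    q <= INR K * (2 * (M * N)) /\ y * (q / N) <= INR (S H1) /\
    INR (H1 + K * Mn) <= (1 + c1) * y * (q / N).
Proof.
intros Hq HM HN Hc1 Hy HMN HMn.
assert (HMN1 : 1 <= M * N) by nra.
assert (Hk0 : 0 < q / (M * N)) by (apply Rdiv_lt_0_compat; lra).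
assert (Hg0 : 0 < q / N) by (apply Rdiv_lt_0_compat; lra).
assert (Hk1 : 1 <= c1 * (q / (M * N))).
{ replace (c1 * (q / (M * N))) with (c1 * q / (M * N)) by (field; split; lra). apply le_div; lra. }
assert (Hkq : q / (M * N) <= q) by (apply div_le; nra).
destruct (nfloor_ex (q / (M * N))) as [k Hk]; [lra|].
destruct (nfloor_ex (y * (q / N))) as [h Hh]; [apply Rmult_le_pos; lra|].
set (K := Nat.max 1 k).
assert (HK1 : 1 <= INR K) by (unfold K; replace 1 with (INR 1) by reflexivity; apply le_INR; lia).
assert (HKk : INR k <= INR K) by (unfold K; apply le_INR; lia).
assert (HKc : INR K = 1 \/ INR K = INR k).
{ unfold K; destruct (Nat.max_spec 1 k) as [[_ ->]|[_ ->]]; [right; reflexivity|left; reflexivity]. }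
assert (HKle : INR K <= c1 * (q / (M * N))) by (destruct HKc as [-> | ->]; nra).
exists K, h. split; [unfold K; lia|].
split; [destruct HKc as [-> | ->]; lra|]. split; [exact HKle|].
split.
{ assert (E : q = q / (M * N) * (M * N)) by (field; split; lra). rewrite E at 1.
  replace (INR K * (2 * (M * N))) with (2 * INR K * (M * N)) by ring.
  apply Rmult_le_compat_r; lra. }
split; [rewrite S_INR; lra|].
rewrite plus_INR, mult_INR.
assert (INR K * INR Mn <= c1 * (q / N)).
{ apply Rle_trans with (c1 * (q / (M * N)) * M).
  - apply Rmult_le_compat; try lra; apply pos_INR.
  - right; field; split; lra. }
assert (c1 * (q / N) <= c1 * y * (q / N)).
{ apply Rmult_le_compat_r; nra. }
nra.
Qed.

Lemma large_power (al A : R) : 0 < al -> exists Q, 1 <= Q /\ forall q, Q <= q -> A <= Rpower q al.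
Proof.
intros Hal. set (B := Rmax A 1). assert (HB : 1 <= B) by apply Rmax_r.
exists (Rmax 1 (Rpower B (/ al))). split; [apply Rmax_l|]. intros q Hq.
assert (Hq1 : Rpower B (/ al) <= q) by (apply Rle_trans with (2 := Hq), Rmax_r).
apply Rle_trans with B; [apply Rmax_l|].
replace B with (Rpower (Rpower B (/ al)) al).
2: { rewrite Rpower_mult, Rinv_l, Rpower_1; lra. }
apply Rle_Rpower_l; [lra|]. split; [apply exp_pos|exact Hq1].
Qed.

Lemma ln_le_self (x : R) : 0 < x -> ln x <= x.
Proof.
intros Hx. assert (H := exp_ineq1_le (ln x)). rewrite exp_ln in H by assumption. lra.
Qed.

(** With z = q^(de/4), the inequality ln z <= z gives l + 1 <= c z. For large q also c <= z, so (l +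
    1)^2 <= z^4 = q^de. *)
Lemma log_square_small (de A : R) : 0 < de -> 1 <= A -> exists Q, 1 <= Q /\ forall q, Q <= q ->
  forall l : nat, 2 ^ l <= A * q -> (INR l + 1) * (INR l + 1) <= Rpower q de.
Proof.
intros Hde HA.
set (b := de / 4). assert (Hb : 0 < b) by (unfold b; lra).
assert (Hl2 : 0 < ln 2) by (rewrite <- ln_1; apply ln_increasing; lra).
set (c := 1 + ln A / ln 2 + / (b * ln 2)).
destruct (large_power b c Hb) as [Q [HQ1 HQ]].
exists Q; split; [exact HQ1|]. intros q Hq l Hl.
assert (Hq1 : 1 <= q) by lra.
set (z := Rpower q b). assert (Hz : c <= z) by (apply HQ, Hq).
assert (HlnA : 0 <= ln A).
{ rewrite <- ln_1; destruct (Req_dec A 1) as [->|Hn]; [lra|]. apply Rlt_le, ln_increasing; lra. }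
assert (Hz1 : 1 <= z).
{ apply Rle_trans with (2 := Hz). unfold c.
  assert (0 <= ln A / ln 2) by (apply Rmult_le_pos; [lra|]; apply Rlt_le, Rinv_0_lt_compat, Hl2).
  assert (0 < / (b * ln 2)) by (apply Rinv_0_lt_compat, Rmult_lt_0_compat; assumption). lra. }
assert (Hlnq : b * ln q <= z).
{ assert (H := ln_le_self z (exp_pos _)). unfold z at 1, Rpower in H. rewrite ln_exp in H. exact H. }
assert (Hlog : INR l * ln 2 <= ln A + ln q).
{ rewrite <- ln_mult, <- ln_pow by lra. destruct Hl as [Hl|Hl].
  - apply Rlt_le, ln_increasing; [apply pow_lt; lra|exact Hl].
  - rewrite Hl; lra. }
assert (Hl1 : INR l + 1 <= c * z).
{ unfold c. apply Rmult_le_reg_r with (ln 2); [exact Hl2|].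
  replace ((1 + ln A / ln 2 + / (b * ln 2)) * z * ln 2) with (z * ln 2 + ln A * z + z / b)
    by (field; split; lra).
  assert (ln q <= z / b) by (apply le_div; [exact Hb|]; lra).
  assert (ln A <= ln A * z) by nra. assert (ln 2 <= z * ln 2) by nra. nra. }
assert (Hlz : INR l + 1 <= z * z) by (assert (Hp := pos_INR l); nra).
assert (Hp := pos_INR l).
apply Rle_trans with ((z * z) * (z * z)); [nra|].
right. unfold z. rewrite <- !Rpower_plus. f_equal. unfold b; field.
Qed.

(** The two j-th powers multiply to at most y^(-j) <= q^(-3). Against this stand M (L + j) = O(q),
    sqrt q <= q and a constant that is at most q. *)
Lemma decay_small (de c1 : R) (j : nat) (Cj : R) : 0 < de -> 1 <= c1 -> 3 <= de * INR j -> 0 <= Cj ->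
  exists Q, 1 <= Q /\ forall q M N L y h : R, Q <= q -> 1 <= M -> 1 <= N -> M * N <= c1 * q ->
   0 <= L -> L <= 2 * N -> y = Rpower q de -> y * (q / N) <= h ->
   M * sqrt q * ((L + INR j) * (2 * (Cj * (2 / N) ^ j)) * (q / (2 * h)) ^ j) <= 1.
Proof.
intros Hde Hc1 Hj HCj.
set (c := 2 * Cj * (2 + INR j) * c1).
exists (Rmax 1 c); split; [apply Rmax_l|].
intros q M N L y h HQ HM HN HMN HL0 HL -> Hh.
assert (Hq1 : 1 <= q) by (apply Rle_trans with (2 := HQ), Rmax_l).
assert (Hqc : c <= q) by (apply Rle_trans with (2 := HQ), Rmax_r).
set (y := Rpower q de) in *. assert (Hy : 0 < y) by apply exp_pos.
assert (Hg : 0 < q / N) by (apply Rdiv_lt_0_compat; lra).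
assert (Hh0 : 0 < h) by nra.
assert (Hsq : sqrt q <= q).
{ rewrite <- (sqrt_sqrt q) at 2 by lra. assert (1 <= sqrt q) by (rewrite <- sqrt_1; apply sqrt_le_1; lra). nra. }
assert (Hsq0 := sqrt_pos q).
assert (Hyj : q ^ 3 <= y ^ j).
{ rewrite <- !Rpower_pow by (try apply exp_pos; lra). unfold y; rewrite Rpower_mult.
  apply Rle_Rpower; [lra|]. simpl (INR 3). lra. }
assert (Hfac : (2 / N) ^ j * (q / (2 * h)) ^ j * q ^ 3 <= 1).
{ rewrite <- Rpow_mult_distr.
  apply Rle_trans with ((2 / N * (q / (2 * h))) ^ j * y ^ j).
  - apply Rmult_le_compat_l; [|exact Hyj]. apply pow_le, Rmult_le_pos; apply Rlt_le, Rdiv_lt_0_compat; lra.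
  - rewrite <- Rpow_mult_distr. apply Rle_trans with (1 ^ j); [apply pow_incr|rewrite pow1; lra].
    replace (2 / N * (q / (2 * h)) * y) with (y * (q / N) / h) by (field; split; lra).
    split; [apply Rlt_le, Rdiv_lt_0_compat; nra|]. apply div_le; lra. }
set (F := (2 / N) ^ j * (q / (2 * h)) ^ j) in *.
assert (HF0 : 0 <= F).
{ unfold F; apply Rmult_le_pos; apply pow_le, Rlt_le, Rdiv_lt_0_compat; lra. }
replace (M * sqrt q * ((L + INR j) * (2 * (Cj * (2 / N) ^ j)) * (q / (2 * h)) ^ j))
  with (M * (L + INR j) * sqrt q * (2 * Cj) * F) by (unfold F; ring).
assert (Hpj := pos_INR j).
assert (HML : M * (L + INR j) <= (2 + INR j) * (c1 * q)).
{ assert (M <= M * N) by nra. nra. }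
assert (HML0 : 0 <= M * (L + INR j)) by (apply Rmult_le_pos; lra).
assert (H3 : M * (L + INR j) * sqrt q <= (2 + INR j) * (c1 * q) * q) by (apply Rmult_le_compat; lra).
assert (H4 : M * (L + INR j) * sqrt q * (2 * Cj) <= q ^ 3).
{ apply Rle_trans with ((2 + INR j) * (c1 * q) * q * (2 * Cj)).
  - apply Rmult_le_compat_r; lra.
  - replace ((2 + INR j) * (c1 * q) * q * (2 * Cj)) with (c * (q * q)) by (unfold c; ring).
    replace (q ^ 3) with (q * (q * q)) by ring. apply Rmult_le_compat_r; nra. }
apply Rle_trans with (2 := Hfac).
rewrite Rmult_comm. apply Rmult_le_compat_l; assumption.
Qed.

Lemma one_le_Rpower (x a : R) : 1 <= x -> 0 <= a -> 1 <= Rpower x a.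
Proof. intros Hx Ha; rewrite <- (Rpower_O x) by lra; apply Rle_Rpower; assumption. Qed.

Lemma inv_INR_S_bounds (r : nat) : 0 < 1 / (2 * INR (S r)) <= 1 / 2.
Proof.
assert (H := pos_INR r). rewrite S_INR. split.
- apply Rdiv_lt_0_compat; lra.
- apply div_le; lra.
Qed.

Lemma le_M_target1 (r : nat) (M N : R) : 1 <= M -> 1 <= N -> M <= target1 r M N.
Proof.
intros HM HN. assert (H := inv_INR_S_bounds r). unfold target1.
assert (H2 := one_le_Rpower N (1/2 + 1 / (2 * INR (S r))) HN ltac:(lra)).
assert (H1 : M <= Rpower M (3/2 - 1 / (2 * INR (S r)))).
{ rewrite <- (Rpower_1 M) at 1 by lra. apply Rle_Rpower; lra. }
nra.
Qed.

(** [target1] equals MN (M/N)^a with a = 1/2 - 1/(2(r+1)) >= 0. For N <= M it dominates the trivial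
    bound. *)
Lemma mul_le_target1 (r : nat) (M N : R) : 1 <= N -> N <= M -> M * N <= target1 r M N.
Proof.
intros HN HNM. assert (H := inv_INR_S_bounds r). unfold target1.
set (a := 1/2 - 1 / (2 * INR (S r))).
replace (3/2 - 1 / (2 * INR (S r))) with (1 + a) by (unfold a; lra).
replace (1/2 + 1 / (2 * INR (S r))) with (1 + - a) by (unfold a; lra).
rewrite !Rpower_plus, !Rpower_1, Rpower_Ropp by lra.
assert (Ha : Rpower N a <= Rpower M a) by (apply Rle_Rpower_l; [unfold a; lra|lra]).
assert (Hp : 0 < Rpower N a) by apply exp_pos.
assert (1 <= Rpower M a / Rpower N a) by (apply le_div; lra).
replace (M * Rpower M a * (N * / Rpower N a)) with (M * N * (Rpower M a / Rpower N a))
  by (unfold Rdiv; ring).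
rewrite <- (Rmult_1_r (M * N)) at 1. apply Rmult_le_compat_l; [nra|assumption].
Qed.

Lemma target_mono (r : nat) (M N N' q : R) : 1 <= M -> 0 < N -> N <= N' -> 1 <= q ->
  target1 r M N + target2 r M N q <= target1 r M N' + target2 r M N' q.
Proof.
intros HM HN HNN Hq. assert (H := inv_INR_S_bounds r). unfold target1, target2.
assert (H1 : Rpower N (1/2 + 1 / (2 * INR (S r))) <= Rpower N' (1/2 + 1 / (2 * INR (S r))))
  by (apply Rle_Rpower_l; lra).
assert (H2 : Rpower N (1 / (2 * INR (S r))) <= Rpower N' (1 / (2 * INR (S r))))
  by (apply Rle_Rpower_l; lra).
apply Rplus_le_compat.
- apply Rmult_le_compat_l; [apply Rlt_le, exp_pos|exact H1].
- apply Rmult_le_compat_r; [apply Rlt_le, exp_pos|].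
  apply Rmult_le_compat_l; [apply Rlt_le, exp_pos|exact H2].
Qed.

(** * Rows of the double sum and their distribution over classes *)

Definition row_sum (q a b lam : Z) (Nn : nat) (u v : R -> R) (m : nat) : C :=
  Csum 0 Nn (fun n => Cmult (cfun u v (INR n)) (inner_sum q a b lam (Z.of_nat m) (Z.of_nat n))).

Definition rsum (n : nat) (f : nat -> R) : R := sum_n_m (G := R_AbelianMonoid) f 1 n.

Lemma rsum_O f : rsum 0 f = 0.
Proof. apply (sum_n_m_zero (G := R_AbelianMonoid)); lia. Qed.

Lemma rsum_S n f : rsum (S n) f = rsum n f + f (S n).
Proof. apply (sum_n_Sm (G := R_AbelianMonoid)); lia. Qed.

Lemma rsum_le n f g : (forall m, (1 <= m)%nat -> (m <= n)%nat -> f m <= g m) -> rsum n f <= rsum n g.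
Proof.
induction n as [|n IH]; intros H; [rewrite !rsum_O; lra|].
rewrite !rsum_S; apply Rplus_le_compat; [apply IH; intros; apply H; lia | apply H; lia].
Qed.

Lemma rsum_const n c : rsum n (fun _ => c) = INR n * c.
Proof.
induction n as [|n IH]; [rewrite rsum_O; simpl; ring|]. rewrite rsum_S, IH, S_INR; ring.
Qed.

Lemma rsum_plus n f g : rsum n (fun m => f m + g m) = rsum n f + rsum n g.
Proof.
induction n as [|n IH]; [rewrite !rsum_O; ring|]. rewrite !rsum_S, IH; ring.
Qed.

Lemma rsum_scal n c f : rsum n (fun m => c * f m) = c * rsum n f.
Proof.
induction n as [|n IH]; [rewrite !rsum_O; ring|]. rewrite !rsum_S, IH; ring.
Qed.

Lemma rsum_le_select n (sel : nat -> bool) f c B : 0 <= c -> INR n <= B ->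
  (forall m, (1 <= m)%nat -> (m <= n)%nat -> sel m = true -> f m <= c) ->
  rsum n (fun m => if sel m then f m else 0) <= B * c.
Proof.
intros Hc HB Hf. apply Rle_trans with (INR n * c).
- rewrite <- rsum_const. apply rsum_le. intros m H1 H2.
  destruct (sel m) eqn:E; [apply Hf; assumption|exact Hc].
- apply Rmult_le_compat_r; assumption.
Qed.

Lemma rsum_cover n I (sel : nat -> nat -> bool) f B : (forall m, 0 <= f m) ->
  (forall m, (1 <= m)%nat -> (m <= n)%nat -> exists i, (i <= I)%nat /\ sel i m = true) ->
  (forall i, (i <= I)%nat -> rsum n (fun m => if sel i m then f m else 0) <= B) ->
  rsum n f <= INR (S I) * B.
Proof.
intros Hf Hc HB.
apply Rle_trans with (rsum n (fun m => sum_f_R0 (fun i => if sel i m then f m else 0) I)).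
- apply rsum_le; intros m H1 H2. destruct (Hc m H1 H2) as [i [Hi Hs]]. clear Hc HB.
  assert (Hp : forall k, 0 <= sum_f_R0 (fun i => if sel i m then f m else 0) k).
  { intros k; apply cond_pos_sum; intros i'; destruct (sel i' m); [apply Hf|lra]. }
  induction I as [|I IH].
  + replace i with 0%nat in Hs by lia. simpl; rewrite Hs; lra.
  + rewrite tech5. destruct (Nat.eq_dec i (S I)) as [->|Hn].
    * rewrite Hs; specialize (Hp I); lra.
    * assert (H := IH ltac:(lia)). assert (Hfm := Hf m). destruct (sel (S I) m); lra.
- clear Hc. induction I as [|I IH].
  + simpl. rewrite Rmult_1_l. apply (HB 0%nat); lia.
  + rewrite S_INR, Rmult_plus_distr_r, Rmult_1_l.
    apply Rle_trans with (rsum n (fun m => sum_f_R0 (fun i => if sel i m then f m else 0) I)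
       + rsum n (fun m => if sel (S I) m then f m else 0)).
    * rewrite <- rsum_plus. apply rsum_le; intros m _ _. rewrite tech5; lra.
    * apply Rplus_le_compat; [apply IH; intros; apply HB; lia|apply HB; lia].
Qed.

Lemma pow_two_between x : 1 <= x -> exists l : nat, x <= 2 ^ l <= 2 * x.
Proof.
intros Hx. assert (H : exists n : nat, x <= 2 ^ n).
{ destruct (nfloor_ex x) as [n [_ Hn]]; [lra|]. exists (S n).
  apply Rle_trans with (INR (S n)); [rewrite S_INR; lra|]. clear.
  induction (S n) as [|k IH]; [simpl; lra|]. rewrite S_INR; simpl.
  assert (1 <= 2 ^ k) by (apply pow_R1_Rle; lra). lra. }
destruct H as [n Hn]. induction n as [|n IH].
- exists 0%nat; simpl in *; lra.
- destruct (Rle_dec x (2 ^ n)) as [H|H]; [apply IH, H|].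
  exists (S n); simpl in *; lra.
Qed.

Lemma dyadic_level n x N : x <= N -> N / 2 ^ n < x ->
  exists i, (i < n)%nat /\ N / 2 ^ S i < x <= N / 2 ^ i.
Proof.
intros Hx. induction n as [|n IH]; intros Hn.
- simpl in Hn; lra.
- destruct (Rlt_dec (N / 2 ^ n) x) as [H|H].
  + destruct (IH H) as [i [Hi Hb]]; exists i; split; [lia|exact Hb].
  + exists n; split; [lia|lra].
Qed.

Lemma cfun_support (u v : R -> R) n x : (forall y, cfun u v y <> RtoC 0 -> 0 <= y <= n) ->
  x < 0 \/ n < x -> u x = 0 /\ v x = 0.
Proof.
intros H Hx.
assert (E : cfun u v x = RtoC 0 \/ cfun u v x <> RtoC 0).
{ destruct (Req_dec (u x) 0) as [H1|H1]; [destruct (Req_dec (v x) 0) as [H2|H2]|].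
  - left; unfold cfun, RtoC; congruence.
  - right; intros E; injection E; tauto.
  - right; intros E; injection E; tauto. }
destruct E as [E|E].
- injection E; auto.
- specialize (H x E); lra.
Qed.

Lemma le_Rabs_div_pow c n j x N : 0 < n -> 0 < N -> N / 2 < n -> x <= c / n ^ j ->
  x <= Rabs c * (2 / N) ^ j.
Proof.
intros Hn HN HNn Hx. apply Rle_trans with (1 := Hx).
assert (Hnj : 0 < / n ^ j) by (apply Rinv_0_lt_compat, pow_lt, Hn).
unfold Rdiv at 1. apply Rle_trans with (Rabs c * / n ^ j).
- apply Rmult_le_compat_r; [lra|apply Rle_abs].
- apply Rmult_le_compat_l; [apply Rabs_pos|]. rewrite <- pow_inv.
  apply pow_incr; split; [apply Rlt_le, Rinv_0_lt_compat, Hn|].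
  apply le_div; [exact HN|]. apply Rmult_le_reg_l with n; [exact Hn|].
  replace (n * (/ n * N)) with N by (field; lra). lra.
Qed.

(* The module keeps the MathComp scopes and notations away from the final statement. *)
Module CharacterSums.
From mathcomp Require Import all_boot all_order all_algebra.
From mathcomp Require Import closed_field finfield separable.
From mathcomp Require Import ring lra zify.
Set Implicit Arguments. Unset Strict Implicit. Unset Printing Implicit Defensive.
Import Order.TTheory GRing.Theory Num.Theory.
Local Close Scope R_scope.
Local Open Scope ring_scope.

(** * Power sums *)

Definition psum (F : comNzRingType) (s : seq F) (k : nat) : F := \sum_(a <- s) a ^+ k.

(** Indexed by reciprocal roots, so the constant term is 1 and zeros in [s] change nothing; the list
    can be padded to a prescribed length. *)
Definition rprod (F : comNzRingType) (s : seq F) : {poly F} :=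
  \prod_(a <- s) (1 - a *: 'X).

Lemma coef_rprod_cons (F : comNzRingType) (a : F) (s : seq F) n :
  (rprod (a :: s))`_n.+1 = (rprod s)`_n.+1 - a * (rprod s)`_n.
Proof.
by rewrite /rprod big_cons mulrBl mul1r coefB -scalerAl coefZ coefXM.
Qed.

Lemma coef0_rprod (F : comNzRingType) (s : seq F) : (rprod s)`_0 = 1.
Proof.
rewrite /rprod -horner_coef0 horner_prod big1 // => a _.
by rewrite !hornerE ?mulr0 subr0.
Qed.

Lemma geometric_rprod (F : comNzRingType) (a : F) (s : seq F) n :
  \sum_(m < n.+1) a ^+ m * (rprod (a :: s))`_(n - m) = (rprod s)`_n.
Proof.
elim: n => [|n IHn].
  by rewrite big_ord_recl big_ord0 addr0 expr0 mul1r !coef0_rprod.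
rewrite big_ord_recl expr0 mul1r subn0 coef_rprod_cons.
rewrite -[in RHS](subrK (a * (rprod s)`_n) (rprod s)`_n.+1); congr (_ + _).
rewrite -IHn mulr_sumr; apply: eq_bigr => m _ /=.
by rewrite /bump /= add1n subSS exprS mulrA.
Qed.

(** Newton's identities by induction on the list: a new entry adds its powers to the power sums, and
    the resulting convolution with [rprod] is a product with 1/(1 - aT), evaluated by
    [geometric_rprod]. *)
Lemma newton_power_sums (F : comNzRingType) (s : seq F) n :
  n%:R * (rprod s)`_n = - \sum_(m < n) psum s m.+1 * (rprod s)`_(n - m.+1).
Proof.
elim: s n => [|a s IHs] [|n]; rewrite ?mul0r ?big_ord0 ?oppr0 //.
  rewrite /rprod big_nil coef1 mulr0 big1 ?oppr0 // => m _.
  by rewrite /psum big_nil mul0r.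
have Psplit m : psum (a :: s) m = a ^+ m + psum s m by rewrite /psum big_cons.
have E1 : \sum_(m < n.+1) psum s m.+1 * (rprod (a :: s))`_(n.+1 - m.+1)
  = - (n.+1)%:R * (rprod s)`_n.+1 + a * (n%:R * (rprod s)`_n).
  rewrite IHs mulNr IHs opprK mulrN mulr_sumr.
  rewrite big_ord_recr /= [in RHS]big_ord_recr /= subnn !coef0_rprod addrAC.
  congr (_ + _); rewrite -sumrB; apply: eq_bigr => m _ /=.
  have -> : (n.+1 - m.+1 = (n - m.+1).+1)%N by rewrite subSn ?ltn_ord.
  rewrite coef_rprod_cons; ring.
have E2 : \sum_(m < n.+1) a ^+ m.+1 * (rprod (a :: s))`_(n.+1 - m.+1)
  = a * (rprod s)`_n.
  rewrite -(geometric_rprod a) mulr_sumr; apply: eq_bigr => m _.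
  by rewrite subSS exprS mulrA.
under eq_bigr => m _ do rewrite Psplit mulrDl.
rewrite big_split /= E1 E2 coef_rprod_cons -[n.+1%:R]natr1; ring.
Qed.

(** The term of highest index enters with coefficient 1, so the recursion determines [S]; Newton's
    identities are the same recursion up to sign. *)
Lemma power_sums_of_recursion (F : numFieldType) (s : seq F) (S : nat -> F) :
  (forall n, n%:R * (rprod s)`_n = \sum_(m < n) S m.+1 * (rprod s)`_(n - m.+1)) ->
  forall n, S n.+1 = - psum s n.+1.
Proof.
move=> Srec n; elim/ltn_ind: n => n IHn.
have := newton_power_sums s n.+1; rewrite Srec !big_ord_recr /= subnn coef0_rprod.
rewrite !mulr1 opprD -sumrN.
under [in LHS]eq_bigr => m _ do rewrite IHn // mulNr.
exact: addrI.
Qed.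

(** Roots are split off by X - z = -z (1 - X/z), where z is nonzero because p(0) = 1. Zeros fill the
    list up to length [n]. *)
Lemma rprod_surj (F : closedFieldType) (p : {poly F}) n : p`_0 = 1 ->
  (size p <= n.+1)%N -> exists2 s : seq F, size s = n & p = rprod s.
Proof.
elim: n p => [|n IHn] p p0 szp.
  exists [::] => //; rewrite /rprod big_nil.
  by rewrite (size1_polyC szp) p0.
case: (leqP (size p) 1) => [/size1_polyC pC|sz1].
  exists (nseq n.+1 0); first by rewrite size_nseq.
  rewrite pC p0 /rprod big1_seq // => a /andP[_ /nseqP[-> _]].
  by rewrite scale0r subr0.
have [z pz] := closed_rootP p (negbT (gtn_eqF sz1)).
have [r pE] := factor_theorem p z pz.
have p0E : r`_0 * - z = 1.
  by rewrite -p0 pE -!horner_coef0 hornerM !hornerE ?sub0r.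
have z0 : z != 0.
  by apply: contra_eq_neq p0E => ->; rewrite oppr0 mulr0 eq_sym oner_eq0.
have r0 : r != 0.
  by apply: contra_eq_neq p0E => ->; rewrite coef0 mul0r eq_sym oner_eq0.
have [s szs rE] : exists2 s : seq F, size s = n & - z *: r = rprod s.
  apply: IHn; first by rewrite coefZ mulrC.
  rewrite size_scale ?oppr_eq0 //.
  by move: szp; rewrite pE size_Mmonic ?monicXsubC // size_XsubC addn2.
exists (z^-1 :: s); first by rewrite /= szs.
rewrite /rprod big_cons -/(rprod s) -rE pE -scalerAr mulrC scalerAl; congr (_ * _).
by rewrite scalerBr scalerA mulNr divff // scaleN1r opprK -polyC1 scale_polyC mulr1 polyCN addrC.
Qed.

Section Bound.
Variable C : numClosedFieldType.
Hypothesis C_archi : forall x : C, exists n : nat, `|x| <= n%:R.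

(** Bernoulli's inequality: if |x| > 1, the powers grow at least linearly and pass B. The
    Archimedean property is a hypothesis because a [numClosedFieldType] may contain infinite
    elements. *)
Lemma bounded_powers_le1 (x B : C) k0 :
  (forall k, (k0 <= k)%N -> `|x| ^+ k <= B) -> `|x| <= 1.
Proof.
move=> xB; case: (real_leP (normr_real x) (@real1 C)) => // x1.
have d_gt0 : 0 < `|x| - 1 by rewrite subr_gt0.
have bern k : 1 + k%:R * (`|x| - 1) <= `|x| ^+ k.
  elim: k => [|k IHk]; first by rewrite mul0r addr0 expr0.
  rewrite exprS; apply: le_trans (ler_wpM2l (normr_ge0 _) IHk).
  rewrite -subr_ge0 -natr1.
  have -> : `|x| * (1 + k%:R * (`|x| - 1)) - (1 + (k%:R + 1) * (`|x| - 1))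
    = k%:R * (`|x| - 1) ^+ 2 by ring.
  by rewrite mulr_ge0 ?ler0n // exprn_ge0 // ltW.
have [n nP] := C_archi (B / (`|x| - 1)).
have B0 : 0 <= B by apply: le_trans (xB _ (leqnn _)); rewrite exprn_ge0.
have := le_trans (bern (n + k0)%N) (xB _ (leq_addl _ _)).
rewrite ger0_norm ?divr_ge0 ?(ltW d_gt0) // ler_pdivrMr // in nP.
have h : n%:R * (`|x| - 1) <= (n + k0)%:R * (`|x| - 1).
  by rewrite ler_wpM2r ?ler_nat ?leq_addr // ltW.
move=> h2; have := le_trans h2 (le_trans nP h).
by rewrite gerDr ler10.
Qed.

(* The weights W_j isolate the powers of one a, which are then bounded. *)
Lemma power_sums_bounded_le1 (s : seq C) (B : C) k0 :
  (forall k, (k0 <= k)%N -> `|psum s k| <= B) ->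
  forall a, a \in s -> `|a| <= 1.
Proof.
move=> sB a a_s; pose W : {poly C} := \prod_(b <- s | b != a) ('X - b%:P).
have Wa : W.[a] != 0.
  rewrite horner_prod prodf_seq_neq0; apply/allP => b _; apply/implyP => ba.
  by rewrite !hornerE subr_eq0 eq_sym.
have key k : (count_mem a s)%:R * W.[a] * a ^+ k
  = \sum_(j < size W) W`_j * psum s (k + j).
  transitivity (\sum_(b <- s) W.[b] * b ^+ k); last first.
    under eq_bigr => b _ do rewrite horner_coef mulr_suml.
    rewrite exchange_big; apply: eq_bigr => j _; rewrite mulr_sumr.
    by apply: eq_bigr => b _; rewrite -mulrA -exprD addnC.
  rewrite (bigID (pred1 a)) /= [X in _ + X]big1_seq ?addr0; last first.
    move=> b /andP[ba bs]; rewrite horner_prod (big_rem b) //= ba !hornerE.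
    by rewrite subrr !mul0r.
  rewrite (eq_bigr (fun=> W.[a] * a ^+ k)); last by move=> b /eqP->.
  by rewrite big_const_seq iter_addr addr0 -mulrA mulr_natl.
pose B' := (\sum_(j < size W) `|W`_j|) * B / `|W.[a]|.
apply: (@bounded_powers_le1 a B' k0) => k lek.
rewrite ler_pdivlMr ?normr_gt0 // -normrX mulrC -normrM.
apply: le_trans (_ : `|(count_mem a s)%:R * W.[a] * a ^+ k| <= _).
  rewrite -mulrA [leRHS]normrM ler_peMl // normr_nat ler1n -has_count.
  by apply/hasP; exists a => //=.
rewrite key mulr_suml (le_trans (ler_norm_sum _ _ _)) // ler_sum // => j _.
by rewrite normrM ler_wpM2l // sB // (leq_trans lek) ?leq_addr.
Qed.

End Bound.

(** * The L-function of a multiplicative function on polynomials *)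

Section Closure.
Variables (p : nat) (p_pr : prime p) (K : closedFieldType).
Variable emb : {rmorphism 'F_p -> K}.

Lemma pchar_closure : p \in [pchar K].
Proof. by rewrite (GRing.fmorph_pchar emb) pchar_Fp. Qed.

Definition frob : {rmorphism K -> K} := pFrobenius_aut pchar_closure.

Lemma frobE x : frob x = x ^+ p. Proof. exact: pFrobenius_autE. Qed.

Lemma Fp_expp (a : 'F_p) : a ^+ p = a.
Proof. by have := expf_card a; rewrite card_Fp. Qed.

Lemma frob_iota a : frob (emb a) = emb a.
Proof. by rewrite frobE -rmorphXn /= Fp_expp. Qed.

Lemma frobX (n : nat) (x y : K) : x ^+ (p ^ n) = y ^+ (p ^ n) -> x = y.
Proof.
elim: n => [|n IHn]; first by rewrite expn0 !expr1.
by rewrite expnSr !exprM -!frobE => /fmorph_inj/IHn.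
Qed.

(** A left inverse of [emb]. The default 0 is never reached on fixed points of Frobenius, to which
    it is applied. *)
Definition down (x : K) : 'F_p := odflt 0 [pick a | emb a == x].

Lemma downK a : down (emb a) = a.
Proof.
rewrite /down; case: pickP => [b /eqP/fmorph_inj //|/(_ a)].
by rewrite eqxx.
Qed.

Lemma down_fix x : x ^+ p = x -> emb (down x) = x.
Proof.
move=> xp; rewrite /down; case: pickP => [b /eqP //|nx].
have : (map_poly emb ('X^#|'F_p| - 'X)).[x] = 0.
  by rewrite rmorphB /= map_polyXn map_polyX !hornerE card_Fp ?xp ?subrr.
rewrite finField_genPoly rmorph_prod horner_prod /= => /eqP/prodf_eq0[a _].
rewrite rmorphB /= map_polyX map_polyC !hornerE subr_eq0 => /eqP xa.
by have := nx a; rewrite xa eqxx.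
Qed.

(** The subfield of K with p^(n+1) elements, as the list of roots of X^(p^(n+1)) - X. The index is
    shifted so that every [n] gives a field. *)
Definition ext n : seq K := projT1 (closed_field_poly_normal ('X^(p ^ n.+1) - 'X)).

Lemma ltn_pexp n : (1 < p ^ n.+1)%N.
Proof.
apply: leq_trans (prime_gt1 p_pr) _; rewrite expnS -{1}[p]muln1 leq_mul2l.
by rewrite expn_gt0 prime_gt0 ?orbT.
Qed.

Lemma ext_poly_size n : size ('X^(p ^ n.+1) - 'X : {poly K}) = (p ^ n.+1).+1.
Proof.
by rewrite size_polyDl size_polyXn // size_polyN size_polyX ltnS ltn_pexp.
Qed.

Lemma ext_prod n : 'X^(p ^ n.+1) - 'X = \prod_(z <- ext n) ('X - z%:P) :> {poly K}.
Proof.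
rewrite /ext; case: closed_field_poly_normal => s /= {1}->.
suff -> : lead_coef ('X^(p ^ n.+1) - 'X : {poly K}) = 1 by rewrite scale1r.
rewrite lead_coefDl ?lead_coefXn // size_polyXn size_polyN size_polyX ltnS.
exact: ltn_pexp.
Qed.

Lemma mem_ext n u : (u \in ext n) = (u ^+ (p ^ n.+1) == u).
Proof. by rewrite -root_prod_XsubC -ext_prod rootE !hornerE subr_eq0. Qed.

Lemma uniq_ext n : uniq (ext n).
Proof.
rewrite -separable_prod_XsubC -ext_prod unlock.
rewrite derivB derivXn derivX -scaler_nat.
have -> : (p ^ n.+1)%:R = 0 :> K.
  by rewrite natrX (pcharf0 pchar_closure) expr0n.
by rewrite scale0r sub0r -(scaleN1r 1) coprimepZr ?oppr_eq0 ?oner_eq0 ?coprimep1.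
Qed.

Lemma size_ext n : size (ext n) = (p ^ n.+1)%N.
Proof.
by have := ext_poly_size n; rewrite ext_prod size_prod_XsubC => -[].
Qed.

Definition orbp n (u : K) : {poly K} := \prod_(i < n) ('X - (u ^+ (p ^ i))%:P).

Lemma size_orbp n u : size (orbp n u) = n.+1.
Proof. by rewrite /orbp size_prod_XsubC /= -[index_enum _]enumT size_enum_ord. Qed.

Lemma monic_orbp n u : orbp n u \is monic.
Proof. exact: monic_prod_XsubC. Qed.

Lemma orbp_root n u : root (orbp n.+1 u) u.
Proof.
by rewrite /orbp big_ord_recl rootM root_XsubC expn0 expr1 eqxx.
Qed.

Lemma orbpD m n u : u ^+ (p ^ m) = u -> orbp (m + n) u = orbp m u * orbp n u.
Proof.
move=> um; rewrite /orbp big_split_ord /=; congr (_ * _); apply: eq_bigr => i _.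
by rewrite expnD exprM um.
Qed.

Lemma orbp_frob n u : u ^+ (p ^ n) = u -> map_poly frob (orbp n u) = orbp n u.
Proof.
move=> un; rewrite /orbp map_prod_XsubC; case: n un => [|n] un; first by rewrite !big_ord0.
rewrite big_ord_recr [RHS]big_ord_recl /= frobE -exprM -expnSr un expn0 expr1 mulrC.
by congr (_ * _); apply: eq_bigr => i _; rewrite /= frobE -exprM -expnSr.
Qed.

(** For u in the field of p^n elements this is the characteristic polynomial of u over the prime
    field: always of degree n, hence a proper power of the minimal polynomial when u lies in a
    smaller field. *)
Definition minp n u : {poly 'F_p} := map_poly down (orbp n u).

Lemma minpK n u : u ^+ (p ^ n) = u -> map_poly emb (minp n u) = orbp n u.
Proof.
move=> un; apply/polyP => i; rewrite coef_map /minp coef_map_id0; last first.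
  by rewrite -(rmorph0 emb) downK.
by apply: down_fix; rewrite -frobE -coef_map orbp_frob.
Qed.

Lemma monic_minp n u : u ^+ (p ^ n) = u -> minp n u \is monic.
Proof.
by move=> un; rewrite -(map_monic emb) minpK ?monic_orbp.
Qed.

Lemma size_minp n u : u ^+ (p ^ n) = u -> size (minp n u) = n.+1.
Proof. by move=> un; rewrite -(size_map_poly emb) minpK ?size_orbp. Qed.

Lemma frob_root (f : {poly K}) u i :
  map_poly frob f = f -> root f u -> root f (u ^+ (p ^ i)).
Proof.
move=> ff fu; elim: i => [|i IHi]; first by rewrite expn0 expr1.
by rewrite expnSr exprM -frobE -ff fmorph_root.
Qed.

(** All conjugates of u are roots of f, so two of them coincide, and injectivity of Frobenius
    carries the repetition back to u. *)
Lemma frob_periodic (f : {poly K}) u : f != 0 -> map_poly frob f = f -> root f u ->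
  exists d, u ^+ (p ^ d.+1) == u.
Proof.
move=> f0 ff fu; pose g (i : 'I_(size f)) := u ^+ (p ^ i).
have /injectivePn[i [j ij gij]] : ~~ injectiveb g.
  have all_g : all (root f) (codom g).
    by apply/allP => x /mapP[i _ ->]; apply: frob_root.
  apply/negP => g_inj; have := max_poly_roots f0 all_g g_inj.
  by rewrite size_codom card_ord ltnn.
wlog ltij : i j ij gij / (i < j)%N.
  move=> h; case: (ltngtP i j) => [|ji|/val_inj eij]; first exact: h.
  - by apply: (h j i) => //; rewrite eq_sym.
  - by rewrite eij eqxx in ij.
exists (j - i).-1; rewrite prednK ?subn_gt0 //; apply/eqP/esym/(@frobX i).
by rewrite -exprM -expnD subnK ?(ltnW ltij).
Qed.

Lemma orbp_uniq d (u : K) : (forall i, (0 < i < d)%N -> u ^+ (p ^ i) != u) ->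
  u ^+ (p ^ d) = u -> uniq [seq u ^+ (p ^ i) | i <- iota 0 d].
Proof.
move=> dmin ud; rewrite map_inj_in_uniq ?iota_uniq // => i j.
wlog leij : i j / (i <= j)%N.
  by move=> h; case: (leqP i j) => [|/ltnW] ? ? ? ?; [exact: h | apply/esym/h].
rewrite !mem_iota !add0n => /andP[_ id] /andP[_ jd] eqij.
move: leij; rewrite leq_eqVlt => /predU1P[//|ltij].
have /dmin : (0 < j - i < d)%N by rewrite subn_gt0 ltij (leq_ltn_trans (leq_subr _ _)).
rewrite (_ : _ == _) //; apply/eqP/esym/(@frobX i).
by rewrite -exprM -expnD subnK ?(ltnW ltij).
Qed.

(** If u has degree d, then u lies in the field of p^(m+1) elements exactly when d divides m + 1,
    and [orbp] is then the ((m+1)/d)-th power of the minimal polynomial. It divides f exactly when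
    that power does not exceed the multiplicity of u. *)
Lemma root_count n (f : {poly K}) u : f != 0 -> map_poly frob f = f -> (size f <= n.+1)%N ->
  (\sum_(0 <= m < n) ((u ^+ (p ^ m.+1) == u) && (orbp m.+1 u %| f)%R) = mup u f)%N.
Proof.
elim/ltn_ind: n f => n IHn f f0 ff szf.
case: (boolP (root f u)) => [fu|nfu]; last first.
  rewrite (mupNroot nfu) big1 // => m _; apply/eqP; rewrite eqb0 negb_and orbC.
  apply/orP; left; apply: contra nfu => /dvdpP[r ->].
  by rewrite rootM orbp_root orbT.
have [d /eqP ud dmin] := ex_minnP (frob_periodic f0 ff fu).
have dmin' i : (0 < i < d.+1)%N -> u ^+ (p ^ i) != u.
  case: i => // i /andP[_]; rewrite ltnS => ltid; apply/negP => /dmin.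
  by rewrite leqNgt ltid.
have /dvdpP[f1 fE] : orbp d.+1 u %| f.
  rewrite /orbp -(big_mkord xpredT (fun i => 'X - (u ^+ (p ^ i))%:P)).
  rewrite -(big_map (fun i => u ^+ (p ^ i)) xpredT (fun z => 'X - z%:P)).
  apply: uniq_roots_dvdp; last by rewrite uniq_rootsE orbp_uniq // /index_iota subn0 orbp_uniq.
  by apply/allP => x /mapP[i _ ->]; apply: frob_root.
have f10 : f1 != 0 by apply: contra_neq f0 => f10; rewrite fE f10 mul0r.
have P0 : orbp d.+1 u != 0 by rewrite monic_neq0 ?monic_orbp.
have ff1 : map_poly frob f1 = f1.
  by apply: (mulIf P0); rewrite -[in LHS](orbp_frob ud) -rmorphM -fE; exact: ff.
have szf1 : (size f = size f1 + d.+1)%N.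
  by rewrite fE size_Mmonic ?monic_orbp // size_orbp addnS.
have sz1 : (0 < size f1)%N by rewrite size_poly_gt0.
have ltdn : (d < n)%N by move: szf sz1; rewrite szf1; move: (size f1) => k; lia.
(* The degree of u is d + 1. Indices below d contribute nothing, the index d contributes 1, and the
   rest is the count for f1, the quotient by the minimal polynomial, shifted by d + 1. *)
rewrite (@big_cat_nat _ _ _ d) //=; last exact: ltnW.
rewrite big_nat big1 ?add0n; last first.
  by move=> i /andP[_ id]; rewrite (negPf (dmin' i.+1 _)).
rewrite big_ltn // ud eqxx /= fE dvdp_mull // mupM //.
rewrite addnC; congr (_ + _)%N; last first.
  rewrite /orbp big_ord_recl expn0 expr1 mupMl.
    by rewrite -['X - _]expr1 mup_XsubCX eqxx.
  rewrite rootE horner_prod; apply/prodf_neq0 => i _.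
  rewrite !hornerE subr_eq0 eq_sym; apply: dmin'.
  by rewrite /= /bump add1n ltnS.
rewrite -[d.+1]add0n big_addn -(IHn (n - d.+1)%N _ f1) //; last 2 first.
- by rewrite ltn_subrL (leq_trans _ ltdn).
- by move: szf; rewrite szf1; move: (size f1) ltdn => k; lia.
apply: eq_bigr => m _; rewrite add0n -addSn addnC orbpD // expnD exprM ud.
by rewrite mulrC dvdp_mul2r.
Qed.

(** Listing the lower coefficients by row vectors makes the set finite without further proof. *)
Definition monics n : seq {poly 'F_p} := [seq 'X^n + rVpoly v | v : 'rV['F_p]_n].

Lemma size_rVpoly_lt n (v : 'rV['F_p]_n) : (size (rVpoly v) < size ('X^n : {poly 'F_p}))%N.
Proof. by rewrite size_polyXn ltnS size_poly. Qed.

Lemma mem_monics n F : (F \in monics n) = (F \is monic) && (size F == n.+1).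
Proof.
apply/mapP/andP => [[v _ ->]|[F1 /eqP szF]].
  have lt := size_rVpoly_lt v.
  by rewrite size_polyDl // size_polyXn eqxx monicE lead_coefDl // lead_coefXn eqxx.
have szd : (size (F - 'X^n)%R <= n)%N.
  apply/leq_sizeP => j lej.
  rewrite coefB coefXn; move: lej; rewrite leq_eqVlt => /predU1P[<-|ltj].
    rewrite eqxx; have : lead_coef F = 1 by apply/monicP.
    by rewrite lead_coefE szF /= => ->; rewrite subrr.
  by rewrite nth_default ?szF // gtn_eqF // subrr.
exists (poly_rV (F - 'X^n)); first by rewrite mem_enum.
by rewrite (poly_rV_K szd) addrC subrK.
Qed.

Lemma uniq_monics n : uniq (monics n).
Proof.
rewrite map_inj_uniq ?enum_uniq // => v w /addrI e.
by rewrite -[v]rVpolyK e rVpolyK.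
Qed.

(** The von Mangoldt identity: the degree of F is the sum of deg P over all prime powers P^k
    dividing F. The deg P roots u of P stand for P^k when viewed in the field of degree k deg P, so
    no factorization into irreducibles is needed. The proof counts the roots of F with
    multiplicity. *)
Lemma sum_orbp_dvd n F : F \in monics n ->
  (\sum_(0 <= m < n) \sum_(u <- ext m) (minp m.+1 u %| F)%R = n)%N.
Proof.
rewrite mem_monics => /andP[F1 /eqP szF]; pose f := map_poly emb F.
have f0 : f != 0 by rewrite map_poly_eq0 monic_neq0.
have szf : size f = n.+1 by rewrite size_map_poly.
have ff : map_poly frob f = f.
  by apply/polyP => i; rewrite !coef_map /= frob_iota.
have [rs fE] := closed_field_poly_normal f.
rewrite (monicP _) ?map_monic // scale1r in fE.
have szrs : size rs = n by have := szf; rewrite fE size_prod_XsubC => -[].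
transitivity (\sum_(u <- undup rs) mup u f)%N; last first.
  under eq_bigr => u _ do rewrite fE mu_prod_XsubC.
  have -> : (\sum_(u <- undup rs) count_mem u rs =
     \sum_(u <- undup rs) iterop (count_mem u rs) addn 1 0)%N.
    by apply: eq_bigr => u _; rewrite Monoid.iteropE iter_addn_0 mul1n.
  by rewrite big_undup_iterop_count sum1_size.
rewrite [RHS](eq_bigr (fun u => \sum_(0 <= m < n) ((u ^+ (p ^ m.+1) == u) && (orbp m.+1 u %| f)%R)))%N; last first.
  by move=> u _; rewrite root_count // szf.
rewrite exchange_big; apply: eq_bigr => m _ /=.
rewrite -big_mkcond -[RHS]big_mkcond /= !sum1_count -!size_filter; apply: perm_size.
apply: uniq_perm; rewrite ?filter_uniq ?undup_uniq ?uniq_ext // => u.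
rewrite !mem_filter mem_ext mem_undup andbC.
case: eqP => //= um; rewrite -(dvdp_map emb) minpK // -/f.
apply/idP/andP => [Pf|[]//]; split => //.
rewrite -root_prod_XsubC -fE; case/dvdpP: Pf => r ->.
by rewrite rootM orbp_root orbT.
Qed.

Section LFunction.
Variables (C : numFieldType) (Lam : {poly 'F_p} -> C).
Hypothesis LamM : forall F G, Lam (F * G) = Lam F * Lam G.

Definition Lcoef n := \sum_(F <- monics n) Lam F.
(** The sum over the field of p^n elements for n >= 1; [n.-1] undoes the shift in [ext]. *)
Definition Spow n := \sum_(u <- ext n.-1) Lam (minp n u).

(** The identity T L' = L (S_1 T + S_2 T^2 + ...) in coefficients. Each F is weighted by its degree
    through [sum_orbp_dvd]; exchanging the sums and writing F = G H with G = [minp] separates the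
    factors. *)
Lemma Lcoef_rec n : n%:R * Lcoef n = \sum_(m < n) Spow m.+1 * Lcoef (n - m.+1).
Proof.
transitivity (\sum_(m < n) \sum_(u <- ext m) \sum_(F <- monics n | minp m.+1 u %| F) Lam F).
  rewrite /Lcoef mulr_sumr [LHS]big_seq.
  under eq_bigr => F Fn do rewrite -{1}(sum_orbp_dvd Fn) natr_sum mulr_suml.
  rewrite -big_seq exchange_big big_mkord; apply: eq_bigr => m _ /=.
  under eq_bigr => F _ do rewrite natr_sum mulr_suml.
  rewrite exchange_big; apply: eq_bigr => u _ /=; rewrite [RHS]big_mkcond /=.
  by apply: eq_bigr => F _; case: ifP => _; rewrite ?mul1r ?mul0r.
apply: eq_bigr => m _; rewrite mulr_suml big_seq [RHS]big_seq; apply: eq_bigr => u /=.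
rewrite mem_ext => /eqP um; set G := minp m.+1 u.
have G1 : G \is monic by apply: monic_minp.
have szG : size G = m.+2 by apply: size_minp.
have G0 : G != 0 by apply: monic_neq0.
rewrite mulr_sumr; under [RHS]eq_bigr => H _ do rewrite -LamM.
rewrite -big_filter -[RHS](big_map (fun H => G * H) xpredT Lam); apply: perm_big.
apply: uniq_perm; rewrite ?filter_uniq ?uniq_monics //.
  by rewrite map_inj_uniq ?uniq_monics // => H H'; apply: mulfI.
move=> F; rewrite mem_filter mem_monics; apply/and3P/mapP.
  move=> [/dvdpP[H FE] F1 /eqP szF]; exists H; last by rewrite mulrC.
  have H1 : H \is monic by move: F1; rewrite FE monicMr.
  rewrite mem_monics H1 /=; move: szF.
  rewrite FE size_Mmonic ?monic_neq0 // szG addnS /= => szH.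
  have := ltn_ord m; rewrite -(eqn_add2r m.+1); lia.
move=> [H]; rewrite mem_monics => /andP[H1 /eqP szH] ->; split.
- by rewrite dvdp_mulr.
- by rewrite monicMl.
- rewrite size_monicM ?monic_neq0 // szG szH; have := ltn_ord m; lia.
Qed.

End LFunction.
End Closure.

(** * Stepanov's method *)

Lemma poly_linear_dependence (F : fieldType) (I : finType) (b : I -> {poly F}) n :
  (forall i, size (b i) <= n)%N -> (n < #|I|)%N ->
  exists2 c : I -> F, (exists i, c i != 0) & \sum_i c i *: b i = 0.
Proof.
move=> szb ltn; pose M := \matrix_(i < #|I|) poly_rV (d := n) (b (enum_val i)).
have /rowV0Pn[v /sub_kermxP vM v0] : kermx M != 0.
  by rewrite kermx_eq0 /row_free neq_ltn (leq_ltn_trans (rank_leq_col _) ltn).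
exists (fun i => v 0 (enum_rank i)).
  have /rV0Pn[j vj] := v0; exists (enum_val j); by rewrite enum_valK.
have : rVpoly (v *m M) = 0 by rewrite vM linear0.
rewrite mulmx_sum_row linear_sum /= => vb; apply: etrans vb.
rewrite [RHS](reindex enum_rank) /=; last exact: onW_bij (@enum_rank_bij I).
by apply: eq_bigr => i _; rewrite linearZ /= rowK poly_rV_K // enum_rankK.
Qed.

(** Among the terms with nonzero coefficient, the one of least order at 0 cannot be cancelled by the
    others. *)
Lemma order_independent (F : fieldType) (I : finType) (o : I -> nat) (H : I -> {poly F})
    (c : I -> F) :
  injective o -> (forall i, (H i).[0] != 0) -> (exists i, c i != 0) ->
  \sum_i c i *: ('X^(o i) * H i) != 0.
Proof.
move=> o_inj H0 [j cj]; case: (@arg_minnP _ j (fun i => c i != 0) o cj) => i ci imin.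
apply/eqP => /(congr1 (fun q : {poly F} => q`_(o i))).
rewrite coef_sum coef0 (bigD1 i) //= big1 ?addr0 => [/eqP|k ki].
  rewrite coefZ coefXnM ltnn subnn mulf_eq0 (negPf ci) /= -horner_coef0.
  by rewrite (negPf (H0 i)).
rewrite coefZ coefXnM; have [->|ck] := eqVneq (c k) 0; first by rewrite mul0r.
case: ltnP => [_|]; first by rewrite mulr0.
rewrite leq_eqVlt => /predU1P[/o_inj e|lt]; first by rewrite e eqxx in ki.
by have := imin k ck; rewrite leqNgt lt.
Qed.

Lemma radix_lt w k e : (k < w)%N -> (e <= 1)%N -> (k + e * w < w.*2.+1)%N.
Proof. by case: e => [|[|]] //; lia. Qed.

Lemma radix_inj w k e k' e' : (k < w)%N -> (k' < w)%N -> (e <= 1)%N -> (e' <= 1)%N ->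
  (k + e * w = k' + e' * w)%N -> e = e' /\ k = k'.
Proof. by case: e => [|[|]] //; case: e' => [|[|]] //; lia. Qed.

Lemma divmod_inj q a b c c' : (c < q)%N -> (c' < q)%N -> (a * q + c = b * q + c')%N -> a = b.
Proof.
move=> ltc ltc' /(congr1 (divn^~ q)); have q0 : (0 < q)%N by case: q ltc ltc'.
by rewrite !divnMDl // !divn_small // !addn0.
Qed.

Lemma ord_le1 E (e : 'I_E) : (E <= 2)%N -> (e <= 1)%N.
Proof. by move=> E2; rewrite -ltnS (leq_trans (ltn_ord e)). Qed.

(** More unknowns than linear equations. The part k + 1 of k + 6d + 8 balances Q w. The remaining 6d
    + 7 give (6d + 7) w p E, which with Q <= 3 w p is at least (2d + 2) Q + Q/3 and so exceeds the
    other terms. *)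
Lemma stepanov_condition p w Q E d k : (0 < w)%N -> (0 < E)%N -> (0 < Q)%N ->
  Q = (p * w.*2.+1)%N -> (Q <= (k + 1) * (E * p))%N -> (k <= Q)%N -> (6 * d + 8 <= Q)%N ->
  (Q * w + (k + (6 * d + 8)) + 2 * d * Q < w * (k + (6 * d + 8)) * p * E)%N.
Proof.
move=> w0 E0 Q0 QE lower kQ dQ.
have h3 : (Q <= 3 * (w * p))%N.
  have : (p * w.*2.+1 <= p * (3 * w))%N by rewrite leq_mul2l; lia.
  by rewrite QE mulnCA [(p * w)%N]mulnC.
have h1 : (Q * w <= w * ((k + 1) * (E * p)))%N by rewrite mulnC leq_mul2l lower orbT.
have h2 : (Q * (6 * d + 7) <= 3 * ((w * p) * (E * (6 * d + 7))))%N.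
  have : (Q * (6 * d + 7) <= 3 * (w * p) * (E * (6 * d + 7)))%N.
    by rewrite leq_mul // leq_pmull.
  by rewrite -mulnA.
have -> : (w * (k + (6 * d + 8)) * p * E =
    w * ((k + 1) * (E * p)) + (w * p) * (E * (6 * d + 7)))%N by ring.
apply: leq_ltn_trans (_ : w * ((k + 1) * (E * p)) + (2 * Q + 2 * d * Q) < _)%N.
  by rewrite -addnA leq_add // leq_add2r; lia.
rewrite ltn_add2l -(@ltn_pmul2l 3) //; apply: leq_trans h2.
have -> : (Q * (6 * d + 7) = 3 * (2 * Q + 2 * d * Q) + Q)%N by ring.
by rewrite -addn1 leq_add2l.
Qed.

(** The degree of the auxiliary polynomial bounds the number z of points. Multiplied by E p, its
    leading term becomes at most Q^2 and all others are linear in Q. *)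
Lemma stepanov_count p w Q E d k z : (w <= Q)%N -> (0 < E <= 2)%N -> (k * (E * p) <= Q)%N ->
  (z < w + Q * (k + (6 * d + 8)) + 2 * d * Q)%N ->
  (E * p * z <= Q ^ 2 + 2 * p * (8 * d + 9) * Q)%N.
Proof.
move=> wQ /andP[E0 E2] kQ lt.
have e1 : (E * p * z <= E * p * (w + Q * (k + (6 * d + 8)) + 2 * d * Q))%N.
  by rewrite leq_mul2l (ltnW lt) orbT.
apply: leq_trans e1 _.
have -> : (E * p * (w + Q * (k + (6 * d + 8)) + 2 * d * Q) =
  Q * (k * (E * p)) + E * p * (8 * d + 8) * Q + E * p * w)%N by ring.
have Ep2 : (E * p <= 2 * p)%N by rewrite leq_mul2r E2 orbT.
have -> : (2 * p * (8 * d + 9) * Q = 2 * p * (8 * d + 8) * Q + 2 * p * Q)%N by ring.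
rewrite addnA; apply: leq_add; last exact: leq_mul.
apply: leq_add; first by rewrite -mulnn leq_mul2l kQ orbT.
by rewrite !leq_mul2r E2 !orbT.
Qed.

Section Stepanov.
Variables (p : nat) (p_pr : prime p) (p_odd : odd p) (K : closedFieldType).
Hypothesis pcharK : p \in [pchar K].

Lemma pexpD n : {morph (fun x : K => x ^+ (p ^ n)) : x y / x + y}.
Proof.
move=> x y /=; elim: n => [|n IHn]; first by rewrite expn0 !expr1.
rewrite expnSr !exprM IHn -(pFrobenius_autE pcharK) rmorphD /=.
by rewrite !pFrobenius_autE.
Qed.

Lemma pexp_sum n (I : Type) (r : seq I) (P : pred I) (f : I -> K) :
  (\sum_(i <- r | P i) f i) ^+ (p ^ n) = \sum_(i <- r | P i) f i ^+ (p ^ n).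
Proof.
have z : (0 : K) ^+ (p ^ n) = 0 by rewrite expr0n expn_eq0 eqn0Ngt prime_gt0.
exact: (big_morph (fun x : K => x ^+ (p ^ n)) (@pexpD n) z).
Qed.

Lemma pexp_surj n (x : K) : exists y, y ^+ (p ^ n) = x.
Proof.
have sz : size ('X^(p ^ n) - x%:P : {poly K}) = (p ^ n).+1.
  by rewrite size_XnsubC // expn_gt0 prime_gt0.
have [y] : exists y, root ('X^(p ^ n) - x%:P) y.
  by apply/closed_rootP; rewrite sz eqSS expn_eq0 eqn0Ngt prime_gt0.
by rewrite rootE !hornerE subr_eq0 => /eqP; exists y.
Qed.

Variables (h D D1 f f1 : {poly K}) (d E m : nat) (s t : K).
Hypotheses (h0 : h.[0] != 0) (D10 : D1.[0] != 0) (f10 : f1.[0] != 0).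
Hypotheses (DE : D = 'X * D1) (fE : f = 'X * f1).
Hypotheses (szh : (size h <= d.+1)%N) (szD : (size D <= d.+1)%N) (szf : (size f <= d.+1)%N).
Hypothesis E12 : (0 < E <= 2)%N.
Hypothesis s0 : s != 0.

Let P := (p ^ m)%N.
Let Q := (p ^ m.+1)%N.
Let hQ := Q.-1./2.
Let hP := P.-1./2.
Let hp := p.-1./2.
Let QE : Q = (p * P)%N. Proof. by rewrite /Q expnS. Qed.
Let pE : p = (hp.*2.+1)%N. Proof. by rewrite /hp; have := prime_gt0 p_pr; lia. Qed.
Let PE : P = (hP.*2.+1)%N.
Proof. by have : odd P; [rewrite /P oddX p_odd orbT | rewrite /hP; lia]. Qed.
Let hQE : hQ = (hP + P * hp)%N.
Proof.
have e : (p * P = (hP + P * hp).*2.+1)%N by rewrite {1}pE; have := PE; nia.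
by rewrite /hQ QE e /= doubleK.
Qed.
Let QhE : Q = (hQ.*2.+1)%N.
Proof. by rewrite hQE QE {1}pE; have := PE; nia. Qed.

(** This is D^P g, where g is the sum of (h/D)^(p^i) over i <= m: half of the trace of h/D from
    F_(Q^2), with denominators cleared. *)
Definition step_trace : {poly K} := \sum_(i < m.+1) h ^+ (p ^ i) * D ^+ (P - p ^ i).
(** Its (Q+1)-th power is f^((Q^2-1)/2), the quadratic character of f on F_(Q^2). The lock keeps
    simplification from expanding the power. *)
Definition step_half : {poly K} := locked (f ^+ hQ).
Let step_halfE : step_half = f ^+ hQ. Proof. by rewrite /step_half -lock. Qed.
Notation T := step_trace.
Notation Y := step_half.

Lemma size_exp_bound (q : {poly K}) a n : (size q <= a.+1)%N -> (size (q ^+ n) <= (a * n).+1)%N.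
Proof.
move=> szq; apply: leq_trans (size_poly_exp_leq _ _) _.
by rewrite ltnS leq_mul2r; apply/orP; right; lia.
Qed.

Lemma size_mul_bound (q r : {poly K}) a b :
  (size q <= a.+1)%N -> (size r <= b.+1)%N -> (size (q * r)%R <= (a + b).+1)%N.
Proof. by move=> szq szr; apply: leq_trans (size_polyMleq _ _) _; lia. Qed.

Lemma size_step_trace : (size T <= (d * P).+1)%N.
Proof.
apply: leq_trans (size_sum _ _ _) _; apply/bigmax_leqP => i _.
have le : (p ^ i <= P)%N by rewrite leq_exp2l ?prime_gt1 // -ltnS.
apply: leq_trans (size_mul_bound (size_exp_bound _ szh) (size_exp_bound _ szD)) _.
by rewrite -mulnDr subnKC.
Qed.

Lemma step_trace0 : T.[0] != 0.
Proof.
rewrite /step_trace horner_sum big_ord_recr /= big1 ?add0r.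
  by rewrite subnn expr0 mulr1 hornerE expf_neq0.
move=> i _; rewrite hornerM [X in _ * X]horner_exp DE hornerM hornerX mul0r expr0n.
have lt : (p ^ i < P)%N by rewrite ltn_exp2l ?prime_gt1.
by rewrite subn_eq0 leqNgt lt mulr0.
Qed.

Section Construct.
Variable B : nat.
Let A := hP.
Definition step_index := ('I_A * 'I_B * 'I_p * 'I_E)%type.
Implicit Type i : step_index.

(** The order of [step_basis] at 0, where D and f vanish simply and T does not vanish. *)
Definition step_order i : nat :=
  (i.1.1.1 + Q * i.1.1.2 + (Q - i.1.2 * P) + i.2 * hQ)%N.
Definition step_cofactor i : {poly K} :=
  T ^+ i.1.2 * D1 ^+ (Q - i.1.2 * P) * f1 ^+ (i.2 * hQ).
Definition step_basis i : {poly K} :=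
  'X^(i.1.1.1) * 'X^(Q * i.1.1.2) * (T ^+ i.1.2 * D ^+ (Q - i.1.2 * P)) * Y ^+ i.2.
(** What the Q-th power of [step_basis] becomes on F_(Q^2), up to powers of D and Y: X^(Ql) turns
    into X^l, T into t D^P - T, and Y into s/Y. The large exponent Q l has collapsed, so few linear
    conditions make a combination vanish. *)
Definition step_twist i : {poly K} :=
  s ^+ i.2 *: ('X^(Q * i.1.1.1) * 'X^(i.1.1.2) *
    ((t *: D ^+ P - T) ^+ i.1.2 * D ^+ (Q - i.1.2 * P)) * Y ^+ (E.-1 - i.2)).

Lemma step_basisE i : step_basis i = 'X^(step_order i) * step_cofactor i.
Proof.
rewrite /step_basis /step_cofactor step_halfE /step_order DE fE.
rewrite !exprMn !exprD -!exprM [(hQ * _)%N]mulnC; ring.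
Qed.

Lemma step_cofactor0 i : (step_cofactor i).[0] != 0.
Proof. by rewrite /step_cofactor !hornerE !mulf_neq0 ?expf_neq0 ?step_trace0. Qed.

(** Since (Q-1)/2 = hP + P (p-1)/2, the order has remainder k + e hP modulo P and quotient p l + (p
    - i) + e (p-1)/2. With P = 2 hP + 1 and k < hP, the remainder determines k and e; the quotient
    then gives l and i. *)
Lemma step_order_inj : injective step_order.
Proof.
move=> [[[k l] i] e] [[[k' l'] i'] e'] /=; rewrite /step_order /=.
have ord1 (a : 'I_A) (b : 'I_B) (c : 'I_p) (g : 'I_E) :
  (a + Q * b + (Q - c * P) + g * hQ = (p * b + (p - c) + g * hp) * P + (a + g * hP))%N.
  have ltc := ltn_ord c; have -> : (Q - c * P = (p - c) * P)%N by rewrite mulnBl QE.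
  by rewrite hQE QE; nia.
rewrite !ord1 => eqo.
have E2 : (E <= 2)%N by case/andP: E12.
have lt1 (a : 'I_A) (g : 'I_E) : (a + g * hP < P)%N.
  by rewrite [X in (_ < X)%N]PE radix_lt ?ord_le1 // (ltn_ord a).
have [eq1 eq2] : (k + e * hP = k' + e' * hP)%N /\
    (p * l + (p - i) + e * hp = p * l' + (p - i') + e' * hp)%N.
  have P0 : (0 < P)%N by rewrite PE.
  split; [move/(congr1 (modn^~ P)): eqo | move/(congr1 (divn^~ P)): eqo].
    by rewrite !modnMDl !modn_small.
  by rewrite !divnMDl // !divn_small ?addn0.
have [eqe eqk] := radix_inj (ltn_ord k) (ltn_ord k') (ord_le1 e E2) (ord_le1 e' E2) eq1.
have lti := ltn_ord i; have lti' := ltn_ord i'.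
(* p - i runs over 1, ..., p; lowering it by 1 makes it a remainder modulo p. *)
have eqil : (l * p + (p - i.+1) = l' * p + (p - i'.+1))%N.
  by rewrite eqe in eq2; rewrite ![(_ * p)%N]mulnC; lia.
have eql : l = l' :> nat.
  have ltp (j : nat) : (p - j.+1 < p)%N by rewrite ltn_subrL (prime_gt0 p_pr).
  exact: (divmod_inj (ltp _) (ltp _) eqil).

have eqi : i = i' :> nat by rewrite eql in eqil; lia.
congr (((_, _), _), _); exact: val_inj.
Qed.

Lemma iP_leQ (i : 'I_p) : (i * P <= Q)%N.
Proof. by rewrite QE leq_mul2r (ltnW (ltn_ord i)) orbT. Qed.

Lemma size_step_core (q : {poly K}) (i : 'I_p) : (size q <= (d * P).+1)%N ->
  (size (q ^+ i * D ^+ (Q - i * P))%R <= (d * Q).+1)%N.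
Proof.
move=> szq; apply: leq_trans (size_mul_bound (size_exp_bound _ szq) (size_exp_bound _ szD)) _.
by rewrite -mulnA -mulnDr [(P * _)%N]mulnC subnKC ?iP_leQ.
Qed.

Lemma size_step_half e : (e <= 1)%N -> (size (Y ^+ e) <= (d * Q).+1)%N.
Proof.
move=> e1; rewrite step_halfE; apply: leq_trans (size_exp_bound _ (size_exp_bound _ szf)) _.
rewrite ltnS -mulnA leq_mul2l; apply/orP; right.
by case: e e1 => [|[|]] // _; rewrite ?muln0 // muln1 QhE; lia.
Qed.

Lemma size_step_basis i : (size (step_basis i) <= hP + Q * B + 2 * d * Q)%N.
Proof.
case: i => [[[k l] i] e]; have ltk := ltn_ord k; have ltl := ltn_ord l.
have e1 : (e <= 1)%N by apply: ord_le1; case/andP: E12.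
apply: leq_trans (size_mul_bound (size_mul_bound (size_mul_bound (a := k) (b := Q * l) _ _)
  (size_step_core _ size_step_trace)) (size_step_half e1)) _; rewrite ?size_polyXn //=.
have : (Q * l <= Q * B)%N by rewrite leq_mul2l (ltnW ltl) orbT.
by move=> leQ; rewrite -[(2 * d * Q)%N]mulnA mul2n -addnn !addnA !ltn_add2r -addSn leq_add.
Qed.

Lemma size_step_twist i : (size (step_twist i) <= Q * hP + B + 2 * d * Q)%N.
Proof.
case: i => [[[k l] i] e]; have ltk := ltn_ord k; have ltl := ltn_ord l.
have e1 : (E.-1 - e <= 1)%N by rewrite (leq_trans (leq_subr _ _)) //; case/andP: E12; case: (E) => [|[|[|]]].
apply: leq_trans (size_scale_leq _ _) _.
have szT : (size (t *: D ^+ P - T)%R <= (d * P).+1)%N.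
  apply: leq_trans (size_polyD _ _) _; rewrite size_polyN geq_max size_step_trace andbT.
  by apply: leq_trans (size_scale_leq _ _) (size_exp_bound _ szD).
apply: leq_trans (size_mul_bound (size_mul_bound (size_mul_bound (a := Q * k) (b := l) _ _)
  (size_step_core _ szT)) (size_step_half e1)) _; rewrite ?size_polyXn //=.
have : (Q * k <= Q * hP)%N by rewrite leq_mul2l (ltnW ltk) orbT.
by move=> leQ; rewrite -[(2 * d * Q)%N]mulnA mul2n -addnn !addnA !ltn_add2r -addnS leq_add.
Qed.

Definition step_point (u : K) :=
  [/\ u ^+ (Q ^ 2) = u, D.[u] != 0,
     \sum_(0 <= i < m.+1 + m.+1) (h.[u] / D.[u]) ^+ (p ^ i) = t &
     (E = 2 -> f.[u] ^+ (hQ * Q.+1) = s)%N].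

(** Three relations at a point: u^(Q^2) = u; g^Q = t - g, because g^Q is the other half of the
    trace; and Y^Q Y = s when E = 2. The factor Y^(E-1) keeps the exponent of Y nonnegative. *)
Lemma step_basis_twist u i : step_point u ->
  Y.[u] ^+ E.-1 * ((step_basis i).[u] / D.[u] ^+ Q) ^+ Q * D.[u] ^+ Q = (step_twist i).[u].
Proof.
case=> uQ Du tr fs; case: i => [[[k l] i] e].
pose g := \sum_(0 <= j < m.+1) (h.[u] / D.[u]) ^+ (p ^ j).
have TE : T.[u] = g * D.[u] ^+ P.
  rewrite /g /step_trace horner_sum big_mkord mulr_suml; apply: eq_bigr => j _.
  have le : (p ^ j <= P)%N by rewrite leq_exp2l ?prime_gt1 // -ltnS.
  rewrite !hornerE -[in RHS](subnK le) exprD expr_div_n.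
  by rewrite [RHS]mulrA [RHS]mulrAC divfK ?expf_neq0.
have gQ : g ^+ Q = t - g.
  rewrite -tr (@big_cat_nat _ _ _ m.+1) //= ?leq_addr // -/g addrAC subrr add0r.
  rewrite -[X in index_iota X]add0n big_addn addnK /g pexp_sum.
  by apply: eq_bigr => j _; rewrite -exprM -expnD.
have DQ : D.[u] ^+ (i * P) * D.[u] ^+ (Q - i * P) = D.[u] ^+ Q.
  by rewrite -exprD subnKC ?iP_leQ.
have bE : (step_basis (k, l, i, e)).[u] / D.[u] ^+ Q =
   u ^+ k * u ^+ (Q * l) * g ^+ i * Y.[u] ^+ e.
  rewrite /step_basis !hornerE TE exprMn -!exprM.
  rewrite [(P * _)%N]mulnC -DQ.
  move: (expf_neq0 (i * P) Du) (expf_neq0 (Q - i * P) Du).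
  move: (D.[u] ^+ (i * P)) (D.[u] ^+ (Q - i * P)) => a b a0 b0.
  move: (u ^+ k) (u ^+ (Q * l)) (g ^+ i) (Y.[u] ^+ e) => x1 x2 x3 x4.
  by rewrite /=; field; rewrite a0 b0.
have YE : (E = 2)%N -> Y.[u] ^+ Q * Y.[u] = s.
  move=> E2; rewrite -exprSr step_halfE horner_exp -exprM; exact: fs.
have YEe : Y.[u] ^+ E.-1 * (Y.[u] ^+ e) ^+ Q = s ^+ e * Y.[u] ^+ (E.-1 - e).
  have [/eqP E2|E1] := boolP (E == 2)%N; last first.
    have -> : E.-1 = 0%N by move: E12 E1; clear; case: E => [|[|[|]]].
    have -> : nat_of_ord e = 0%N.
      by move: E12 E1 (ltn_ord e); clear; move: (nat_of_ord e); case: E => [|[|[|]]] // [].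
    by rewrite !expr0 expr1n.
  have e1 : (e <= 1)%N by rewrite ord_le1 // E2.
  have -> : E.-1 = 1%N by rewrite E2.
  case: (nat_of_ord e) e1 => [|[|]] //= _; first by rewrite !expr0 expr1n mulr1 mul1r.
  by rewrite !expr1 subnn mulr1 mulrC YE.
rewrite bE /step_twist !hornerE TE !exprMn.
rewrite -exprM [X in u ^+ X * _]mulnC.
have -> : (u ^+ (Q * l)) ^+ Q = u ^+ l by rewrite -exprM mulnAC mulnn exprM uQ.
have -> : (g ^+ i) ^+ Q = (t - g) ^+ i by rewrite -exprM mulnC exprM gQ.
have -> : t * D.[u] ^+ P - g * D.[u] ^+ P = (t - g) * D.[u] ^+ P by rewrite mulrBl.
transitivity (u ^+ (Q * k) * u ^+ l * (t - g) ^+ i * D.[u] ^+ Q *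
    (Y.[u] ^+ E.-1 * (Y.[u] ^+ e) ^+ Q)); first by ring.
rewrite YEe -DQ exprMn -exprM [(P * _)%N]mulnC.
move: (D.[u] ^+ (i * P)) (D.[u] ^+ (Q - i * P)) (u ^+ (Q * k)) (u ^+ l) ((t - g) ^+ i).
move: (Y.[u] ^+ (E.-1 - e)) (s ^+ e) => *; rewrite /=; ring.
Qed.

(* On Z, the Q-th power of the auxiliary polynomial G is the value of a polynomial of low
   degree, which linear algebra makes zero; the distinct orders at 0 keep G nonzero. *)
Lemma stepanov_raw (Z : seq K) :
  (Q * hP + B + 2 * d * Q < hP * B * p * E)%N -> uniq Z ->
  (forall u, u \in Z -> step_point u) -> (size Z < hP + Q * B + 2 * d * Q)%N.
Proof.
move=> lt uZ Zp.
have [||c' c'0 c'E] := poly_linear_dependence (b := step_twist) (n := Q * hP + B + 2 * d * Q).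
- exact: size_step_twist.
- by rewrite !card_prod !card_ord.
(* The combination uses Q-th roots of the coefficients c', so that its Q-th power carries the c'
   themselves. K is algebraically closed, hence perfect. *)
have ex x : exists y : K, y ^+ Q == x by have [y <-] := pexp_surj m.+1 x; exists y.
pose c i := xchoose (ex (c' i)).
have cE i : c i ^+ Q = c' i by apply/eqP/(xchooseP (ex (c' i))).
pose G := \sum_i c i *: step_basis i.
have G0 : G != 0.
  rewrite /G; under eq_bigr => i _ do rewrite step_basisE.
  apply: order_independent; [exact: step_order_inj|exact: step_cofactor0|].
  case: c'0 => i; rewrite -cE => ci; exists i; apply: contra_neq ci => ->.
  by rewrite expr0n /Q expn_eq0 eqn0Ngt prime_gt0.
have szG : (size G <= hP + Q * B + 2 * d * Q)%N.
  apply: leq_trans (size_sum _ _ _) _; apply/bigmax_leqP => i _.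
  exact: leq_trans (size_scale_leq _ _) (size_step_basis i).
apply: leq_trans szG; apply: max_poly_roots => //.
apply/allP => u /Zp up; have [uQ Du tr fs] := up.
have Yu : Y.[u] ^+ E.-1 != 0.
  have [E1|E1] := eqVneq E.-1 0%N; first by rewrite E1 expr0 oner_neq0.
  have /fs fsE : E = 2%N by move: E12 E1; clear; case: E => [|[|[|]]].
  apply/expf_neq0; apply: contra_neq s0 => Y0.
  by rewrite -fsE exprM -horner_exp -step_halfE Y0 expr0n.
rewrite rootE; suff : Y.[u] ^+ E.-1 * (G.[u] / D.[u] ^+ Q) ^+ Q * D.[u] ^+ Q == 0.
  rewrite !mulf_eq0 (negPf Yu) expf_eq0 mulf_eq0 invr_eq0 !expf_eq0 (negPf Du) !andbF !orbF /=.
  by case/andP.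
rewrite /G horner_sum mulr_suml pexp_sum mulr_sumr mulr_suml.
have := congr1 (fun q : {poly K} => q.[u]) c'E; rewrite horner_sum horner0 => c'E0.
apply/eqP; apply: etrans c'E0; apply: eq_bigr => i _.
rewrite hornerZ [RHS]hornerZ -cE -step_basis_twist // -[c i * _ / _]mulrA exprMn.
by move: (Y.[u] ^+ E.-1) (c i ^+ Q) (D.[u] ^+ Q) (_ ^+ Q) => *; ring.
Qed.

End Construct.

(** The range of l is taken just above Q/(Ep), where unknowns and equations balance. The degree is
    then Q^2/(Ep) + O(Q), the expected size of one class up to the error term. *)
Lemma stepanov_bound (Z : seq K) : (0 < m)%N -> (6 * d + 8 <= Q)%N -> uniq Z ->
  (forall u, u \in Z -> step_point u) ->
  (E * p * size Z <= Q ^ 2 + 2 * p * (8 * d + 9) * Q)%N.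
Proof.
move=> m0 leQ uZ Zp; pose k := (Q %/ (E * p))%N.
have [E0 E2] := andP E12.
have Ep0 : (0 < E * p)%N by rewrite muln_gt0 E0 prime_gt0.
have Q0 : (0 < Q)%N by rewrite expn_gt0 prime_gt0.
have P1 : (1 < P)%N by rewrite -{1}(expn0 p) ltn_exp2l // prime_gt1.
have hP0 : (0 < hP)%N by move: P1; rewrite [in X in X -> _]PE; case: hP.
have lower : (Q <= (k + 1) * (E * p))%N.
  by rewrite {1}(divn_eq Q (E * p)) mulnDl mul1n leq_add2l ltnW // ltn_pmod.
have cnd : (Q * hP + (k + (6 * d + 8)) + 2 * d * Q < hP * (k + (6 * d + 8)) * p * E)%N.
  by apply: stepanov_condition => //; rewrite ?leq_div // QE {1}PE.
apply: stepanov_count (stepanov_raw cnd uZ Zp) => //; last exact: leq_divM.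
have : (hP <= P)%N by rewrite [X in (_ <= X)%N]PE -addnn -addnS leq_addr.
by move/leq_trans; apply; rewrite QE leq_pmull ?prime_gt0.
Qed.

End Stepanov.

(** * Weil's bound *)

(* Upper bounds for the single N j and the value of their sum make them nearly equal, so
   Stepanov upper bounds suffice. *)
Lemma balanced_sum_bound (C : numClosedFieldType) (J : finType) (N : J -> nat) (W : J -> C)
    (T B d : nat) :
  \sum_j W j = 0 -> (forall j, `|W j| <= 1) -> (forall j, #|J| * N j <= T + B)%N ->
  (T <= \sum_j N j + d)%N -> (0 < #|J|)%N ->
  `|\sum_j W j * (N j)%:R| <= (2 * B + d)%:R.
Proof.
move=> W0 W1 NB Td J0; have J0' : (0 : C) < #|J|%:R by rewrite ltr0n.
rewrite -(ler_pM2l J0') -{1}(ger0_norm (ltW J0')) -normrM mulr_sumr.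
pose x j : C := #|J|%:R * (N j)%:R - T%:R.
have -> : \sum_j #|J|%:R * (W j * (N j)%:R) = \sum_j W j * x j.
  rewrite /x; under [RHS]eq_bigr => j _ do rewrite mulrBr mulrCA.
  by rewrite sumrB -mulr_suml W0 mul0r subr0.
apply: le_trans (ler_norm_sum _ _ _) _.
apply: le_trans (_ : \sum_j (2 * B%:R - x j) <= _).
  apply: ler_sum => j _; rewrite normrM; apply: le_trans (ler_piMl _ (W1 j)) _ => //.
  have -> : x j = B%:R - (B%:R - x j) by ring.
  apply: le_trans (ler_normB _ _) _; rewrite ger0_norm ?ler0n // ger0_norm.
    by rewrite le_eqVlt; apply/orP; left; apply/eqP; ring.
  by rewrite /x opprB addrA subr_ge0 -natrM -natrD ler_nat addnC.
rewrite sumrB sumr_const -[2 * B%:R *+ _]mulr_natl /x sumrB sumr_const.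
rewrite -[T%:R *+ _]mulr_natl -mulr_sumr -natr_sum.
rewrite -mulrBr -mulrBr ler_pM2l // opprB.
by rewrite natrD natrM lerD2l lerBlDr -natrD addnC ler_nat.
Qed.

(** * Quadratic and additive characters of the prime field *)

Section Characters.
Variables (p : nat) (p_pr : prime p) (p_odd : odd p) (C : numClosedFieldType).

(** The Legendre symbol by Euler's criterion, which makes it multiplicative at once. The link with
    the number of square roots is [card_sqrt]. *)
Definition chi (x : 'F_p) : C :=
  if x == 0 then 0 else if x ^+ p.-1./2 == 1 then 1 else -1.

Lemma Fp_half_power (x : 'F_p) : x != 0 -> (x ^+ p.-1./2 == 1) || (x ^+ p.-1./2 == -1).
Proof.
move=> x0; rewrite -eqf_sqr expr1n -exprM muln2 halfK.
have -> : odd p.-1 = false by case: p p_odd => //= n /negbTE.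
rewrite subn0; apply/eqP; apply: (mulfI x0); rewrite mulr1 -exprS prednK ?prime_gt0 //.
exact: Fp_expp.
Qed.

Lemma Fp_one_neqN1 : (1 : 'F_p) != -1.
Proof.
rewrite -subr_eq0 opprK -(natrD _ 1 1) -(dvdn_pcharf (pchar_Fp p_pr)).
by rewrite gtnNdvd //; case: p p_pr p_odd => [|[|[|]]].
Qed.

Lemma chi0 : chi 0 = 0. Proof. by rewrite /chi eqxx. Qed.

Lemma chi1 : chi 1 = 1.
Proof. by rewrite /chi oner_eq0 expr1n eqxx. Qed.

Lemma chiM : {morph chi : x y / x * y}.
Proof.
move=> x y; rewrite /chi mulf_eq0.
have [->|x0] := eqVneq x 0; first by rewrite /= mul0r.
have [->|y0] := eqVneq y 0; first by rewrite /= mulr0.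
rewrite /= exprMn.
have N1 : (-1 == 1 :> 'F_p) = false by rewrite eq_sym (negPf Fp_one_neqN1).
by case/orP: (Fp_half_power x0) => /eqP ->; case/orP: (Fp_half_power y0) => /eqP ->;
   rewrite !(mulrNN, mulN1r, mulrN1, mul1r, mulr1, opprK, eqxx, N1).
Qed.

Lemma chi_prod (I : Type) (r : seq I) (P : pred I) (f : I -> 'F_p) :
  chi (\prod_(i <- r | P i) f i) = \prod_(i <- r | P i) chi (f i).
Proof. exact: (big_morph _ chiM chi1). Qed.

Lemma norm_chi_le1 x : `|chi x| <= 1.
Proof. by rewrite /chi; do 2?case: ifP => _; rewrite ?normr0 ?ler01 ?normrN ?normr1. Qed.

Lemma chi_sqr x : x != 0 -> chi x ^+ 2 = 1.
Proof. by move=> x0; rewrite /chi (negPf x0); case: ifP => _; rewrite ?sqrrN expr1n. Qed.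

Lemma conj_chi x : (chi x)^* = chi x.
Proof. by rewrite /chi; do 2?case: ifP => _; rewrite ?rmorphN ?rmorph0 ?rmorph1. Qed.

Variable psi : 'F_p -> C.
Hypotheses (psiD : forall x y, psi (x + y) = psi x * psi y)
  (psi_norm : forall x, `|psi x| = 1) (psi_nontriv : psi 1 != 1).

Lemma psi_neq0 x : psi x != 0.
Proof. by rewrite -normr_eq0 psi_norm oner_eq0. Qed.

Lemma psi0 : psi 0 = 1.
Proof. by apply: (mulfI (psi_neq0 0)); rewrite -psiD addr0 mulr1. Qed.

Lemma sum_psi (a : 'F_p) : a != 0 -> \sum_t psi (t * a) = 0.
Proof.
move=> a0; have -> : \sum_t psi (t * a) = \sum_t psi t.
  by rewrite [RHS](reindex_inj (mulIf a0)).
have : (1 - psi 1) * \sum_t psi t = 0.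
  rewrite mulrBl mul1r {1}(reindex_inj (addrI 1)) /= mulr_sumr -sumrB big1 // => t _.
  by rewrite psiD subrr.
move/eqP; rewrite mulf_eq0 subr_eq0 eq_sym (negPf psi_nontriv) /=; exact: eqP.
Qed.

End Characters.

Lemma deriv_prod_XsubC (F : fieldType) (I : Type) (r : seq I) (z : I -> F) (a : F) :
  (\prod_(i <- r) ('X - (z i)%:P)).[a] != 0 ->
  (\prod_(i <- r) ('X - (z i)%:P))^`().[a] / (\prod_(i <- r) ('X - (z i)%:P)).[a]
  = \sum_(i <- r) (a - z i)^-1.
Proof.
elim: r => [|i r IHr]; first by rewrite !big_nil derivC horner0 mul0r.
rewrite !big_cons derivM derivXsubC mul1r !(hornerM, hornerD) !hornerE.
rewrite mulf_eq0 negb_or => /andP[ai ar]; rewrite -(IHr ar).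
by field; rewrite ai ar.
Qed.

Lemma logderiv_frac (F : fieldType) (x y x' y' k : F) : x != 0 -> y != 0 ->
  k * ((x' * y + x * y') / (x * y)) = k * (x' / x) + k * (y' / y).
Proof. by move=> x0 y0; field; rewrite x0 y0. Qed.

Lemma logderiv_shift (F : fieldType) (k x x' y t S : F) :
  k * ((x' + t * y) / x) + S = k * (x' / x) + S + t * (k * y / x).
Proof. by ring. Qed.

Lemma double_root_deriv (F : fieldType) (G : {poly F}) a :
  (G * ('X - a%:P) ^+ 2).[a] = 0 /\ (G * ('X - a%:P) ^+ 2)^`().[a] = 0.
Proof.
have Aa : ('X - a%:P).[a] = 0 by rewrite hornerXsubC subrr.
move: ('X - a%:P) Aa => A Aa.
by rewrite expr2 !(derivM, hornerM, hornerD) !Aa !(mulr0, mul0r, addr0).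
Qed.

(** * The L-function of a mixed character sum *)

Section Weil.
Variables (p : nat) (p_pr : prime p) (p_odd : odd p) (C : numClosedFieldType).
Hypothesis C_archi : forall x : C, exists n : nat, `|x| <= n%:R.
Variable psi : 'F_p -> C.
Hypotheses (psiD : forall x y, psi (x + y) = psi x * psi y)
  (psi_norm : forall x, `|psi x| = 1) (psi_nontriv : psi 1 != 1).
Notation chi := (@chi p C).

Variables (s : seq 'F_p) (c : 'F_p -> 'F_p) (e : 'F_p -> bool).
Hypotheses (s_uniq : uniq s) (s0 : 0 \in s) (c0 : c 0 != 0).
Let d := size s.

(** At F = X - x the arguments are the product of the a - x and the sum of the c_a/(a - x), which
    are those of the mixed sum. Values multiply and logarithmic derivatives F'/F add, so [Lam] is
    multiplicative. *)
Definition Lam (F : {poly 'F_p}) : C :=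
  if all (fun a => F.[a] != 0) s then
    chi (\prod_(a <- s | e a) F.[a]) * psi (\sum_(a <- s) c a * (F^`().[a] / F.[a]))
  else 0.

Lemma LamM F G : Lam (F * G) = Lam F * Lam G.
Proof.
rewrite /Lam; have -> : all (fun a => (F * G).[a] != 0) s =
   all (fun a => F.[a] != 0) s && all (fun a => G.[a] != 0) s.
  by rewrite -all_predI; apply: eq_all => a; rewrite /= hornerM mulf_eq0 negb_or.
case: (boolP (all _ s)) => [/allP Fs|_]; last by rewrite mul0r.
case: (boolP (all _ s)) => [/allP Gs|_]; last by rewrite mulr0.
rewrite /= mulrACA -chiM // -psiD -big_split /=; congr (chi _ * psi _).
  by apply: eq_bigr => a _; rewrite hornerM.
rewrite -big_split /= !big_seq; apply: eq_bigr => a sa.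
have Fa := Fs a sa; have Ga := Gs a sa.
rewrite derivM hornerM hornerD !hornerM; move: Fa Ga.
move: F.[a] G.[a] F^`().[a] G^`().[a] (c a) => x y x' y' k x0 y0.
exact: logderiv_frac.
Qed.

Lemma Lam1 : Lam 1 = 1.
Proof.
rewrite /Lam; case: allP => [_|[]]; last by move=> a _; rewrite hornerE oner_eq0.
rewrite big1 => [|a _]; last by rewrite hornerE.
rewrite big1 => [|a _]; last by rewrite derivC horner0 mul0r mulr0.
by rewrite chi1 mul1r psi0.
Qed.

Lemma Lcoef0 : Lcoef Lam 0 = 1.
Proof.
have -> : Lcoef Lam 0 = \sum_(F <- [:: 1]) Lam F.
  apply: perm_big; apply: uniq_perm; rewrite ?uniq_monics // => F.
  rewrite mem_monics inE; apply/andP/eqP => [[F1 /eqP szF]|->]; last first.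
    by rewrite monic1 size_polyC oner_eq0.
  by rewrite (size1_polyC (eq_leq szF)); move/monicP: F1; rewrite lead_coefE szF => ->.
by rewrite big_seq1 Lam1.
Qed.

(* Let E vanish doubly at the points of s other than 0 and simply at 0.  Then F + t E runs
   through monic polynomials of the same degree and Lam is multiplied by psi (t k), k <> 0. *)
Lemma Lcoef_vanish n : (2 * d <= n)%N -> Lcoef Lam n = 0.
Proof.
move=> dn; pose E : {poly 'F_p} := 'X * \prod_(a <- rem 0 s) ('X - a%:P) ^+ 2.
have d0 : (0 < d)%N by rewrite /d; case: (s) s0.
have szE : (size E <= 2 * d)%N.
  rewrite /E mulrC size_mulX ?monic_neq0 ?monic_prod // => [|a _]; last first.
    by rewrite monic_exp ?monicXsubC.
  rewrite prodrXl; apply: leq_ltn_trans (size_poly_exp_leq _ _) _.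
  by rewrite size_prod_XsubC /= size_rem // -/d; lia.
have Ea a : a \in s -> a != 0 -> E.[a] = 0 /\ E^`().[a] = 0.
  move=> sa a0; have sa' : a \in rem 0 s by rewrite rem_filter // mem_filter /= a0.
  have [G ->] : exists G, E = G * ('X - a%:P) ^+ 2.
    by rewrite /E (big_rem a) //= mulrCA mulrC; eexists.
  exact: double_root_deriv.
have E0 : E.[0] = 0 by rewrite /E hornerM hornerX mul0r.
have E0' : E^`().[0] != 0.
  rewrite /E derivM derivX mul1r hornerD [('X * _).[0]]hornerM hornerX mul0r addr0.
  rewrite horner_prod prodf_seq_neq0; apply/allP => a; rewrite rem_filter // mem_filter /=.
  by case/andP=> a0 _; rewrite horner_exp hornerXsubC expf_neq0 // sub0r oppr_eq0.
have LamE F t : F \in monics p n -> Lam (F + t *: E) = Lam F * psi (t * (c 0 * E^`().[0] / F.[0])).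
  move=> _; have Fa a : a \in s -> (F + t *: E).[a] = F.[a].
    move=> sa; rewrite hornerD hornerZ; have [->|a0] := eqVneq a 0.
      by rewrite E0 mulr0 addr0.
    by rewrite (Ea a sa a0).1 mulr0 addr0.
  rewrite /Lam (eq_in_all (a2 := fun a => F.[a] != 0)) => [|a sa]; last by rewrite Fa.
  case: ifP => _; last by rewrite mul0r.
  rewrite -mulrA -psiD; congr (chi _ * psi _).
    by rewrite big_seq_cond [RHS]big_seq_cond; apply: eq_bigr => a /andP[sa _]; rewrite Fa.
  have rem_eq : \sum_(a <- rem 0 s) c a * ((F + t *: E)^`().[a] / (F + t *: E).[a])
      = \sum_(a <- rem 0 s) c a * (F^`().[a] / F.[a]).
    apply: eq_big_seq => a; rewrite rem_filter // mem_filter => /andP[/= a0 sa].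
    by rewrite Fa // derivD derivZ hornerD hornerZ (Ea a sa a0).2 mulr0 addr0.
  rewrite !(big_rem 0 s0) /= rem_eq Fa // derivD derivZ hornerD hornerZ.
  exact: logderiv_shift.
have Lt t : Lcoef Lam n = \sum_(F <- monics p n) Lam (F + t *: E).
  rewrite /Lcoef -(big_map (fun F => F + t *: E) xpredT Lam); apply: perm_big.
  have inM F u : F \in monics p n -> F + u *: E \in monics p n.
    rewrite !mem_monics => /andP[F1 /eqP szF].
    have lt : (size (u *: E) < size F)%N.
      by rewrite szF ltnS (leq_trans (size_scale_leq _ _)) // (leq_trans szE).
    by rewrite size_polyDl // szF eqxx monicE lead_coefDl // -monicE F1.
  apply: uniq_perm; rewrite ?uniq_monics //.
    by rewrite map_inj_uniq ?uniq_monics //; apply: addIr.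
  move=> F; apply/idP/mapP => [FM|[G GM ->]]; last exact: inM.
  by exists (F - t *: E); rewrite ?subrK // -scaleNr inM.
have : #|'F_p|%:R * Lcoef Lam n = 0.
  rewrite mulr_natl -sumr_const (eq_bigr _ (fun t _ => Lt t)) exchange_big /=.
  rewrite big_seq big1 // => F FM; rewrite (eq_bigr _ (fun t _ => LamE F t FM)).
  rewrite -mulr_sumr; have [F0|F0] := eqVneq F.[0] 0.
    suff -> : Lam F = 0 by rewrite mul0r.
    by rewrite /Lam; case: allP => // /(_ 0 s0); rewrite F0 eqxx.
  by rewrite sum_psi ?mulr0 // !mulf_neq0 ?invr_eq0.
by move/eqP; rewrite mulf_eq0 pnatr_eq0 card_Fp // eqn0Ngt prime_gt0 //= => /eqP.
Qed.

End Weil.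

(** The left side is the exponent of the norm from F_(Q^2) to F_p followed by Euler's criterion; the
    right side, (Q^2-1)/2, is Euler's criterion on F_(Q^2). *)
Lemma sumn_half_power p m : odd p ->
  ((\sum_(i < m.+1 + m.+1) p ^ i) * p.-1./2 = (p ^ m.+1).-1./2 * (p ^ m.+1).+1)%N.
Proof.
move=> p_odd; have p0 : (0 < p)%N by case: p p_odd.
have Qodd : odd (p ^ m.+1) by rewrite oddX p_odd orbT.
have Q0 : (0 < p ^ m.+1)%N by rewrite expn_gt0 p0.
have E := predn_exp p (m.+1 + m.+1); rewrite expnD in E.
have hp : (p.-1 = (p.-1./2).*2)%N by move: p_odd p0; clear; lia.
have hQ : ((p ^ m.+1).-1 = ((p ^ m.+1).-1./2).*2)%N.
  by move: Qodd Q0; move: (p ^ m.+1)%N; clear; lia.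
apply: double_inj; rewrite [RHS]doubleMl -hQ [X in X.*2 = _]mulnC [LHS]doubleMl -hp.
rewrite -E; move: Q0; move: (p ^ m.+1)%N; clear => Q Q0.
by case: Q Q0 => // Q _; nia.
Qed.

Lemma iter_addr_nat (C : pzSemiRingType) n (x : C) : iter n (+%R x) 0 = x * n%:R.
Proof. by rewrite iter_addr addr0 mulr_natr. Qed.

(** * Equidistribution of trace and norm classes over extensions of even degree *)

Section MixedSums.
Variables (p : nat) (p_pr : prime p) (p_odd : odd p) (C : numClosedFieldType).
Variable psi : 'F_p -> C.
Hypotheses (psiD : forall x y, psi (x + y) = psi x * psi y)
  (psi_norm : forall x, `|psi x| = 1) (psi_nontriv : psi 1 != 1).
Variables (s : seq 'F_p) (c : 'F_p -> 'F_p) (e : 'F_p -> bool).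
Hypotheses (s_uniq : uniq s) (s0 : 0 \in s) (c0 : c 0 != 0).
Hypothesis e_cond : e 0 \/ (forall a, a \in s -> ~~ e a).
Variables (K : closedFieldType) (emb : {rmorphism 'F_p -> K}).
Let d := size s.
Let pcharK := pchar_closure p_pr emb.
Let lin (a : 'F_p) : {poly K} := (emb a)%:P - 'X.

Let Dp : {poly K} := \prod_(a <- s) lin a.
Let D1 : {poly K} := - \prod_(a <- rem 0 s) lin a.
Let hp : {poly K} := \sum_(a <- s) emb (c a) *: \prod_(b <- rem a s) lin b.
(** In the absence of the quadratic character f is a placeholder with a simple zero at 0. *)
Let fp : {poly K} := if e 0 then \prod_(a <- s | e a) lin a else 'X.
Let f1 : {poly K} := if e 0 then - \prod_(a <- rem 0 s | e a) lin a else 1.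

Let lin0 : lin 0 = - 'X. Proof. by rewrite /lin rmorph0 sub0r. Qed.
Let linE a u : (lin a).[u] = emb a - u.
Proof. by rewrite /lin hornerD hornerN hornerX hornerC. Qed.

Let size_lin a : size (lin a) = 2%N.
Proof. by rewrite /lin -opprB size_polyN size_XsubC. Qed.

Let size_prod_lin (r : seq 'F_p) (P : pred 'F_p) : (size (\prod_(a <- r | P a) lin a)%R <= (size r).+1)%N.
Proof.
elim: r => [|a r IHr]; first by rewrite big_nil size_poly1.
rewrite big_cons; case: ifP => _; last exact: leq_trans IHr _.
by apply: leq_trans (size_polyMleq _ _) _; rewrite size_lin.
Qed.

Let DpE : Dp = 'X * D1.
Proof. by rewrite /Dp (big_rem 0 s0) /= lin0 mulNr /D1 mulrN. Qed.

Let fpE : fp = 'X * f1.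
Proof.
rewrite /fp /f1; case: ifP => e0; last by rewrite mulr1.
by rewrite (big_rem 0 s0) /= e0 lin0 mulNr mulrN.
Qed.

Let prod_lin0 (P : pred 'F_p) : (\prod_(a <- rem 0 s | P a) lin a).[0] != 0.
Proof.
rewrite horner_prod prodf_seq_neq0; apply/allP => a; rewrite rem_filter // mem_filter /=.
by case/andP=> a0 _; rewrite linE subr0 fmorph_eq0 a0 implybT.
Qed.

Let D10 : D1.[0] != 0.
Proof. by rewrite /D1 hornerN oppr_eq0 prod_lin0. Qed.

Let f10 : f1.[0] != 0.
Proof.
rewrite /f1; case: ifP => _; last by rewrite hornerC oner_neq0.
by rewrite hornerN oppr_eq0 prod_lin0.
Qed.

Let hp0 : hp.[0] != 0.
Proof.
rewrite /hp (big_rem 0 s0) /= hornerD hornerZ [X in _ + X]horner_sum [X in _ + X]big_seq [X in _ + X]big1 ?addr0.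
  by rewrite mulf_neq0 ?fmorph_eq0 // prod_lin0.
move=> a; rewrite rem_filter // mem_filter => /andP[/= a0 sa].
have s0' : 0 \in rem a s by rewrite rem_filter // mem_filter /= eq_sym a0.
by rewrite hornerZ (big_rem 0 s0') /= hornerM lin0 hornerN hornerX oppr0 mul0r mulr0.
Qed.

Let d0 : (0 < d)%N. Proof. by rewrite /d; case: (s) s0. Qed.

Let size_Dp : (size Dp <= d.+1)%N. Proof. exact: size_prod_lin. Qed.

Let size_fp : (size fp <= d.+1)%N.
Proof. by rewrite /fp; case: ifP => _; [exact: size_prod_lin | rewrite size_polyX]. Qed.

Let size_hp : (size hp <= d.+1)%N.
Proof.
rewrite /hp big_seq; apply: leq_trans (size_sum _ _ _) _; apply/bigmax_leqP_seq => a sa _.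
apply: leq_trans (size_scale_leq _ _) _; apply: leq_trans (size_prod_lin _ _) _.
by rewrite size_rem // ltnS leq_pred.
Qed.

Let hDE u : Dp.[u] != 0 -> hp.[u] / Dp.[u] = \sum_(a <- s) emb (c a) / (emb a - u).
Proof.
move=> Du; rewrite /hp horner_sum mulr_suml; apply: eq_big_seq => a sa.
move: Du; rewrite /Dp (big_rem a sa) /= hornerM hornerZ linE mulf_eq0 negb_or.
by case/andP=> a0 r0; rewrite -mulf_div divff ?mulr1.
Qed.

Variable m : nat.
Let n := (m.+1 + m.+1)%N.
Let Q := (p ^ m.+1)%N.

Let emb_exp a i : emb a ^+ (p ^ i) = emb a.
Proof.
elim: i => [|i IHi]; first by rewrite expn0 expr1.
by rewrite expnSr exprM IHi -(frobE p_pr emb) frob_iota.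
Qed.

Let mem_ext_n u : u \in ext p K n.-1 -> u ^+ (p ^ n) = u.
Proof. by rewrite mem_ext // => /eqP. Qed.

Let lin_exp a u i : emb a - u ^+ (p ^ i) = (emb a - u) ^+ (p ^ i).
Proof.
rewrite (pexpD pcharK) emb_exp; congr (_ + _); apply/eqP.
rewrite eq_sym -addr_eq0 -(pexpD pcharK) addNr expr0n.
by rewrite expn_eq0 eqn0Ngt prime_gt0.
Qed.

Let emb_minp a u : u ^+ (p ^ n) = u ->
  emb ((minp emb n u).[a]) = \prod_(i < n) (emb a - u) ^+ (p ^ i).
Proof.
move=> un; rewrite -horner_map minpK // /orbp horner_prod; apply: eq_bigr => i _.
by rewrite hornerXsubC lin_exp.
Qed.

Let minp_neq0 a u : u ^+ (p ^ n) = u -> ((minp emb n u).[a] != 0) = (emb a != u).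
Proof.
move=> un; rewrite -(fmorph_eq0 emb) emb_minp // -[in RHS]subr_eq0.
have [->|au] := eqVneq (emb a - u) 0.
  rewrite (bigD1 (Ordinal (isT : 0 < n)%N)) //= expr0n expn_eq0 eqn0Ngt prime_gt0 //=.
  by rewrite mul0r eqxx.
by apply/prodf_neq0 => i _; rewrite expf_neq0.
Qed.

Definition good u := all (fun a => (minp emb n u).[a] != 0) s.
Definition trace_class u : 'F_p :=
  \sum_(a <- s) c a * ((minp emb n u)^`().[a] / (minp emb n u).[a]).
Definition norm_class u : 'F_p := \prod_(a <- s | e a) (minp emb n u).[a].

Let goodE u : u ^+ (p ^ n) = u -> good u = (Dp.[u] != 0).
Proof.
move=> un; rewrite /Dp horner_prod prodf_seq_neq0; apply: eq_all => a.
by rewrite /= minp_neq0 // linE subr_eq0.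
Qed.

Let emb_trace u : u ^+ (p ^ n) = u -> good u ->
  emb (trace_class u) = \sum_(0 <= i < n) (hp.[u] / Dp.[u]) ^+ (p ^ i).
Proof.
move=> un gu; rewrite hDE -?goodE // big_mkord.
under [RHS]eq_bigr => i _ do rewrite pexp_sum //.
rewrite exchange_big rmorph_sum; apply: eq_big_seq => a sa /=.
rewrite rmorphM fmorph_div -!horner_map -deriv_map minpK // /orbp.
rewrite deriv_prod_XsubC.
  rewrite mulr_sumr; apply: eq_bigr => i _; rewrite expr_div_n emb_exp.
  by rewrite lin_exp.
rewrite -/(orbp p n u) -(minpK p_pr emb un) horner_map fmorph_eq0.
by move/allP: gu => /(_ a sa).
Qed.

Let norm_class_neq0 u : good u -> norm_class u != 0.
Proof.
move/allP=> gu; rewrite /norm_class prodf_seq_neq0; apply/allP => a sa.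
by rewrite gu // implybT.
Qed.

Let emb_norm u : u ^+ (p ^ n) = u -> e 0 ->
  emb (norm_class u ^+ p.-1./2) = fp.[u] ^+ ((Q.-1)./2 * Q.+1).
Proof.
move=> un e0; rewrite rmorphXn /= /norm_class rmorph_prod /=.
under eq_bigr => a _ do rewrite emb_minp // prodrXr.
rewrite prodrXl -exprM sumn_half_power // /fp e0 horner_prod; congr (_ ^+ _).
by apply: eq_bigr => a _; rewrite linE.
Qed.

Let norm_class1 u : ~~ e 0 -> norm_class u = 1.
Proof.
move=> e0; case: e_cond e0 => [->//|ne _].
rewrite /norm_class big_seq_cond big_pred0 // => a.
by apply/andP=> -[sa ea]; have := ne a sa; rewrite ea.
Qed.

(** A point is classified by its trace and by whether its norm is a nonsquare. The boolean [e 0]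
    counts as 0 or 1, so the second coordinate takes one or two values. *)
Let cls u : 'F_p * 'I_(e 0).+1 := (trace_class u, inord (norm_class u ^+ p.-1./2 != 1)).
Let W (j : 'F_p * 'I_(e 0).+1) : C := psi j.1 * (-1) ^+ j.2.
Let Z := [seq u <- ext p K n.-1 | good u].

Let clsE u : (cls u).2 = (norm_class u ^+ p.-1./2 != 1) :> nat.
Proof.
rewrite /= inordK //; case: (boolP (e 0)) => e0; first by case: (_ == _).
by rewrite norm_class1 // expr1n eqxx.
Qed.

Let Lam_cls u : good u -> Lam psi s c e (minp emb n u) = W (cls u).
Proof.
move=> gu; rewrite /Lam -/(good u) gu -/(norm_class u) -/(trace_class u) mulrC /W clsE.
congr (_ * _); rewrite /chi (negPf (norm_class_neq0 gu)).
by case: ifP => _; rewrite ?expr0 ?expr1.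
Qed.

Let Spow_cls : Spow emb (Lam psi s c e) n =
  \sum_j W j * (count (fun u => cls u == j) Z)%:R.
Proof.
rewrite /Spow (bigID good) /= [X in _ + X]big1 ?addr0; last first.
  by move=> u /negPf gu; rewrite /Lam -/(good u) gu.
rewrite (eq_bigr _ (@Lam_cls)) -big_filter -/Z.
rewrite (partition_big cls xpredT) //=; apply: eq_bigr => j _.
rewrite (eq_bigr (fun=> W j)) => [|u /eqP-> //].
by rewrite big_const_seq iter_addr_nat.
Qed.

Let card_J : #|{: ('F_p * 'I_(e 0).+1)%type}| = ((e 0%R).+1 * p)%N.
Proof. by rewrite card_prod card_Fp // card_ord mulnC. Qed.

Let sumW : \sum_j W j = 0.
Proof.
rewrite -(pair_big xpredT xpredT (fun t b => psi t * (-1) ^+ (nat_of_ord b))) /=.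
rewrite exchange_big big1 // => b _; rewrite -mulr_suml.
have := sum_psi psiD psi_nontriv (oner_neq0 _).
by under eq_bigr => t _ do rewrite mulr1; move=> ->; rewrite mul0r.
Qed.

Let normW j : `|W j| <= 1.
Proof. by rewrite /W normrM psi_norm mul1r normrX normrN1 expr1n. Qed.

Let count_cls_le j : (0 < m)%N -> (6 * d + 8 <= Q)%N ->
  ((e 0%R).+1 * p * count (fun u => cls u == j) Z <= Q ^ 2 + 2 * p * (8 * d + 9) * Q)%N.
Proof.
move=> m0 dQ; rewrite -size_filter.
have sgn0 : (-1 : K) ^+ j.2 != 0 by rewrite expf_neq0 // oppr_eq0 oner_neq0.
have E12 : (0 < (e 0%R).+1 <= 2)%N by case: (e 0).
apply: (stepanov_bound p_pr p_odd pcharK (s := (-1) ^+ j.2) (t := emb j.1) hp0 D10 f10 DpE fpE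
   size_hp size_Dp size_fp E12 sgn0 m0 dQ).
  by rewrite !filter_uniq // uniq_ext.
move=> u; rewrite !mem_filter => /andP[/eqP clsj /andP[gu uE]].
have un := mem_ext_n uE; split.
- by rewrite -expnM muln2 -addnn.
- by rewrite -goodE.
- by rewrite -clsj emb_trace.
move=> E2; have e0 : e 0 by move: E2; case: (e 0).
rewrite -emb_norm // -clsj clsE.
case/orP: (Fp_half_power p_pr p_odd (norm_class_neq0 gu)) => /eqP ->.
  by rewrite eqxx rmorph1 expr0.
by rewrite eq_sym Fp_one_neqN1 // rmorphN1 expr1.
Qed.

Let sum_count_cls : (\sum_j count (fun u => cls u == j) Z = size Z)%N.
Proof.
rewrite -(sum1_size Z) (partition_big cls xpredT) //=; apply: eq_bigr => j _.
by rewrite sum1_count.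
Qed.

(** A point is bad only if it lies in the image of [s]. *)
Let size_Z : (Q ^ 2 <= size Z + d)%N.
Proof.
have -> : (Q ^ 2 = size (ext p K n.-1))%N.
  by rewrite size_ext // -expnM muln2 -addnn.
rewrite -(count_predC good) size_filter leq_add2l -size_filter /d -(size_map emb s).
apply: uniq_leq_size; first by rewrite filter_uniq ?uniq_ext.
move=> u; rewrite mem_filter => /andP[/= ngu /mem_ext_n un].
move: ngu; rewrite /good -has_predC => /hasP[a sa /=].
by rewrite negbK -[_ == 0]negbK minp_neq0 // negbK => /eqP <-; apply: map_f.
Qed.

(** The field has Q^2 elements, so an error linear in Q is square-root cancellation; p and d stay
    fixed as Q grows. *)
Lemma Spow_bound : (0 < m)%N -> (6 * d + 8 <= Q)%N ->
  `|Spow emb (Lam psi s c e) n| <= (2 * (2 * p * (8 * d + 9) * Q) + d)%:R.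
Proof.
move=> m0 dQ; rewrite Spow_cls; apply: (balanced_sum_bound (T := (Q ^ 2)%N) sumW normW).
- by move=> j; rewrite card_J; apply: count_cls_le.
- by rewrite sum_count_cls size_Z.
- by rewrite card_J muln_gt0 (prime_gt0 p_pr).
Qed.

End MixedSums.

(** * From the even power sums to the size of each reciprocal root *)

Section WeilBound.
Variables (p : nat) (p_pr : prime p) (p_odd : odd p) (C : numClosedFieldType).
Hypothesis C_archi : forall x : C, exists n : nat, `|x| <= n%:R.
Variable psi : 'F_p -> C.
Hypotheses (psiD : forall x y, psi (x + y) = psi x * psi y)
  (psi_norm : forall x, `|psi x| = 1) (psi_nontriv : psi 1 != 1).

Definition mixed_sum (s : seq 'F_p) (c : 'F_p -> 'F_p) (e : 'F_p -> bool) : C :=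
  \sum_(x | x \notin s) (\prod_(a <- s | e a) chi C (a - x)) * psi (\sum_(a <- s) c a / (a - x)).

Lemma Spow1 (K : closedFieldType) (emb : {rmorphism 'F_p -> K}) s c e :
  Spow emb (Lam psi s c e) 1 = mixed_sum s c e.
Proof.
have extE : perm_eq (ext p K 0) [seq emb x | x : 'F_p].
  apply: uniq_perm; rewrite ?uniq_ext //.
    by rewrite map_inj_uniq ?enum_uniq //; apply: fmorph_inj.
  move=> u; rewrite mem_ext // expn1; apply/eqP/mapP => [up|[x _ ->]].
    by exists (down emb u); rewrite ?mem_enum // down_fix.
  by rewrite -(frobE p_pr emb) frob_iota.
rewrite /Spow /= (perm_big _ extE) /= big_image /mixed_sum [RHS]big_mkcond /=.
apply: eq_bigr => x _.
have -> : minp emb 1 (emb x) = 'X - x%:P.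
  apply: (map_poly_inj emb); rewrite (minpK p_pr) ?expn1; last first.
    by rewrite -(frobE p_pr emb) frob_iota.
  rewrite /orbp big_ord_recl big_ord0 mulr1 expn0 expr1.
  by rewrite rmorphB /= map_polyX map_polyC.
rewrite /Lam; have -> : all (fun a => ('X - x%:P).[a] != 0) s = (x \notin s).
  apply/allP/idP => [sx|xs a sa]; last first.
    by rewrite hornerXsubC subr_eq0; apply: contraNneq xs => <-.
  by apply/negP => /sx; rewrite hornerXsubC subrr eqxx.
case: ifP => // _; rewrite chi_prod //; congr (_ * psi _).
  by apply: eq_bigr => a _; rewrite hornerXsubC.
by apply: eq_bigr => a _; rewrite hornerXsubC derivXsubC hornerC mul1r.
Qed.

Lemma weil_bound0 (s : seq 'F_p) (c : 'F_p -> 'F_p) (e : 'F_p -> bool) : uniq s -> 0 \in s -> c 0 != 0 ->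
  e 0 \/ (forall a, a \in s -> ~~ e a) ->
  `|mixed_sum s c e| <= (2 * size s)%:R * sqrtC p%:R.
Proof.
move=> us s0 c0 ec; have [K [emb _]] := countable_algebraic_closure 'F_p.
pose L := Lam psi s c e; pose d := size s.
have d0 : (0 < d)%N by rewrite /d; case: (s) s0.
(* By [Lcoef_vanish] the truncation loses nothing: this is the whole L-function, of degree at most
   2d - 1. *)
pose P : {poly C} := \poly_(i < 2 * d) Lcoef L i.
have PE i : P`_i = Lcoef L i.
  rewrite coef_poly; case: ltnP => // le.
  by rewrite /L (Lcoef_vanish p_pr p_odd psiD psi_nontriv e us s0 c0).
have P0 : P`_0 = 1 by rewrite PE /L (Lcoef0 psiD psi_norm).
have szP : (size P <= (2 * d).-1.+1)%N by rewrite prednK ?muln_gt0 // size_poly.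
have [al szal Pal] := rprod_surj P0 szP.
have Srec k : k%:R * (rprod al)`_k = \sum_(j < k) Spow emb L j.+1 * (rprod al)`_(k - j.+1).
  rewrite -Pal PE (Lcoef_rec p_pr emb (LamM p_pr p_odd psiD s c e)).
  by apply: eq_bigr => j _; rewrite PE.
have SE := power_sums_of_recursion Srec.
have p0 : (0 : C) < p%:R by rewrite ltr0n prime_gt0.
(* The k-th power sum of the a^2/p is the 2k-th one of the a divided by p^k, which is bounded in k
   by Stepanov's estimate. The entries then have modulus at most 1. *)
pose be := [seq a ^+ 2 / p%:R | a <- al].
have psum_be k : psum be k = psum al (2 * k) / p%:R ^+ k.
  rewrite /psum big_map mulr_suml; apply: eq_bigr => a _.
  by rewrite expr_div_n -exprM.
have be1 b : b \in be -> `|b| <= 1.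
  apply: (power_sums_bounded_le1 C_archi (B := (2 * (2 * p * (8 * d + 9)) + d)%:R)
     (k0 := (6 * d + 9)%N)) => k lek.
  have [m kE] : exists m, k = m.+1 by exists k.-1; rewrite prednK // (leq_trans _ lek) // addnS.
  have pk : (k < p ^ k)%N by rewrite ltn_expl // prime_gt1.
  have pk0 : (0 : C) < p%:R ^+ k by rewrite exprn_gt0.
  rewrite psum_be normrM normfV (ger0_norm (ltW pk0)) ler_pdivrMr //.
  have := Spow_bound p_pr p_odd psiD psi_norm psi_nontriv us s0 c0 ec emb (m := m).
  have -> : (m.+1 + m.+1 = (2 * k).-1.+1)%N by rewrite kE mul2n -addnn.
  rewrite -/L SE normrN prednK ?muln_gt0 ?kE // -kE => Sb; apply: le_trans (Sb _ _) _.
  - by rewrite -ltnS -kE (leq_trans _ lek) // addnC.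
  - by rewrite (leq_trans _ (ltnW pk)) // (leq_trans _ lek) // leq_add2l.
  rewrite -natrX -natrM ler_nat mulnDl -/d mulnA leq_add2l leq_pmulr //.
  by rewrite expn_gt0 prime_gt0.
have alp a : a \in al -> `|a| <= sqrtC p%:R.
  move=> ala; have := be1 _ (map_f (fun a => a ^+ 2 / p%:R) ala).
  rewrite normrM normrX normfV (ger0_norm (ltW p0)) ler_pdivrMr // mul1r => a2.
  by rewrite -(@ler_pXn2r _ 2) ?nnegrE ?sqrtC_ge0 ?ler0n // sqrtCK.
rewrite -(Spow1 emb) SE normrN /psum; apply: le_trans (ler_norm_sum _ _ _) _.
rewrite big_seq; apply: le_trans (_ : \sum_(a <- al) sqrtC p%:R <= _).
  by rewrite [leRHS]big_seq; apply: ler_sum => a ala; rewrite expr1 alp.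
rewrite big_const_seq count_predT iter_addr_nat szal mulrC ler_wpM2r //.
  by rewrite sqrtC_ge0 ler0n.
by rewrite ler_nat leq_pred.
Qed.

(** A translation moves the distinguished pole [a0] to 0. *)
Theorem weil_bound (s : seq 'F_p) (c : 'F_p -> 'F_p) (e : 'F_p -> bool) a0 : uniq s -> a0 \in s -> c a0 != 0 ->
  e a0 \/ (forall a, a \in s -> ~~ e a) ->
  `|mixed_sum s c e| <= (2 * size s)%:R * sqrtC p%:R.
Proof.
move=> us s0 c0 ec; pose s' := [seq a - a0 | a <- s].
have inj0 : injective (fun a : 'F_p => a - a0) by apply: addIr.
have := @weil_bound0 s' (fun a => c (a + a0)) (fun a => e (a + a0)).
rewrite size_map map_inj_uniq // -(subrr a0) (map_f (fun a => a - a0) s0) subrr add0r.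
have -> : mixed_sum s' (fun a => c (a + a0)) (fun a => e (a + a0)) = mixed_sum s c e.
  rewrite /mixed_sum (reindex_inj inj0) /=; apply: eq_big => [x|x _].
    by rewrite /s' (mem_map inj0).
  rewrite !big_map; congr (_ * psi _).
    by apply: eq_big => [a|a _]; rewrite ?subrK // opprB addrA subrK.
  apply: eq_bigr => a _; by rewrite subrK opprB addrA subrK.
apply=> //; case: ec => [|ne]; [by left | right => a /mapP[b sb ->]].
by rewrite subrK ne.
Qed.

End WeilBound.

(** * The moment of short sums *)

Lemma sum_count_mem (T : eqType) (V : nmodType) (l s : seq T) (g : T -> V) :
  uniq s -> {subset l <= s} -> \sum_(x <- l) g x = \sum_(a <- s) g a *+ count_mem a l.
Proof.
move=> us; elim: l => [|x l IHl] ls; first by rewrite big_nil big1.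
rewrite big_cons IHl => [|y ly]; last by rewrite ls // inE ly orbT.
under [RHS]eq_bigr => a _ do rewrite /= mulrnDr.
rewrite big_split /= [X in _ = X + _](bigD1_seq x) ?ls ?inE ?eqxx //=.
by rewrite [X in _ = _ + X + _]big1 ?addr0 ?mulr1n // => a ax; rewrite eq_sym (negPf ax).
Qed.

Lemma prod_count_mem (T : eqType) (V : comPzSemiRingType) (l s : seq T) (g : T -> V) :
  uniq s -> {subset l <= s} -> \prod_(x <- l) g x = \prod_(a <- s) g a ^+ count_mem a l.
Proof.
move=> us; elim: l => [|x l IHl] ls; first by rewrite big_nil big1.
rewrite big_cons IHl => [|y ly]; last by rewrite ls // inE ly orbT.
under [RHS]eq_bigr => a _ do rewrite /= exprD.
rewrite big_split /= [X in _ = X * _](bigD1_seq x) ?ls ?inE ?eqxx //=.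
by rewrite [X in _ = _ * X * _]big1 ?mulr1 ?expr1 // => a ax; rewrite eq_sym (negPf ax).
Qed.

Lemma sub_common_term (V : comPzRingType) (X Y X' Y' Z : V) :
  X + (X' - Z) - (Y + (Y' - Z)) = X - Y + (X' - Y').
Proof. by ring. Qed.

Lemma Fp_natr_inj p (a b : nat) : prime p -> (a < p)%N -> (b < p)%N ->
  (a%:R : 'F_p) = b%:R -> a = b.
Proof.
move=> p_pr ap bp /(congr1 val) /=.
by rewrite !val_Fp_nat // !modn_small.
Qed.

Section Moment.
Variables (p : nat) (p_pr : prime p) (p_odd : odd p) (C : numClosedFieldType).
Hypothesis C_archi : forall x : C, exists n : nat, `|x| <= n%:R.
Variable psi : 'F_p -> C.
Hypotheses (psiD : forall x y, psi (x + y) = psi x * psi y)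
  (psi_norm : forall x, `|psi x| = 1) (psi_nontriv : psi 1 != 1).
Notation chi := (@chi p C).

Lemma psiN x : psi (- x) = (psi x)^*.
Proof.
apply: (mulfI (psi_neq0 psi_norm x)).
by rewrite -psiD subrr (psi0 psiD psi_norm) -normCK psi_norm expr1n.
Qed.

Lemma psi_sum (I : Type) (r : seq I) (P : pred I) (f : I -> 'F_p) :
  psi (\sum_(i <- r | P i) f i) = \prod_(i <- r | P i) psi (f i).
Proof. exact: (big_morph psi psiD (psi0 psiD psi_norm)). Qed.

Variables A B : 'F_p.
Hypothesis A0 : A != 0.

Definition kap (v : 'F_p) : C := chi v * psi (A / v + B * v).

Lemma norm_kap v : `|kap v| <= 1.
Proof. by rewrite normrM psi_norm mulr1 norm_chi_le1. Qed.

Lemma conj_kap v : (kap v)^* = chi v * psi (- (A / v + B * v)).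
Proof. by rewrite rmorphM /= conj_chi psiN. Qed.

(** Grouping equal shifts gives a mixed sum with c_b = A (n1 - n2) and a quadratic factor at b when
    n1 + n2 is odd. As the lists have equal length, the part B v cancels and a constant phase
    remains. Multiplicities are at most r < p, so different ones stay different in the field. *)
Lemma kap_product_sum r (l l' : seq 'F_p) a : size l = r -> size l' = r -> (r < p)%N ->
  count_mem a l != count_mem a l' ->
  `|\sum_v (\prod_(k <- l) kap (k - v)) * (\prod_(k <- l') (kap (k - v))^*)|
    <= (4 * r)%:R * sqrtC p%:R.
Proof.
move=> szl szl' rp neq; pose s := undup (l ++ l').
pose n1 b := count_mem b l; pose n2 b := count_mem b l'.
have us : uniq s by apply: undup_uniq.
have szs : (size s <= 2 * r)%N.
  by apply: leq_trans (size_undup _) _; rewrite size_cat szl szl' addnn mul2n.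
have ls : {subset l <= s} by move=> x xl; rewrite mem_undup mem_cat xl.
have ls' : {subset l' <= s} by move=> x xl; rewrite mem_undup mem_cat xl orbT.
pose c b := A * ((n1 b)%:R - (n2 b)%:R).
pose e b := odd (n1 b + n2 b).
pose k0 := B * \sum_(k <- l) k - B * \sum_(k <- l') k.
have in_s b : n1 b != n2 b -> b \in s.
  rewrite mem_undup mem_cat -!has_pred1 !has_count -/(n1 b) -/(n2 b).
  by case: (n1 b) => // ; case: (n2 b).
have c_neq0 b : n1 b != n2 b -> c b != 0.
  move=> nb; rewrite mulf_neq0 // subr_eq0; apply: contra nb => /eqP /Fp_natr_inj -> //.
    by rewrite (leq_ltn_trans (count_size _ _)) // szl.
  by rewrite (leq_ltn_trans (count_size _ _)) // szl'.
(* A point with n1 + n2 odd has n1 different from n2 and carries the quadratic factor. If there is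
   none, no quadratic factor occurs at all and the given [a] serves. *)
have [a0 [sa0 ca0 ea0]] : exists a0, [/\ a0 \in s, c a0 != 0 &
    e a0 \/ forall b, b \in s -> ~~ e b].
  case: (boolP (has e s)) => [/hasP[b sb eb]|/hasPn ne].
    exists b; split=> //; last by left.
    by apply: c_neq0; apply: contraTneq eb; rewrite /e => ->; rewrite addnn odd_double.
  by exists a; split; [apply: in_s | apply: c_neq0 | right].
have psi_part v : (\sum_(k <- l) (A / (k - v) + B * (k - v))) +
    (\sum_(k <- l') - (A / (k - v) + B * (k - v))) = \sum_(b <- s) c b / (b - v) + k0.
  rewrite sumrN !big_split /=.
  have lE (t : seq 'F_p) : size t = r ->
      \sum_(k <- t) B * (k - v) = B * \sum_(k <- t) k - B * v *+ r.
    move=> <-; rewrite mulr_sumr -(count_predT t) -iter_addr_0 -big_const_seq -sumrB.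
    by apply: eq_bigr => k _; rewrite mulrBr.
  rewrite !lE // (sum_count_mem (l := l) _ us ls) (sum_count_mem (l := l') _ us ls').
  have -> : \sum_(b <- s) c b / (b - v) =
     \sum_(b <- s) A / (b - v) *+ n1 b - \sum_(b <- s) A / (b - v) *+ n2 b.
    rewrite -sumrB; apply: eq_bigr => b _.
    by rewrite /c mulrBr mulrBl !mulr_natr !mulrnAl.
  rewrite /k0; move: (\sum_(b <- s) _ *+ n1 b) (\sum_(b <- s) _ *+ n2 b) => X Y.
  move: (B * \sum_(k <- l) k) (B * \sum_(k <- l') k) (B * v *+ r) => X' Y' Z.
  exact: sub_common_term.
have summand v : (\prod_(k <- l) kap (k - v)) * (\prod_(k <- l') (kap (k - v))^*) =
   (\prod_(b <- s) chi (b - v) ^+ (n1 b + n2 b)) *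
   psi (\sum_(b <- s) c b / (b - v)) * psi k0.
  under [X in _ * X]eq_bigr => k _ do rewrite conj_kap.
  rewrite /kap !big_split /= mulrACA -!psi_sum -psiD psi_part -[RHS]mulrA -[in RHS]psiD.
  under [X in _ = X * _]eq_bigr => b _ do rewrite exprD.
  rewrite [X in _ = X * _]big_split /=; congr (_ * _).
  by rewrite -(prod_count_mem (fun k => chi (k - v)) us ls)
    -(prod_count_mem (fun k => chi (k - v)) us ls').
under eq_bigr => v _ do rewrite summand.
rewrite -mulr_suml normrM psi_norm mulr1.
have -> : \sum_v (\prod_(b <- s) chi (b - v) ^+ (n1 b + n2 b)) *
   psi (\sum_(b <- s) c b / (b - v)) = mixed_sum psi s c e.
  rewrite /mixed_sum [RHS]big_mkcond; apply: eq_bigr => v _ /=.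
  case: (boolP (v \in s)) => [vs|vs] /=.
    have nv : (0 < n1 v + n2 v)%N.
      move: vs; rewrite mem_undup mem_cat -!has_pred1 !has_count -/(n1 v) -/(n2 v).
      by rewrite addn_gt0.
    by rewrite (big_rem v vs) /= subrr chi0 expr0n gtn_eqF // !mul0r.
  congr (_ * _); rewrite [RHS]big_mkcond; apply: eq_big_seq => b bs /=.
  have bv : b - v != 0 by rewrite subr_eq0; apply: contraNneq vs => <-.
  rewrite -(odd_double_half (n1 b + n2 b)) exprD -mul2n exprM chi_sqr // expr1n mulr1.
  by rewrite -/(e b); case: (e b).
apply: le_trans (weil_bound p_pr p_odd C_archi psiD psi_norm psi_nontriv us sa0 ca0 ea0) _.
rewrite ler_wpM2r ?sqrtC_ge0 ?ler0n // ler_nat.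
by apply: leq_trans (leq_mul (leqnn 2) szs) _; rewrite mulnA.
Qed.

Section Expand.
Variables (K r : nat).
Hypotheses (Kp : (K <= p)%N) (rp : (r < p)%N).
Notation fT := {ffun 'I_r -> 'I_K}.

Definition shift_seq (f : fT) : seq 'F_p := [seq (val (f i))%:R | i : 'I_r].

Lemma size_shift_seq f : size (shift_seq f) = r.
Proof. by rewrite size_image card_ord. Qed.

Definition moment_term (ff : fT * fT) : C :=
  \sum_v (\prod_(k <- shift_seq ff.1) kap (k - v)) *
         (\prod_(k <- shift_seq ff.2) (kap (k - v))^*).

Lemma moment_expand :
  \sum_v `|\sum_(k < K) kap (v + k%:R)| ^+ (2 * r) = \sum_ff moment_term ff.
Proof.
(* v is replaced by -v to match the form k - v of the mixed sums. *)
rewrite (reindex_inj (@oppr_inj _)) /= exchange_big /=; apply: eq_bigr => v _.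
pose S := \sum_(k < K) kap (k%:R - v).
have -> : \sum_(k < K) kap (- v + k%:R) = S by apply: eq_bigr => k _; rewrite addrC.
rewrite exprM normCK exprMn /S rmorph_sum /=.
have prodE (g : 'I_K -> C) : (\sum_k g k) ^+ r = \sum_(f : fT) \prod_i g (f i).
  by rewrite -(bigA_distr_bigA (fun _ : 'I_r => g)) prodr_const card_ord.
rewrite !prodE mulr_suml -(pair_bigA _ (fun f1 f2 =>
  (\prod_(k <- shift_seq f1) kap (k - v)) * (\prod_(k <- shift_seq f2) (kap (k - v))^*))) /=.
apply: eq_bigr => f1 _; rewrite mulr_sumr; apply: eq_bigr => f2 _.
by rewrite /shift_seq !big_image.
Qed.

Lemma norm_moment_term_le ff : `|moment_term ff| <= p%:R.
Proof.
apply: le_trans (ler_norm_sum _ _ _) _; apply: le_trans (_ : \sum_(v : 'F_p) 1 <= _).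
  apply: ler_sum => v _; rewrite normrM !normr_prod mulr_ile1 ?prodr_ge0 //.
    by apply: prodr_ile1 => k _; rewrite normr_ge0 norm_kap.
  by apply: prodr_ile1 => k _; rewrite normr_ge0 norm_conjC norm_kap.
by rewrite sumr_const card_Fp.
Qed.

(** Deliberately one-sided: every value of the second function is a value of the first. Off this set
    some shift has multiplicity 0 on one side and not on the other, as [kap_product_sum] requires;
    on it the second function is the first composed with a self-map of the indices, which gives the
    count r^r K^r. *)
Definition diagonal (ff : fT * fT) := [forall i, [exists j, ff.2 i == ff.1 j]].

Lemma norm_moment_term_offdiag ff : ~~ diagonal ff ->
  `|moment_term ff| <= (4 * r)%:R * sqrtC p%:R.
Proof.
rewrite negb_forall => /existsP[i]; rewrite negb_exists => /forallP ni.
apply: (@kap_product_sum r _ _ (val (ff.2 i))%:R); rewrite ?size_shift_seq //.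
have -> : count_mem (val (ff.2 i))%:R (shift_seq ff.1) = 0%N.
  apply/count_memPn/negP => /mapP[j _] /Fp_natr_inj e.
  have := ni j; rewrite -val_eqE /= e ?eqxx //; exact: leq_trans (ltn_ord _) Kp.
rewrite eq_sym -lt0n -has_count has_pred1; apply/mapP; exists i => //.
by rewrite mem_enum.
Qed.

Lemma card_diagonal : (#|diagonal| <= r ^ r * K ^ r)%N.
Proof.
pose h (fg : fT * {ffun 'I_r -> 'I_r}) : fT * fT := (fg.1, [ffun i => fg.1 (fg.2 i)]).
have sub : diagonal \subset codom h.
  apply/subsetP => -[f1 f2] /forallP d12; apply/codomP.
  exists (f1, [ffun i => xchoose (existsP (d12 i))]); rewrite /h /=; congr (_, _).
  by apply/ffunP => i; rewrite !ffunE; apply/eqP/(xchooseP (existsP (d12 i))).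
apply: leq_trans (subset_leq_card sub) _; apply: leq_trans (leq_image_card _ _) _.
by rewrite card_prod !card_ffun !card_ord mulnC.
Qed.

Lemma moment_bound : \sum_v `|\sum_(k < K) kap (v + k%:R)| ^+ (2 * r)
  <= (r ^ r * K ^ r * p)%:R + (K ^ (2 * r) * (4 * r))%:R * sqrtC p%:R.
Proof.
have S0 : 0 <= \sum_v `|\sum_(k < K) kap (v + k%:R)| ^+ (2 * r).
  by apply: sumr_ge0 => v _; rewrite exprn_ge0.
rewrite -(ger0_norm S0) moment_expand; apply: le_trans (ler_norm_sum _ _ _) _.
rewrite (bigID diagonal) /=; apply: lerD.
  apply: le_trans (ler_sum _ (fun ff _ => norm_moment_term_le ff)) _.
  rewrite sumr_const -mulrnA ler_nat mulnC leq_mul2r; apply/orP; right.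
  exact: card_diagonal.
apply: le_trans (ler_sum _ norm_moment_term_offdiag) _.
rewrite sumr_const -[X in X <= _]mulr_natl mulrA -natrM ler_wpM2r ?sqrtC_ge0 ?ler0n // ler_nat.
rewrite leq_mul2r; apply/orP; right; apply: leq_trans (max_card _) _.
by rewrite card_prod !card_ffun !card_ord -expnD addnn mul2n.
Qed.

End Expand.
End Moment.

(** * Counting collisions *)

Section Inequalities.
Variable R : realDomainType.

Lemma chebyshev_sum (I : finType) (A : {pred I}) (x : I -> R) r :
  (forall i, 0 <= x i) ->
  (\sum_(i in A) x i) * (\sum_(i in A) x i ^+ r) <= #|A|%:R * \sum_(i in A) x i ^+ r.+1.
Proof.
move=> x0; rewrite -(ler_pM2l (ltr0n R 2)) -subr_ge0.
have -> : 2%:R * (#|A|%:R * \sum_(i in A) x i ^+ r.+1) -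
    2%:R * ((\sum_(i in A) x i) * (\sum_(i in A) x i ^+ r)) =
  \sum_(i in A) \sum_(j in A) (x i - x j) * (x i ^+ r - x j ^+ r).
  have e i j : (x i - x j) * (x i ^+ r - x j ^+ r) =
      (x i ^+ r.+1 - x i * x j ^+ r) + (x j ^+ r.+1 - x i ^+ r * x j).
    by rewrite !exprS; ring.
  under [RHS]eq_bigr => i _ do under eq_bigr => j _ do rewrite e.
  under [RHS]eq_bigr => i _ do rewrite big_split /= !sumrB -!mulr_sumr sumr_const.
  rewrite big_split /= !sumrB sumr_const -!mulr_suml sumrMnl.
  rewrite -[(\sum_(i in A) x i ^+ r.+1) *+ #|A|]mulr_natl.
  move: (\sum_(i in A) x i) (\sum_(i in A) x i ^+ r) (\sum_(i in A) x i ^+ r.+1) => X Y Z.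
  by move: (#|A|%:R : R) => n; ring.
apply: sumr_ge0 => i _; apply: sumr_ge0 => j _.
case: (lerP (x i) (x j)) => [le|/ltW le].
  by rewrite -mulrNN !opprB mulr_ge0 ?subr_ge0 // lerXn2r ?nnegrE.
by rewrite mulr_ge0 ?subr_ge0 // lerXn2r ?nnegrE.
Qed.

Lemma power_mean (I : finType) (A : {pred I}) (x : I -> R) r :
  (forall i, 0 <= x i) ->
  (\sum_(i in A) x i) ^+ r.+1 <= #|A|%:R ^+ r * \sum_(i in A) x i ^+ r.+1.
Proof.
move=> x0; elim: r => [|r IHr]; first by rewrite expr0 mul1r !expr1.
have s0 : 0 <= \sum_(i in A) x i by apply: sumr_ge0.
rewrite exprS; apply: le_trans (ler_wpM2l s0 IHr) _.
rewrite mulrCA exprSr -mulrA ler_wpM2l ?exprn_ge0 //; exact: chebyshev_sum.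
Qed.

Lemma cauchy_schwarz_sum (I : finType) (a b : I -> R) :
  (\sum_i a i * b i) ^+ 2 <= (\sum_i a i ^+ 2) * (\sum_i b i ^+ 2).
Proof.
rewrite -(ler_pM2l (ltr0n R 2)) -subr_ge0.
have -> : 2%:R * ((\sum_i a i ^+ 2) * (\sum_i b i ^+ 2)) - 2%:R * (\sum_i a i * b i) ^+ 2 =
  \sum_i \sum_j (a i * b j - a j * b i) ^+ 2.
  have e i j : (a i * b j - a j * b i) ^+ 2 =
     (a i ^+ 2 * b j ^+ 2 + b i ^+ 2 * a j ^+ 2) - (a i * b i * (a j * b j)) *+ 2.
    by rewrite mulr2n; ring.
  under [RHS]eq_bigr => i _ do under eq_bigr => j _ do rewrite e.
  under [RHS]eq_bigr => i _ do
    rewrite sumrB big_split /= -!mulr_sumr sumrMnl -mulr_sumr.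
  by rewrite sumrB big_split /= -!mulr_suml sumrMnl -mulr_suml mulr2n; ring.
by apply: sumr_ge0 => i _; apply: sumr_ge0 => j _; rewrite sqr_ge0.
Qed.

Lemma multiplicity_sum (I T : finType) (A : {set I}) (u : I -> T) (g : T -> R) :
  \sum_(j in A) g (u j) = \sum_v #|[set j in A | u j == v]|%:R * g v.
Proof.
rewrite (partition_big u xpredT) //=; apply: eq_bigr => v _.
rewrite (eq_bigr (fun=> g v)) => [|j /andP[_ /eqP->] //].
rewrite sumr_const mulr_natl; congr (_ *+ _).
by apply: eq_card => j; rewrite !inE.
Qed.

Lemma sum_multiplicity_sqr (I T : finType) (A : {set I}) (u : I -> T) :
  (\sum_v #|[set j in A | u j == v]| ^ 2 =
   #|[set jj in setX A A | u jj.1 == u jj.2]|)%N.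
Proof.
rewrite -sum1_card (partition_big (fun jj => u jj.1) xpredT) //=; apply: eq_bigr => v _.
rewrite -mulnn -cardsX -sum1_card; apply: eq_bigl => -[i j]; rewrite !inE /=.
case: (i \in A); case: (j \in A); rewrite ?andbF //=.
by case: (u i =P v) => [<-|_]; rewrite ?andbF ?andbT //= eq_sym.
Qed.

(** The power mean inequality produces |A|^(2r); grouping by the value of [u] and Cauchy-Schwarz
    then separate the squared multiplicities, which count collisions, from the full moment of S. *)
Lemma collision_holder (I T : finType) (A : {set I}) (u : I -> T) (S : T -> R) r :
  (forall v, 0 <= S v) ->
  (\sum_(j in A) S (u j)) ^+ (2 * r.+1) <=
  #|A|%:R ^+ (2 * r) * #|[set jj in setX A A | u jj.1 == u jj.2]|%:R *
  \sum_v S v ^+ (2 * r.+1).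
Proof.
move=> S0; have s0 : 0 <= \sum_(j in A) S (u j) by apply: sumr_ge0.
rewrite mulnC exprM; have pm := @power_mean I (mem A) (fun j => S (u j)) r (fun j => S0 _).
have pm0 : 0 <= (\sum_(j in A) S (u j)) ^+ r.+1 by rewrite exprn_ge0.
apply: le_trans (_ : (#|A|%:R ^+ r * \sum_(j in A) S (u j) ^+ r.+1) ^+ 2 <= _).
  by rewrite lerXn2r ?nnegrE // (le_trans pm0).
rewrite exprMn -exprM mulnC -mulrA ler_wpM2l ?exprn_ge0 //.
rewrite (@multiplicity_sum _ _ A u (fun v => S v ^+ r.+1)).
apply: le_trans (cauchy_schwarz_sum _ _) _.
rewrite -sum_multiplicity_sqr natr_sum le_eqVlt; apply/orP; left; apply/eqP.
congr (_ * _); apply: eq_bigr => v _; first by rewrite natrX.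
by rewrite -exprM mulnC.
Qed.

End Inequalities.

(** * Divisor counts under a hyperbola *)

Section Hyperbola.
Local Open Scope nat_scope.

(** Each dyadic block 2^i <= g < 2^(i+1) has 2^i terms of size at most M/2^i, so it contributes at
    most M. *)
Lemma sum_divn_le l M : \sum_(1 <= g < 2 ^ l) M %/ g <= M * l.
Proof.
elim: l => [|l IHl]; first by rewrite big_geq.
have l0 : 0 < 2 ^ l by rewrite expn_gt0.
rewrite (@big_cat_nat _ _ _ (2 ^ l)) //=; last by rewrite leq_exp2l.
rewrite mulnS addnC leq_add //.
apply: leq_trans (_ : \sum_(2 ^ l <= g < 2 ^ l.+1) M %/ 2 ^ l <= _).
  by rewrite big_nat [leqRHS]big_nat; apply: leq_sum => g /andP[lg _]; apply: leq_div2l.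
rewrite sum_nat_const_nat expnS mul2n -addnn addnK mulnC; exact: leq_divM.
Qed.

Definition hyperbola N M := [set ga : 'I_N * 'I_N | [&& 0 < ga.1, 0 < ga.2 & ga.1 * ga.2 <= M]].

Lemma card_hyperbola N M l : N <= 2 ^ l -> #|hyperbola N M| <= M * l.
Proof.
move=> Nl; apply: leq_trans (sum_divn_le l M).
rewrite -sum1_card (eq_bigl (fun ga : 'I_N * 'I_N => xpredT ga.1 &&
   [&& 0 < ga.1, 0 < ga.2 & ga.1 * ga.2 <= M])); last by move=> ga; rewrite inE.
rewrite -(pair_big_dep xpredT (fun g a : 'I_N => [&& 0 < g, 0 < a & g * a <= M]) (fun _ _ => 1)) /=.
apply: leq_trans (_ : \sum_(0 <= g < N) (if 0 < g then M %/ g else 0) <= _).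
  rewrite big_mkord; apply: leq_sum => g _; case: ifP => g0; last by rewrite big_pred0.
  rewrite sum1_card.
  have sub : {subset [pred a : 'I_N | [&& true, 0 < a & g * a <= M]] <= 
     image (fun i : 'I_(M %/ g) => insubd (Ordinal (ltn_ord g)) i.+1) predT}.
    move=> a /and3P[_ a0 gaM]; apply/imageP.
    have lt : a.-1 < M %/ g by rewrite prednK // leq_divRL // mulnC.
    exists (Ordinal lt) => //=; apply: val_inj; rewrite val_insubd /= prednK //.
    by rewrite ltn_ord.
  apply: leq_trans (subset_leq_card (introT subsetP sub)) _.
  by apply: leq_trans (leq_image_card _ _) _; rewrite card_ord.
case: N Nl => [|N] Nl; first by rewrite big_geq.
rewrite big_ltn //= add0n (@big_cat_nat _ _ _ N.+1 1 (2 ^ l)) //= .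
rewrite big_nat [X in _ <= X + _]big_nat.
rewrite (eq_bigr (fun g => M %/ g)); first exact: leq_addr.
by move=> g /andP[g0 _]; rewrite g0.
Qed.

Definition equal_products N M H := [set x : ('I_N * 'I_N) * ('I_N * 'I_N) |
  [&& 0 < x.1.1 <= M, 0 < x.1.2 <= H, 0 < x.2.1 <= M, 0 < x.2.2 <= H
    & x.1.1 * x.1.2 == x.2.1 * x.2.2]].

(* m y = m' y' forces m = g a, m' = g b, y = b d, y' = a d with g = gcd(m, m'). *)
Lemma card_equal_products N M H l : M < N -> H < N -> N <= 2 ^ l ->
  #|equal_products N M H| <= (M * l) * (H * l).
Proof.
case: N => // N MN HN Nl.
pose h (x : ('I_N.+1 * 'I_N.+1) * ('I_N.+1 * 'I_N.+1)) :=
  ((inord (x.1.1 * x.1.2) : 'I_N.+1, inord (x.2.1 * x.2.2) : 'I_N.+1),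
   (inord (x.1.1 * x.2.1) : 'I_N.+1, inord (x.1.2 * x.2.2) : 'I_N.+1)).
apply: leq_trans (leq_mul (card_hyperbola M Nl) (card_hyperbola H Nl)).
rewrite -cardsX; apply: leq_trans (leq_imset_card h _).
apply/subset_leq_card/subsetP => -[[m y] [m' y']]; rewrite inE /=.
case/and5P=> /andP[m0 mM] /andP[y0 yH] /andP[m'0 m'M] /andP[y'0 y'H] /eqP e.
pose g := gcdn m m'; have g0 : 0 < g by rewrite gcdn_gt0 m0.
pose a := m %/ g; pose b := m' %/ g.
have mE : m = g * a :> nat by rewrite mulnC divnK ?dvdn_gcdl.
have m'E : m' = g * b :> nat by rewrite mulnC divnK ?dvdn_gcdr.
have a0 : 0 < a by rewrite -(ltn_pmul2l g0) muln0 -mE.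
have b0 : 0 < b by rewrite -(ltn_pmul2l g0) muln0 -m'E.
have cop : coprime b a.
  by rewrite /coprime -(eqn_pmul2l g0) muln_gcdr -mE -m'E gcdnC muln1.
have e2 : a * y = b * y'.
  by apply/eqP; rewrite -(eqn_pmul2l g0) !mulnA -mE -m'E e.
have /dvdnP[d yE] : b %| y by rewrite -(Gauss_dvdr _ cop) e2 dvdn_mulr.
have y'E : y' = a * d :> nat.
  by apply/eqP; rewrite -(eqn_pmul2l b0) -e2 yE mulnA [(b * (a * d))%N]mulnCA mulnA mulnAC.
have d0 : 0 < d by move: y0; rewrite yE muln_gt0 => /andP[].
have lem (z t : nat) : 0 < t -> z * t <= N -> z <= N.
  by move=> t0; apply: leq_trans; rewrite leq_pmulr.
have gN : g < N.+1 by rewrite ltnS (@lem g a) // -mE -ltnS.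
have aN : a < N.+1 by rewrite ltnS (@lem a g) // mulnC -mE -ltnS.
have bN : b < N.+1 by rewrite ltnS (@lem b g) // mulnC -m'E -ltnS.
have dN : d < N.+1 by rewrite ltnS (@lem d b) // -yE -ltnS.
apply/imsetP; exists ((Ordinal gN, Ordinal aN), (Ordinal bN, Ordinal dN)).
  by rewrite !inE /= g0 a0 b0 d0 -mE mM mulnC -yE yH.
by rewrite /h /= [(b * d)%N]mulnC -mE -m'E -y'E -yE !inord_val.
Qed.

End Hyperbola.

(** With r_a the multiplicity of a, the related pairs number the sum of r_a r_b over related a, b.
    By 2 r_a r_b <= r_a^2 + r_b^2 and symmetry this is at most c times the sum of the r_a^2. *)
Lemma related_pairs (I T : finType) (A : {set I}) (u : I -> T) (e : rel T) c :
  symmetric e -> (forall a, #|[set b | e a b]| <= c)%N ->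
  (#|[set jj in setX A A | e (u jj.1) (u jj.2)]| <=
   c * #|[set jj in setX A A | u jj.1 == u jj.2]|)%N.
Proof.
move=> e_sym ec; pose r a := #|[set j in A | u j == a]|.
have -> : #|[set jj in setX A A | e (u jj.1) (u jj.2)]| =
    (\sum_a \sum_(b | e a b) r a * r b)%N.
  rewrite -sum1_card (partition_big (fun jj => u jj.1) xpredT) //=; apply: eq_bigr => a _.
  rewrite (partition_big (fun jj => u jj.2) (e a)) /=; last first.
    by move=> jj; rewrite !inE => /andP[/andP[_ eu] /eqP <-].
  apply: eq_bigr => b eab; rewrite -cardsX -sum1_card; apply: eq_bigl => -[i j].
  rewrite !inE /=; case: (i \in A); case: (j \in A); rewrite ?andbF //=.
  by case: (u i =P a) => [->|_]; case: (u j =P b) => [->|_]; rewrite ?andbF //= eab.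
rewrite -(leq_pmul2l (ltn0Sn 1)).
apply: leq_trans (_ : \sum_a \sum_(b | e a b) (r a ^ 2 + r b ^ 2) <= _)%N.
  rewrite big_distrr; apply: leq_sum => a _ /=; rewrite big_distrr; apply: leq_sum => b _ /=.
  exact: nat_Cauchy.
under eq_bigr => a _ do rewrite big_split /=.
rewrite big_split /= [X in (_ + X)%N](exchange_big_dep xpredT) //=.
have half : (\sum_a \sum_(b | e a b) r a ^ 2 <= c * #|[set jj in setX A A | u jj.1 == u jj.2]|)%N.
  rewrite -sum_multiplicity_sqr big_distrr /=; apply: leq_sum => a _.
  rewrite sum_nat_const leq_mul2r; apply/orP; right; apply: leq_trans (ec a).
  by apply/subset_leq_card/subsetP => b; rewrite inE.
rewrite mul2n -addnn leq_add //; apply: leq_trans half.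
by apply: leq_sum => b _; rewrite (eq_bigl (e b)) // => a; rewrite e_sym.
Qed.

Section AbsF.
Variables (p : nat) (p_pr : prime p).
Implicit Types x y h : 'F_p.

(** The absolute value of the representative of least modulus. *)
Definition absF h : nat := minn h (p - h).

Lemma ltn_Fp h : (h < p)%N.
Proof. by rewrite -[X in (_ < X)%N](Fp_cast p_pr) ltn_ord. Qed.

Lemma absF_lt h : (absF h < p)%N.
Proof. by apply: leq_ltn_trans (geq_minl _ _) (ltn_Fp h). Qed.

Lemma absF_sign h : h = (absF h)%:R \/ h = - (absF h)%:R.
Proof.
rewrite /absF; have ltp := ltn_Fp h; case: leqP => _; first by left; rewrite natr_Zp.
right; rewrite natrB ?(ltnW ltp) // natr_Zp.
have -> : p%:R = 0 :> 'F_p by apply: pcharf0; apply: pchar_Fp.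
by rewrite sub0r opprK.
Qed.

Lemma absFN h : absF (- h) = absF h.
Proof.
have [->|h0] := eqVneq h 0; first by rewrite oppr0.
have hp := ltn_Fp h; have h0' : (0 < h)%N by rewrite lt0n.
have e : val (- h) = (p - h)%N.
  have -> : - h = (p - h)%:R.
    rewrite natrB ?(ltnW hp) // natr_Zp.
    have -> : p%:R = 0 :> 'F_p by apply: pcharf0; apply: pchar_Fp.
    by rewrite sub0r.
  by rewrite /= val_Fp_nat // modn_small // ltn_subrL h0' prime_gt0.
by rewrite /absF e subKn ?(ltnW hp) // minnC.
Qed.

Lemma absF_natr n : (absF n%:R <= n)%N.
Proof. by apply: leq_trans (geq_minl _ _) _; rewrite val_Fp_nat // leq_mod. Qed.

Lemma absFD x y : (absF (x + y)%R <= absF x + absF y)%N.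
Proof.
wlog xE : x y / x = (absF x)%:R.
  move=> hw; have [|xE] := absF_sign x; first exact: hw.
  have := hw (- x) (- y); rewrite absFN -opprD !absFN; apply.
  by rewrite {1}xE opprK.
have [yE|yE] := absF_sign y.
  by rewrite {1}xE {1}yE -natrD absF_natr.
rewrite {1}xE {1}yE; case: (leqP (absF y) (absF x)) => le.
  rewrite -natrB //; apply: leq_trans (absF_natr _) _; apply: leq_trans (leq_subr _ _) (leq_addr _ _).
rewrite -absFN opprB -natrB ?(ltnW le) //.
by apply: leq_trans (absF_natr _) _; apply: leq_trans (leq_subr _ _) (leq_addl _ _).
Qed.

Lemma absF_eq0 h : (absF h == 0%N) = (h == 0).
Proof.
apply/eqP/eqP => [h0|->]; last by rewrite /absF min0n.
by have [->|->] := absF_sign h; rewrite h0 ?oppr0.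
Qed.

Definition smallF H := [set h : 'F_p | absF h <= H]%N.

Lemma card_smallF H : (#|smallF H| <= 2 * H + 1)%N.
Proof.
pose f (i : 'I_H.+1 + 'I_H) : 'F_p := match i with inl k => k%:R | inr k => - (k.+1)%:R end.
apply: leq_trans (_ : #|codom f| <= _)%N; last first.
  apply: leq_trans (leq_image_card _ _) _.
  by rewrite card_sum !card_ord; lia.
apply/subset_leq_card/subsetP => h; rewrite inE => hH; apply/codomP.
have [hE|hE] := absF_sign h.
  by exists (inl (Ordinal (hH : absF h < H.+1)%N)).
case aE: (absF h) hE hH => [|k] hE hH; first by exists (inl ord0); rewrite hE oppr0.
by exists (inr (Ordinal hH)); rewrite hE.
Qed.

Section Collisions.
Variables (M H l : nat) (ms : {set 'F_p}).
Hypotheses (Mp : (M < p)%N) (Hp : (H < p)%N) (pl : (p <= 2 ^ l)%N).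
Hypothesis msM : forall m, m \in ms -> (0 < m <= M)%N.
Let J := setX ms (smallF H).

Lemma card_ms : (#|ms| <= M)%N.
Proof.
apply: leq_trans (_ : #|codom (fun i : 'I_M => (i.+1)%:R : 'F_p)| <= _)%N; last first.
  by apply: leq_trans (leq_image_card _ _) _; rewrite card_ord.
apply/subset_leq_card/subsetP => m /msM /andP[m0 mM]; apply/codomP.
have lt : (m.-1 < M)%N by rewrite prednK.
by exists (Ordinal lt); rewrite /= prednK // natr_Zp.
Qed.

Let prodN (X : 'F_p * 'F_p) : nat := (X.1 * absF X.2)%N.
Let L := (M * H)%N.
Let prodI X : 'I_L.+1 := inord (prodN X).

Let prodNL X : X \in J -> (prodN X <= L)%N.
Proof. by rewrite !inE => /andP[/msM /andP[_ mM] hH]; apply: leq_mul. Qed.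

Let prodI_val X : X \in J -> prodI X = prodN X :> nat.
Proof. by move=> XJ; rewrite inordK // ltnS prodNL. Qed.

Let prodN_sign X : X.1 * X.2 = (prodN X)%:R \/ X.1 * X.2 = - (prodN X)%:R.
Proof.
rewrite /prodN natrM natr_Zp; have [e|e] := absF_sign X.2; [left|right]; rewrite {1}e //.
by rewrite mulrN.
Qed.

Let fiber_le (c : 'F_p) : (#|[set b : 'I_L.+1 | (b%:R : 'F_p) == c]| <= L %/ p + 1)%N.
Proof.
set B := [set b : 'I_L.+1 | _]; rewrite addn1 -[X in (_ <= X)%N]card_ord.
rewrite -(card_in_imset (f := fun b : 'I_L.+1 => inord (b %/ p) : 'I_(L %/ p).+1) (D := B)).
  exact: max_card.
move=> a b; rewrite !inE => /eqP <- /eqP /(congr1 val) /=; rewrite !val_Fp_nat // => eqm.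
move/(congr1 val); rewrite /= !inordK ?ltnS ?leq_div2r -1?ltnS // => eqd.
by apply: val_inj; rewrite /= (divn_eq a p) (divn_eq b p) eqd eqm.
Qed.

(** Congruence up to a prescribed sign; since m |h| forgets the sign of h, both signs have to be
    allowed. *)
Let collide (s : bool) : rel 'I_L.+1 := fun a b => (a%:R : 'F_p) == (-1) ^+ s * b%:R.

Let collide_sym s : symmetric (collide s).
Proof.
move=> a b; rewrite /collide; apply/eqP/eqP => ->;
by rewrite mulrA -signr_addb addbb mul1r.
Qed.

Let E := [set jj in setX J J | prodI jj.1 == prodI jj.2].

Let collide_le s : (#|[set jj in setX J J | collide s (prodI jj.1) (prodI jj.2)]|
  <= (L %/ p + 1) * #|E|)%N.
Proof.
apply: related_pairs; first exact: collide_sym.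
move=> a; apply: leq_trans (fiber_le ((-1) ^+ s * a%:R)).
apply/subset_leq_card/subsetP => b; rewrite !inE /collide => /eqP ->.
by rewrite mulrA -signr_addb addbb mul1r.
Qed.

(** Equality m |h| = m' |h'| in integers. Either both h vanish, which gives at most M^2 pairs, or
    the divisor count applies with four choices of signs. *)
Let card_E : (#|E| <= M ^ 2 + 4 * ((M * l) * (H * l)))%N.
Proof.
pose N := (Zp_trunc (pdiv p)).+2; have NE : N = p by apply: Fp_cast.
pose E0 := [set jj : ('F_p * 'F_p) * ('F_p * 'F_p) | (jj.1.1 \in ms) && (jj.2.1 \in ms) &&
   (jj.1.2 == 0) && (jj.2.2 == 0)].
pose sgn (b : bool) (y : 'F_p) : 'F_p := (-1) ^+ b * y.
pose f (x : (('I_N * 'I_N) * ('I_N * 'I_N)) * (bool * bool)) : ('F_p * 'F_p) * ('F_p * 'F_p) :=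
  ((x.1.1.1, sgn x.2.1 x.1.1.2), (x.1.2.1, sgn x.2.2 x.1.2.2)).
pose E1 := f @: setX (equal_products N M H) setT.
have sgnE h : exists b, h = sgn b (absF h)%:R.
  have [e|e] := absF_sign h; [exists false | exists true]; rewrite /sgn ?mul1r //.
  by rewrite expr1 mulN1r.
apply: leq_trans (_ : #|E0 :|: E1| <= _)%N.
  apply/subset_leq_card/subsetP => -[[m h] [m' h']]; rewrite inE => /andP[JJ /eqP eqP0].
  have [XJ YJ] : (m, h) \in J /\ (m', h') \in J by move: JJ; rewrite in_setX => /andP[].
  have eqN : prodN (m, h) = prodN (m', h').
    by rewrite -!prodI_val //; move: eqP0 => /= ->.
  move: XJ YJ; rewrite !in_setX /= => /andP[mm hh] /andP[mm' hh'].
  rewrite /smallF inE in hh; rewrite /smallF inE in hh'.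
  have /andP[m0 mM] := msM mm; have /andP[m'0 m'M] := msM mm'.
  rewrite /prodN /= in eqN; rewrite in_setU; apply/orP.
  case: (posnP (absF h)) => h0.
    left; rewrite inE /= mm mm' /= -(absF_eq0 h) h0 eqxx /= -absF_eq0.
    by move: eqN; rewrite h0 muln0 => /esym/eqP; rewrite muln_eq0 eqn0Ngt m'0.
  have h'0 : (0 < absF h')%N.
    rewrite lt0n; apply: contraTneq h0 => h'0; move: eqN; rewrite h'0 muln0 => /eqP.
    by rewrite muln_eq0 (eqn0Ngt m) m0 /= => /eqP ->.
  right; have [b hE] := sgnE h; have [b' h'E] := sgnE h'.
  have valy z : val ((absF z)%:R : 'F_p) = absF z.
    by rewrite /= val_Fp_nat // modn_small // absF_lt.
  apply/imsetP; exists (((m, (absF h)%:R), (m', (absF h')%:R)), (b, b')); last first.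
    by rewrite /f /= -hE -h'E.
  rewrite in_setX in_setT andbT inE /= m0 mM m'0 m'M.
  have vh := valy h; have vh' := valy h'; rewrite /= in vh vh'.
  by rewrite vh vh' h0 h'0 hh hh' eqN eqxx.
apply: leq_trans (leq_card_setU _ _) _; apply: leq_add.
  pose g (mm : 'F_p * 'F_p) : ('F_p * 'F_p) * ('F_p * 'F_p) := ((mm.1, 0), (mm.2, 0)).
  apply: leq_trans (_ : #|g @: setX ms ms| <= _)%N.
    apply/subset_leq_card/subsetP => -[[m h] [m' h']]; rewrite inE /=.
    case/andP=> /andP[/andP[mm mm'] /eqP ->] /eqP ->.
    by apply/imsetP; exists (m, m'); rewrite ?in_setX ?mm.
  by apply: leq_trans (leq_imset_card _ _) _; rewrite cardsX -mulnn leq_mul ?card_ms.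
apply: leq_trans (leq_imset_card _ _) _; rewrite cardsX cardsT card_prod card_bool mulnC.
rewrite leq_mul2l /=; apply: card_equal_products; by rewrite ?NE.
Qed.

(** Cross-multiplying, m' h = m h', so exchanging m and m' turns equal ratios into congruent
    products. Those are at most M H, so each residue class holds at most MH/p + 1 of them, and
    [related_pairs] passes from congruence to equality for each of the two signs. *)
Lemma card_collisions : (#|[set jj in setX J J | (jj.1.2 / jj.1.1 == jj.2.2 / jj.2.1)%R]| <=
  2 * ((M * H) %/ p + 1) * (M ^ 2 + 4 * ((M * l) * (H * l))))%N.
Proof.
pose sw (jj : ('F_p * 'F_p) * ('F_p * 'F_p)) := ((jj.2.1, jj.1.2), (jj.1.1, jj.2.2)).
have sw_inj : injective sw by move=> [[? ?] [? ?]] [[? ?] [? ?]] [-> -> -> ->].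
rewrite -(card_imset _ sw_inj).
pose P s := [set jj in setX J J | collide s (prodI jj.1) (prodI jj.2)].
apply: leq_trans (_ : #|P false :|: P true| <= _)%N; last first.
  apply: leq_trans (leq_card_setU _ _) _.
  have ES := leq_mul (leqnn (L %/ p + 1)) card_E.
  by rewrite mul2n -addnn mulnDl leq_add // (leq_trans (collide_le _)).
apply/subset_leq_card/subsetP => _ /imsetP[[[m h] [m' h']] jj ->].
move: jj; rewrite inE in_setX /= => /andP[/andP[XJ YJ] /eqP e].
have [XJ' YJ'] : (m', h) \in J /\ (m, h') \in J.
  by move: XJ YJ; rewrite !in_setX => /andP[-> ->] /andP[-> ->].
have nz z : (z \in ms) -> z != 0.
  by move/msM/andP=> [z0 _]; apply: contraTneq z0 => ->.
have m0 : m != 0 by apply: nz; move: XJ; rewrite in_setX => /andP[].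
have m'0 : m' != 0 by apply: nz; move: YJ; rewrite in_setX => /andP[].
have e' : m' * h = m * h' by rewrite -[h](divfK m0) e mulrA [m' * _]mulrC divfK // mulrC.
have swJ : sw ((m, h), (m', h')) \in setX J J by rewrite in_setX /sw /= XJ' YJ'.
rewrite in_setU /P.
suff : collide false (prodI (m', h)) (prodI (m, h')) || collide true (prodI (m', h)) (prodI (m, h')).
  by case/orP => cs; apply/orP; [left|right]; rewrite inE swJ.
rewrite /collide !prodI_val // expr0 expr1 mul1r mulN1r.
have : ((prodN (m', h))%:R == (prodN (m, h'))%:R :> 'F_p) ||
       ((prodN (m', h))%:R == - (prodN (m, h'))%:R :> 'F_p).
  have [e1|e1] := prodN_sign (m', h); have [e2|e2] := prodN_sign (m, h'); rewrite /= in e1 e2.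
  - by rewrite -e1 -e2 e' eqxx.
  - by rewrite -e1 e' e2 eqxx orbT.
  - by rewrite -e2 -e' e1 opprK eqxx orbT.
  - by rewrite -[_%:R]opprK -e1 e' e2 opprK eqxx.
by [].
Qed.

End Collisions.
End AbsF.

(** * Gauss sums and Fourier inversion *)

Lemma complete_square (F : fieldType) (v a b lam y : F) :
  (2 : F) != 0 -> v != 0 -> a != 0 ->
  lam * (y - lam * a / (2 * v)) + v / a * ((y - lam * a / (2 * v)) ^+ 2 - b) =
  v / a * y ^+ 2 + (- (lam ^+ 2 * a / 4) / v + (- (b / a)) * v).
Proof.
move=> two v0 a0; have four : (4 : F) != 0 by rewrite (natrM _ 2 2) mulf_neq0.
by field; rewrite two v0 a0 four.
Qed.

Lemma fourier_phase (F : fieldType) (a b m n h x t : F) : a != 0 -> m != 0 ->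
  - (h * n) + (t + h / m / a * (x ^+ 2 - b)) = t + h * ((x ^+ 2 - (a * m * n + b)) / (a * m)).
Proof. by move=> a0 m0; field; rewrite a0 m0. Qed.

Section Gauss.
Variables (p : nat) (p_pr : prime p) (p_odd : odd p) (C : numClosedFieldType).
Variable psi : 'F_p -> C.
Hypotheses (psiD : forall x y, psi (x + y) = psi x * psi y)
  (psi_norm : forall x, `|psi x| = 1) (psi_nontriv : psi 1 != 1).
Notation chi := (@chi p C).
Let psi0' := psi0 psiD psi_norm.

Lemma Fp_two_neq0 : (2 : 'F_p) != 0.
Proof.
rewrite -(dvdn_pcharf (pchar_Fp p_pr)) gtnNdvd //.
by case: p p_pr p_odd => [|[|[|]]].
Qed.

(** The nonzero squares already supply (p-1)/2 roots of X^((p-1)/2) - 1; a nonsquare root would be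
    one too many. *)
Lemma euler_square (y : 'F_p) : y != 0 -> y ^+ p.-1./2 = 1 -> exists t, t ^+ 2 = y.
Proof.
move=> y0 yh; pose Sq := [set x ^+ 2 | x : 'F_p & x != 0].
have [/imsetP[t _ ->]|ySq] := boolP (y \in Sq); first by exists t.
have hE : (p.-1 = p.-1./2 * 2)%N by rewrite muln2 halfK; move: p_odd; case: (p) => // n /= /negbTE ->; rewrite subn0.
have h0 : (0 < p.-1./2)%N by move: (prime_gt1 p_pr) p_odd; case: (p) => [|[|[|]]].
have pow1 (x : 'F_p) : x != 0 -> x ^+ p.-1 = 1.
  by move=> x0; apply: (mulfI x0); rewrite mulr1 -exprS prednK ?prime_gt0 // Fp_expp.
have fib : (#|[set x : 'F_p | x != 0%R]| <= \sum_(z in Sq) 2)%N.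
  rewrite -sum1_card (partition_big (fun x : 'F_p => (x ^+ 2)%R) (mem Sq)) /=; last first.
    by move=> x; rewrite inE => x0; apply: imset_f; rewrite inE.
  apply: leq_sum => z /imsetP[t _ ->]; rewrite sum1_card.
  apply: leq_trans (_ : #|[set t; - t]| <= 2)%N; last by rewrite cards2; case: (_ != _).
  by apply/subset_leq_card/subsetP => x; rewrite !inE unfold_in => /andP[_]; rewrite eqf_sqr.
have cardF : #|[set x : 'F_p | x != 0]| = p.-1.
  have := cardsC1 (0 : 'F_p); rewrite card_Fp // => <-.
  by apply: eq_card => x; rewrite !inE.
rewrite cardF sum_nat_const {1}hE leq_pmul2r // in fib.
have := @max_poly_roots _ ('X^(p.-1./2) - 1) (y :: enum Sq).
rewrite -size_poly_eq0 size_XnsubC // => /(_ isT); rewrite /= mem_enum ySq enum_uniq.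
have -> : root ('X^(p.-1./2) - 1) y by rewrite rootE !hornerE yh subrr.
have -> : all (root ('X^(p.-1./2) - 1)) (enum Sq).
  apply/allP => z; rewrite mem_enum => /imsetP[t t0 ->].
  by rewrite rootE !hornerE -exprM mulnC -hE pow1 ?subrr //; move: t0; rewrite inE.
by move=> /(_ isT isT); rewrite -cardE !ltnS ltnNge fib.
Qed.

Lemma card_sqrt (y : 'F_p) : #|[set x | x ^+ 2 == y]|%:R = 1 + chi y :> C.
Proof.
have [->|y0] := eqVneq y 0.
  rewrite chi0 addr0; suff -> : [set x : 'F_p | x ^+ 2 == 0] = [set 0] by rewrite cards1.
  by apply/setP => x; rewrite !inE sqrf_eq0.
case: (boolP (y ^+ p.-1./2 == 1)) => yh.
  have [t tE] := euler_square y0 (eqP yh).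
  have -> : [set x | x ^+ 2 == y] = [set t; - t].
    by apply/setP => x; rewrite !inE -tE eqf_sqr.
  have t0 : t != 0 by apply: contraNneq y0 => t0; rewrite -tE t0 expr0n.
  rewrite cards2 (_ : t != - t); last first.
    by rewrite -subr_eq0 opprK -mulr2n -mulr_natl mulf_neq0 ?Fp_two_neq0.
  by rewrite /CharacterSums.chi (negPf y0) yh.
rewrite (_ : [set x | _] = set0).
  by rewrite cards0 /CharacterSums.chi (negPf y0) (negPf yh) subrr.
apply/setP => x; rewrite !inE; apply/negP => /eqP xy; case/negP: yh.
have x0 : x != 0 by apply: contraNneq y0 => x0; rewrite -xy x0 expr0n.
rewrite -xy -exprM mulnC muln2 halfK.
have -> : odd p.-1 = false by move: p_odd; case: (p) => // n /= /negbTE.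
rewrite subn0; apply/eqP; apply: (mulfI x0); rewrite mulr1 -exprS prednK ?prime_gt0 //.
exact: Fp_expp.
Qed.

Definition gauss_sum : C := \sum_y chi y * psi y.

Lemma quadratic_sum (w : 'F_p) : w != 0 -> \sum_x psi (w * x ^+ 2) = chi w * gauss_sum.
Proof.
move=> w0; rewrite (partition_big (fun x : 'F_p => x ^+ 2) xpredT) //=.
transitivity (\sum_y (1 + chi y) * psi (w * y)).
  apply: eq_bigr => y _; rewrite -card_sqrt (eq_bigr (fun=> psi (w * y))).
    by rewrite sumr_const mulr_natl; congr (_ *+ _); apply: eq_card => x; rewrite !inE.
  by move=> x /eqP ->.
under eq_bigr => y _ do rewrite mulrDl mul1r.
rewrite big_split /= (eq_bigr (fun y => psi (y * w))) => [|y _]; last by rewrite mulrC.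
rewrite (sum_psi psiD psi_nontriv w0) add0r.
rewrite (reindex_inj (mulfI (invr_neq0 w0))) /gauss_sum mulr_sumr; apply: eq_bigr => y _ /=.
rewrite mulVKf // mulrA chiM //; congr (_ * _ * _).
have chiw : chi w != 0 by rewrite -sqrf_eq0 chi_sqr // oner_eq0.
by apply: (mulfI chiw); rewrite -chiM // divff // chi1 -expr2 chi_sqr.
Qed.

Lemma norm_gauss_sum : `|gauss_sum| ^+ 2 = p%:R.
Proof.
have -> : gauss_sum = \sum_x psi (x ^+ 2).
  by rewrite -[LHS]mul1r -(chi1 p C) -(quadratic_sum (oner_neq0 _)); apply: eq_bigr => x _; rewrite mul1r.
rewrite normCK rmorph_sum mulr_sumr.
transitivity (\sum_y \sum_z psi (z ^+ 2) * psi (y * (2 * z))).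
  apply: eq_bigr => y _; rewrite mulr_suml (reindex_inj (addrI y)) /=.
  apply: eq_bigr => z _; rewrite -psiN // -!psiD; congr psi; ring.
rewrite exchange_big /= (bigD1 0) //= [X in _ + X]big1 ?addr0.
  under eq_bigr => y _ do rewrite !mulr0 expr0n psi0' mul1r.
  by rewrite sumr_const card_Fp.
move=> z z0; rewrite -mulr_sumr.
by rewrite (sum_psi psiD psi_nontriv) ?mulr0 // mulf_neq0 ?Fp_two_neq0.
Qed.

Variables (a b lam : 'F_p).
Hypotheses (a0 : a != 0) (lam0 : lam != 0).

Definition Gam (v : 'F_p) : C := \sum_x psi (lam * x + v / a * (x ^+ 2 - b)).

Definition kapA : 'F_p := - (lam ^+ 2 * a / 4).
Definition kapB : 'F_p := - (b / a).

Lemma kapA_neq0 : kapA != 0.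
Proof.
rewrite oppr_eq0 !mulf_neq0 ?expf_neq0 ?invr_eq0 //.
by rewrite (natrM _ 2 2) mulf_neq0 ?Fp_two_neq0.
Qed.

(** Completing the square for v nonzero. At v = 0 both sides vanish, the left one because lam is
    nonzero and the right one because chi 0 = 0. *)
Lemma GamE v : Gam v = chi a * gauss_sum * kap psi kapA kapB v.
Proof.
have [->|v0] := eqVneq v 0.
  rewrite /kap chi0 mul0r mulr0 /Gam.
  under eq_bigr => x _ do rewrite !mul0r addr0 mulrC.
  exact: (sum_psi psiD psi_nontriv lam0).
rewrite /Gam (reindex_inj (addIr (- (lam * a / (2 * v))))) /=.
under eq_bigr => y _ do rewrite complete_square ?Fp_two_neq0 // psiD.
rewrite -mulr_suml quadratic_sum; last by rewrite mulf_neq0 ?invr_eq0.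
rewrite /kap -/kapA -/kapB mulrACA [RHS]mulrC -!mulrA [RHS]mulrC.
have chiV : chi a^-1 = chi a.
  have chia : chi a != 0 by rewrite -sqrf_eq0 chi_sqr // oner_eq0.
  by apply: (mulfI chia); rewrite -chiM // divff // chi1 -expr2 chi_sqr.
rewrite chiM // chiV; ring.
Qed.

Lemma norm_Gam_coef : `|chi a * gauss_sum| = sqrtC p%:R.
Proof.
have chia : `|chi a| = 1.
  by apply/eqP; rewrite -(@eqrXn2 _ 2) // ?ler01 // expr1n -normrX chi_sqr // normr1.
rewrite normrM chia mul1r; apply/eqP.
by rewrite -(@eqrXn2 _ 2) // ?sqrtC_ge0 ?ler0n // sqrtCK norm_gauss_sum.
Qed.

Lemma norm_Gam_sum j u :
  `|\sum_(k < j) Gam (u + k%:R)| = sqrtC p%:R * `|\sum_(k < j) kap psi kapA kapB (u + k%:R)|.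
Proof.
under eq_bigr => k _ do rewrite GamE.
by rewrite -mulr_sumr normrM norm_Gam_coef.
Qed.

Lemma norm_Gam_le v : `|Gam v| <= sqrtC p%:R.
Proof.
by rewrite GamE normrM norm_Gam_coef ler_piMr ?sqrtC_ge0 ?ler0n // norm_kap.
Qed.

Definition root_sum (y : 'F_p) : C := \sum_(x | x ^+ 2 == y) psi (lam * x).

Definition dual_weight (L : nat) (phi : nat -> C) (h : 'F_p) : C :=
  \sum_(n < L) phi n * psi (- (h * n%:R)).

Lemma root_sum_fourier (m n : 'F_p) : m != 0 ->
  p%:R * root_sum (a * m * n + b) = \sum_h psi (- (h * n)) * Gam (h / m).
Proof.
move=> m0; have summand h : psi (- (h * n)) * Gam (h / m) =
    \sum_x psi (lam * x) * psi (h * ((x ^+ 2 - (a * m * n + b)) / (a * m))).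
  rewrite /Gam mulr_sumr; apply: eq_bigr => x _; rewrite -!psiD; congr psi.
  exact: fourier_phase.
under [RHS]eq_bigr => h _ do rewrite summand.
rewrite exchange_big /root_sum /= mulr_sumr [LHS]big_mkcond /=; apply: eq_bigr => x _.
rewrite -mulr_sumr; case: ifP => [/eqP ->|nx].
  under eq_bigr => h _ do rewrite subrr mul0r mulr0 psi0'.
  by rewrite sumr_const card_Fp // mulrC.
by rewrite (sum_psi psiD psi_nontriv) ?mulr0 // !mulf_neq0 ?invr_eq0 ?mulf_neq0 // subr_eq0 nx.
Qed.

Lemma weighted_root_sum_fourier L (phi : nat -> C) (m : 'F_p) : m != 0 ->
  p%:R * \sum_(n < L) phi n * root_sum (a * m * n%:R + b) =
  \sum_h dual_weight L phi h * Gam (h / m).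
Proof.
move=> m0; rewrite mulr_sumr.
under eq_bigr => n _ do rewrite mulrCA root_sum_fourier // mulr_sumr.
rewrite exchange_big; apply: eq_bigr => h _ /=; rewrite /dual_weight mulr_suml.
by apply: eq_bigr => n _; rewrite mulrA.
Qed.

(** The complete sum over h is invariant under h -> h + m k; dividing by m makes the shift of the
    argument of [Gam] independent of m. *)
Lemma shift_average (w : 'F_p -> C) (m : 'F_p) K : m != 0 ->
  K%:R * \sum_h w h * Gam (h / m) =
  \sum_h \sum_(k < K) w (h + m * k%:R) * Gam (h / m + k%:R).
Proof.
move=> m0; rewrite exchange_big /= mulr_natl -{1}(card_ord K) -sumr_const.
apply: eq_bigr => k _; rewrite (reindex_inj (addIr (m * k%:R))) /=.
by apply: eq_bigr => h _; rewrite mulrDl mulrAC divff // mul1r.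
Qed.

End Gauss.

Lemma abel_summation_bound (C : numClosedFieldType) (K : nat) (w g : nat -> C) (W V : C) :
  (forall k, (k <= K)%N -> `|w k| <= W) ->
  (forall k, (k < K)%N -> `|w k.+1 - w k| <= V) ->
  `|\sum_(k < K) w k * g k| <=
    W * `|\sum_(k < K) g k| + V * \sum_(j < K) `|\sum_(k < j.+1) g k|.
Proof.
move=> wW wV; pose G j := \sum_(k < j) g k.
have -> : \sum_(k < K) w k * g k = w K * G K - \sum_(j < K) (w j.+1 - w j) * G j.+1.
  elim: K {wW wV} => [|K IHK]; first by rewrite /G !big_ord0 mulr0 subrr.
  rewrite !big_ord_recr /= IHK /G !big_ord_recr /=; ring.
apply: le_trans (ler_normB _ _) _; rewrite normrM; apply: lerD.
  by rewrite ler_wpM2r // wW.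
apply: le_trans (ler_norm_sum _ _ _) _; rewrite mulr_sumr; apply: ler_sum => j _.
by rewrite normrM ler_wpM2r // wV.
Qed.

(* Complex norms and the bilinear estimate *)
From mathcomp Require Import complex.
Local Open Scope complex_scope.

Section ComplexNorm.
Variable R : rcfType.
Implicit Types z : R[i].

(** The norm on [R[i]] takes values in [R[i]]; this is the same number as an element of R. *)
Definition nrm z : R := Num.sqrt (complex.Re z ^+ 2 + complex.Im z ^+ 2).

Lemma nrmE z : `|z| = (nrm z)%:C. Proof. exact: normc_def. Qed.

Lemma nrm_ge0 z : 0 <= nrm z. Proof. exact: sqrtr_ge0. Qed.

Lemma le_norm_nrm z (x : R) : (`|z| <= x%:C) = (nrm z <= x).
Proof. by rewrite nrmE lecR. Qed.

Lemma sum_norm_nrm (I : Type) (r : seq I) (P : pred I) (f : I -> R[i]) :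
  \sum_(i <- r | P i) `|f i| = (\sum_(i <- r | P i) nrm (f i))%:C.
Proof. by rewrite rmorph_sum; apply: eq_bigr => i _; rewrite nrmE. Qed.

Lemma natrC n : (n%:R : R)%:C = n%:R.
Proof. exact: (rmorph_nat (real_complex R)). Qed.

Lemma sqrtC_natr n : sqrtC n%:R = (Num.sqrt n%:R)%:C :> R[i].
Proof.
apply/eqP; rewrite -(@eqrXn2 _ 2) ?sqrtC_ge0 ?ler0n //; last by rewrite lecR sqrtr_ge0.
by rewrite sqrtCK -rmorphXn /= sqr_sqrtr ?ler0n // natrC.
Qed.

Lemma complex_archi (R_archi : forall x : R, exists n : nat, x <= n%:R) (z : R[i]) :
  exists n : nat, `|z| <= n%:R.
Proof.
have [n zn] := R_archi (nrm z); exists n.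
by rewrite nrmE -natrC lecR.
Qed.

End ComplexNorm.

Section Core.
Variables (p : nat) (p_pr : prime p) (p_odd : odd p) (R : rcfType).
Hypothesis R_archi : forall x : R, exists n : nat, x <= n%:R.
Let C : numClosedFieldType := R[i].
Variable psi : 'F_p -> C.
Hypotheses (psiD : forall x y, psi (x + y) = psi x * psi y)
  (psi_norm : forall x, `|psi x| = 1) (psi_nontriv : psi 1 != 1).
Variables (a b lam : 'F_p).
Hypotheses (a0 : a != 0) (lam0 : lam != 0).
Variables (ms : {set 'F_p}) (M H H1 K r : nat).
Hypotheses (Kp : (K <= p)%N) (rp : (r.+1 < p)%N).
Hypothesis msM : forall m, m \in ms -> (0 < m <= M)%N.
Hypothesis HKM : (H1 + K * M <= H)%N.

Let J := setX ms (smallF p H).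
Let ratio (mh : 'F_p * 'F_p) : 'F_p := mh.2 / mh.1.
Let partial j (u : 'F_p) : R := nrm (\sum_(k < j) kap psi (kapA a lam) (kapB a b) (u + k%:R)).

Definition moment_value : R := (r.+1 ^ r.+1 * K ^ r.+1 * p)%:R +
  (K ^ (2 * r.+1) * (4 * r.+1))%:R * Num.sqrt p%:R.

Definition core_bound : R := #|J|%:R ^+ (2 * r) *
  #|[set jj in setX J J | jj.1.2 / jj.1.1 == jj.2.2 / jj.2.1]|%:R * moment_value.

Lemma partial_moment j : (j <= K)%N -> \sum_v partial j v ^+ (2 * r.+1) <= moment_value.
Proof.
move=> jK; rewrite -lecR rmorph_sum /=.
have -> : \sum_v (partial j v ^+ (2 * r.+1))%:C =
    \sum_v `|\sum_(k < j) kap psi (kapA a lam) (kapB a b) (v + k%:R)| ^+ (2 * r.+1).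
  by apply: eq_bigr => v _; rewrite rmorphXn /= nrmE.
have jp := leq_trans jK Kp.
apply: le_trans (moment_bound p_pr p_odd (complex_archi R_archi) psiD psi_norm psi_nontriv
  (kapB a b) (kapA_neq0 p_pr p_odd a0 lam0) jp rp) _.
rewrite /moment_value rmorphD /= natrC [X in _ <= _ + X]rmorphM /= natrC sqrtC_natr; apply: lerD.
  by rewrite ler_nat leq_mul2r leq_mul2l leq_exp2r // jK !orbT.
rewrite ler_wpM2r ?lecR ?sqrtr_ge0 // ler_nat leq_mul2r leq_exp2r ?jK ?orbT //.
Qed.

Lemma partial_sum_bound j : (j <= K)%N ->
  (\sum_(mh in J) partial j (ratio mh)) ^+ (2 * r.+1) <= core_bound.
Proof.
move=> jK; apply: le_trans (@collision_holder R _ _ J ratio (partial j) r (fun v => nrm_ge0 _)) _.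
by rewrite ler_wpM2l ?partial_moment // mulr_ge0 ?exprn_ge0.
Qed.

Lemma core_bound_ge0 : 0 <= core_bound.
Proof. by apply: le_trans (partial_sum_bound (leq0n _)); rewrite exprn_ge0 // sumr_ge0 // => *; apply: nrm_ge0. Qed.

(** After averaging over k, residues h within H are treated by Abel summation and the moment, the
    others by the decay of the weight. X is a Hoelder bound common to all lengths of the inner
    sum. *)
Lemma bilinear_core (w : 'F_p -> 'F_p -> C) (W V delta : R) :
  (forall m x, m \in ms -> nrm (w m x) <= W) ->
  (forall m x, m \in ms -> nrm (w m (x + m) - w m x) <= V) ->
  0 <= W -> 0 <= V -> 0 <= delta -> (forall m x, m \in ms -> (H1 < absF x)%N -> nrm (w m x) <= delta) ->
  exists X : R, [/\ 0 <= X, X ^+ (2 * r.+1) <= core_bound &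
    K%:R * \sum_(m in ms) nrm (\sum_h w m h * Gam psi a b lam (h / m)) <=
    Num.sqrt p%:R * ((W + K%:R * V) * X + #|ms|%:R * p%:R * K%:R * delta)].
Proof.
move=> wW wV W0 V0 d0 wd.
(* Abel summation meets partial sums of every length j <= K; their maximum satisfies the same moment
   bound. *)
pose X := \big[Num.max/0]_(j < K.+1) \sum_(mh in J) partial j (ratio mh).
have X0 : 0 <= X by apply: bigmax_ge_id.
have Xb : X ^+ (2 * r.+1) <= core_bound.
  apply: (big_ind (fun x => x ^+ (2 * r.+1) <= core_bound)).
  - by rewrite expr0n core_bound_ge0.
  - by move=> x y xB yB; case: (leP x y).
  - by move=> j _; apply: partial_sum_bound; rewrite -ltnS.
have Xge j : (j <= K)%N -> \sum_(mh in J) partial j (ratio mh) <= X.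
  by move=> jK; apply: (@le_bigmax_cond _ _ _ 0 (Ordinal (jK : j < K.+1)%N) xpredT (fun j : 'I_K.+1 => \sum_(mh in J) partial j (ratio mh))).
exists X; split=> //; have sp0 : 0 <= sqrtC p%:R :> C by rewrite sqrtC_ge0 ler0n.
have mne0 m : m \in ms -> m != 0.
  by move/msM/andP=> [m0 _]; apply: contraTneq m0 => ->.
pose g m h := \sum_(k < K) w m (h + m * k%:R) * Gam psi a b lam (h / m + k%:R).
have near m h : m \in ms -> `|g m h| <= sqrtC p%:R *
    (W * partial K (h / m) + V * \sum_(j < K) partial j.+1 (h / m))%:C.
  move=> mm; apply: le_trans (@abel_summation_bound C K (fun k => w m (h + m * k%:R))
    (fun k => Gam psi a b lam (h / m + k%:R)) W%:C V%:C _ _) _.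
  - by move=> k _; rewrite le_norm_nrm wW.
  - by move=> k _; rewrite le_norm_nrm -natr1 mulrDr mulr1 addrA wV.
  rewrite /= norm_Gam_sum //; under eq_bigr => j _ do rewrite norm_Gam_sum //.
  rewrite -mulr_sumr nrmE sum_norm_nrm rmorphD !rmorphM /= /partial.
  by rewrite mulrCA [X in _ + X]mulrCA mulrDr.
(* If |h| > H >= H1 + K M, then |h + m k| > H1 for every k < K, so all shifted weights are small. *)
have far m h : m \in ms -> h \notin smallF p H -> `|g m h| <= sqrtC p%:R * (K%:R * delta)%:C.
  move=> mm; rewrite inE -ltnNge => hH; apply: le_trans (ler_norm_sum _ _ _) _.
  rewrite rmorphM /= natrC mulrCA mulr_natl.
  have -> : (sqrtC p%:R * delta%:C) *+ K = \sum_(k < K) sqrtC p%:R * delta%:C :> C.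
    by rewrite sumr_const card_ord.
  apply: ler_sum => k _; rewrite normrM mulrC; apply: ler_pM => //.
    exact: norm_Gam_le.
  rewrite le_norm_nrm wd //; have := absFD p_pr (h + m * k%:R) (- (m * k%:R)).
  rewrite addrK absFN //; have := absF_natr p_pr (m * k)%N; rewrite natrM natr_Zp => h1 h2.
  have /andP[_ mM] := msM mm; have h3 : (m * k <= K * M)%N by rewrite mulnC leq_mul // ltnW.
  rewrite -(ltn_add2r (absF (m * k%:R)%R)); apply: leq_trans (leq_trans hH h2).
  by rewrite ltnS (leq_trans _ HKM) // leq_add2l (leq_trans h1).
have per_m m : m \in ms -> K%:R * `|\sum_h w m h * Gam psi a b lam (h / m)| <=
    sqrtC p%:R * (\sum_(h in smallF p H) (W * partial K (h / m) + V * \sum_(j < K) partial j.+1 (h / m))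
      + p%:R * (K%:R * delta))%:C.
  move=> mm; rewrite -[X in X * _]normr_nat -normrM shift_average ?mne0 //.
  apply: le_trans (ler_norm_sum _ _ _) _.
  rewrite (bigID (mem (smallF p H))) /= rmorphD mulrDr; apply: lerD.
    rewrite rmorph_sum mulr_sumr; apply: ler_sum => h _; exact: near.
  apply: le_trans (ler_sum _ (fun h hH => far m h mm hH)) _.
  have kd0 : 0 <= K%:R * delta by rewrite mulr_ge0.
  rewrite sumr_const -[X in X <= _]mulr_natl mulrCA ler_wpM2l //.
  rewrite -natrC -rmorphM /= lecR ler_wpM2r // ler_nat -[X in (_ <= X)%N](card_Fp p_pr).
  exact: max_card.
have sumJ j : \sum_(m in ms) \sum_(h in smallF p H) partial j (h / m) =
    \sum_(mh in J) partial j (ratio mh).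
  rewrite pair_big /=; apply: eq_bigl => -[m h]; by rewrite in_setX.
rewrite -lecR !rmorphM /= natrC -sum_norm_nrm -sqrtC_natr mulr_sumr.
apply: le_trans (ler_sum _ per_m) _; rewrite -mulr_sumr ler_wpM2l //.
rewrite -rmorph_sum /= lecR big_split /=; apply: lerD; last first.
  by rewrite sumr_const -[X in X <= _]mulr_natl !mulrA.
have -> : \sum_(m in ms) \sum_(h in smallF p H) (W * partial K (h / m) +
      V * \sum_(j < K) partial j.+1 (h / m)) =
    W * (\sum_(mh in J) partial K (ratio mh)) +
    V * \sum_(j < K) \sum_(mh in J) partial j.+1 (ratio mh).
  under eq_bigr => m _ do rewrite big_split /= -!mulr_sumr.
  rewrite big_split /= -!mulr_sumr sumJ; congr (_ + _ * _).
  under [LHS]eq_bigr => m _ do rewrite exchange_big /=.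
  by rewrite [LHS]exchange_big; apply: eq_bigr => j _; rewrite /= sumJ.
rewrite mulrDl; apply: lerD; first by rewrite ler_wpM2l ?Xge.
rewrite mulrAC [X in _ <= X]mulrC ler_wpM2l //.
apply: le_trans (ler_sum _ (fun j _ => Xge _ (ltn_ord j))) _.
by rewrite sumr_const card_ord mulr_natl.
Qed.

End Core.

(* The additive character and the dual weights over the real numbers *)
From mathcomp Require Import reals Rstruct.
(* MathComp claims the delimiters %R and %Z for ring_scope and int_scope. *)
Delimit Scope R_scope with RS.
Delimit Scope Z_scope with ZZ.
Notation R := (Real.sort (Rdefinitions.R : realType)).

Lemma R_archi (x : R) : exists n : nat, x <= n%:R.
Proof.
have [n xn] := Rarchimedean_axiom x; exists n.
exact: le_trans (ler_norm x) (ltW xn).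
Qed.

Definition circ (t : R) : R := 2 * PI * t.

Definition eR (t : R) : R[i] := cos (circ t) +i* sin (circ t).

Lemma eRD s t : eR (s + t) = eR s * eR t.
Proof.
rewrite /eR /circ mulrDr cosD sinD; apply/eqP; rewrite eq_complex /=; apply/andP.
by split; apply/eqP; ring.
Qed.

Lemma eR0 : eR 0 = 1.
Proof. by rewrite /eR /circ mulr0 cos_0 sin_0. Qed.

Lemma eR_nat n : eR n%:R = 1.
Proof.
elim: n => [|n IHn]; first exact: eR0.
rewrite -natr1 eRD IHn mul1r /eR /circ mulr1.
have -> : (2 * PI : R) = Rmult (IZR 2) PI by [].
by rewrite cos_2PI sin_2PI.
Qed.

Lemma norm_eR t : `|eR t| = 1.
Proof.
rewrite nrmE /nrm /eR /=.
have -> : cos (circ t) ^+ 2 + sin (circ t) ^+ 2 = 1.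
  by rewrite addrC !expr2; apply: sin2_cos2.
by rewrite sqrtr1.
Qed.

Lemma INR_IZR2 : INR 2 = IZR 2. Proof. exact: INR_IZR_INZ. Qed.
Lemma INR_IZR3 : INR 3 = IZR 3. Proof. exact: INR_IZR_INZ. Qed.

Definition half_circ (t : R) : R := PI * t.

Lemma nrm_one_sub_eR t : nrm (1 - eR t) = 2 * `|sin (half_circ t)|.
Proof.
apply/eqP; rewrite -(@eqrXn2 _ 2) ?nrm_ge0 ?mulr_ge0 //.
rewrite /nrm sqr_sqrtr ?addr_ge0 ?sqr_ge0 // exprMn real_normK ?num_real //= /eR /=.
have e1 : sin (circ t) ^+ 2 = 1 - cos (circ t) ^+ 2.
  have := sin2_cos2 (circ t); rewrite /Rsqr !RealsE -!expr2 => <-.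
  by rewrite addrK.
have e2 : 1 - cos (circ t) = 2 * sin (half_circ t) ^+ 2.
  have := one_minus_cos (half_circ t); rewrite RpowE /circ -mulrA.
  exact.
rewrite sub0r sqrrN e1.
have -> : (1 - cos (circ t)) ^+ 2 + (1 - cos (circ t) ^+ 2) = 2 * (1 - cos (circ t)).
  by ring.
by rewrite e2; apply/eqP; ring.
Qed.

Lemma nrm_one_sub_eR_le t : nrm (1 - eR t) <= 8 * `|t|.
Proof.
rewrite nrm_one_sub_eR -[8]/(2 * 4)%:R natrM -mulrA ler_wpM2l //.
have /RleP := sin_abs_le (half_circ t); rewrite !RabsE => h; apply: le_trans h _.
rewrite /half_circ normrM ler_wpM2r // ger0_norm; last by apply/RleP/Rlt_le/PI_RGT_0.
by apply/RleP; rewrite -INRE INR_IZR_INZ; exact: PI_4.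
Qed.

Lemma nrm_one_sub_eR_ge t : 0 <= t -> 2 * t <= 1 -> 2 * t <= nrm (1 - eR t).
Proof.
move=> t0 t1; rewrite nrm_one_sub_eR ler_pM2l //.
have PI3 : 3 <= PI :> R.
  by apply/RleP; rewrite -INRE INR_IZR_INZ; apply: PI_ge3.
have h0 : 0 <= half_circ t by rewrite mulr_ge0 // (le_trans _ PI3).
have h1 : half_circ t <= PI / 2.
  by rewrite /half_circ ler_pM2l ?(lt_le_trans _ PI3) // -[2^-1]mul1r ler_pdivlMr // mulrC.
apply: le_trans (ler_norm _); apply: le_trans (_ : half_circ t / 3 <= _).
  by rewrite ler_pdivlMr // mulrC ler_wpM2r.
apply/RleP; have := @sin_ge_third (half_circ t); rewrite RdivE -INR_IZR3 INRE; apply.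
by split; apply/RleP => //; rewrite RdivE -INR_IZR2 INRE.
Qed.

Lemma eRN t : eR (- t) = (eR t)^*.
Proof.
have e0 : eR t != 0 by rewrite -normr_eq0 norm_eR oner_eq0.
by apply: (mulfI e0); rewrite -eRD subrr eR0 -normCK norm_eR expr1n.
Qed.

Lemma nrm_conj (z : R[i]) : nrm z^* = nrm z.
Proof. by apply: (@complexI R); rewrite -!nrmE norm_conjC. Qed.

Lemma nrmBC (z w : R[i]) : nrm (z - w) = nrm (w - z).
Proof. by apply: (@complexI R); rewrite -!nrmE -opprB normrN. Qed.

Section Psi.
Variables (p : nat) (p_pr : prime p).
Let p0 : (0 : R) < p%:R. Proof. by rewrite ltr0n prime_gt0. Qed.

Definition psiF (x : 'F_p) : R[i] := eR ((x : nat)%:R / p%:R).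

Lemma psiF_nat n : psiF n%:R = eR (n%:R / p%:R).
Proof.
rewrite /psiF val_Fp_nat // {2}(divn_eq n p) natrD natrM mulrDl mulfK ?gt_eqF //.
by rewrite eRD eR_nat mul1r.
Qed.

Lemma psiFD x y : psiF (x + y) = psiF x * psiF y.
Proof. by rewrite -{1}[x]natr_Zp -{1}[y]natr_Zp -natrD psiF_nat natrD mulrDl eRD. Qed.

Lemma psiF_norm x : `|psiF x| = 1. Proof. exact: norm_eR. Qed.

Lemma psiFN x : psiF (- x) = eR (- ((x : nat)%:R / p%:R)).
Proof.
have e0 : psiF x != 0 by rewrite -normr_eq0 norm_eR oner_eq0.
by apply: (mulfI e0); rewrite -psiFD -eRD !subrr /psiF mul0r eR0.
Qed.

Lemma nrm_one_sub_psiFN x : nrm (1 - psiF (- x)) = nrm (1 - psiF x).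
Proof.
rewrite psiFN (_ : 1 - _ = (1 - psiF x)^*) ?nrm_conj //.
by rewrite rmorphB rmorph1 eRN.
Qed.

Lemma nrm_one_sub_psiF h : 2 * (absF h)%:R / p%:R <= nrm (1 - psiF h).
Proof.
have le2 : 2 * ((absF h)%:R / p%:R) <= 1 :> R.
  rewrite mulrA ler_pdivrMr // mul1r -natrM ler_nat /absF.
  by have := ltn_Fp p_pr h; rewrite minnE; lia.
have key : 2 * ((absF h)%:R / p%:R) <= nrm (1 - psiF (absF h)%:R).
  by rewrite psiF_nat nrm_one_sub_eR_ge // divr_ge0 // ltW.
rewrite -mulrA; have [e|e] := absF_sign p_pr h; first by rewrite [in X in _ <= X]e.
by rewrite [in X in _ <= X]e nrm_one_sub_psiFN.
Qed.

Lemma psiF_nontriv : (2 < p)%N -> psiF 1 != 1.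
Proof.
move=> p2; rewrite eq_sym -subr_eq0 -normr_eq0 nrmE; apply: lt0r_neq0.
rewrite ltcR; apply: lt_le_trans (nrm_one_sub_psiF 1).
have -> : absF (1 : 'F_p) = 1%N.
  have v1 : nat_of_ord (1 : 'F_p) = 1%N.
    by have := val_Fp_nat p_pr 1; rewrite modn_small ?prime_gt1.
  by rewrite /absF v1; apply/minn_idPl; rewrite subn_gt0 ltnW.
by rewrite mulr1 divr_gt0.
Qed.

Lemma nrm_psiF x : nrm (psiF x) = 1.
Proof. by apply: (@complexI R); rewrite -nrmE psiF_norm. Qed.

Lemma nrmM (z w : R[i]) : nrm (z * w) = nrm z * nrm w.
Proof. by apply: (@complexI R); rewrite rmorphM /= -!nrmE normrM. Qed.

Lemma nrmX (z : R[i]) n : nrm (z ^+ n) = nrm z ^+ n.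
Proof. by apply: (@complexI R); rewrite rmorphXn /= -!nrmE normrX. Qed.

Lemma nrm_sum_le (I : Type) (r : seq I) (P : pred I) (f : I -> R[i]) :
  nrm (\sum_(i <- r | P i) f i) <= \sum_(i <- r | P i) nrm (f i).
Proof. by rewrite -lecR -nrmE -sum_norm_nrm ler_norm_sum. Qed.

Lemma nrm_Complex_le (x y B : R) : `|x| <= B -> `|y| <= B -> nrm (x +i* y) <= 2 * B.
Proof.
move=> xB yB; have B0 : 0 <= B by apply: le_trans xB.
rewrite /nrm /= -[2 * B]ger0_norm ?mulr_ge0 // -sqrtr_sqr ler_wsqrtr //.
rewrite -[x ^+ 2]real_normK ?num_real // -[y ^+ 2]real_normK ?num_real //.
have x2 : `|x| ^+ 2 <= B ^+ 2 by rewrite lerXn2r ?nnegrE.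
have y2 : `|y| ^+ 2 <= B ^+ 2 by rewrite lerXn2r ?nnegrE.
apply: le_trans (lerD x2 y2) _; have -> : B ^+ 2 + B ^+ 2 = 2 * B ^+ 2 by ring.
by rewrite exprMn ler_wpM2r ?exprn_ge0 // -natrX ler_nat.
Qed.

Lemma dual_weight_le L (phi : nat -> R[i]) B h : (forall n, (n < L)%N -> nrm (phi n) <= B) ->
  nrm (dual_weight psiF L phi h) <= L%:R * B.
Proof.
move=> phiB; apply: le_trans (nrm_sum_le _ _ _) _.
rewrite mulr_natl; have -> : B *+ L = \sum_(n < L) B by rewrite sumr_const card_ord.
by apply: ler_sum => n _; rewrite nrmM nrm_psiF mulr1 phiB.
Qed.

Lemma dual_weight_shift_le L (phi : nat -> R[i]) B (h m : 'F_p) :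
  0 <= B -> (forall n, (n < L)%N -> nrm (phi n) <= B) ->
  nrm (dual_weight psiF L phi (h + m) - dual_weight psiF L phi h) <=
  L%:R * (B * (8 * ((m : nat)%:R * L%:R / p%:R))).
Proof.
move=> B0 phiB; rewrite /dual_weight -sumrB; apply: le_trans (nrm_sum_le _ _ _) _.
set T := B * _; rewrite mulr_natl; have -> : T *+ L = \sum_(n < L) T by rewrite sumr_const card_ord.
apply: ler_sum => n _; rewrite mulrDl opprD psiFD mulrA.
rewrite -[X in _ - X]mulr1 -mulrBr !nrmM nrm_psiF mulr1; apply: ler_pM => //; try exact: nrm_ge0.
  exact: phiB.
have -> : nrm (psiF (- (m * n%:R)) - 1) = nrm (1 - eR ((m * n)%N%:R / p%:R)).
  by rewrite -psiF_nat natrM natr_Zp nrmBC nrm_one_sub_psiFN.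
apply: le_trans (nrm_one_sub_eR_le _) _; rewrite ler_wpM2l // ger0_norm; last first.
  by rewrite divr_ge0 // ltW.
by rewrite -natrM ler_wpM2r ?invr_ge0 ?(ltW p0) // ler_nat leq_mul // ltnW.
Qed.

(** Summation by parts: multiplying the generating sum by 1 - z replaces the coefficients by their
    backward differences. The functions vanish on both sides of [0, L), so there are no boundary
    terms; each step lengthens the sum by one. *)
Lemma dual_weight_diff L (u v : Rdefinitions.R -> Rdefinitions.R) (h : 'F_p) (j : nat) :
  (forall x, Rlt x 0 \/ Rle (INR L) x -> u x = 0) ->
  (forall x, Rlt x 0 \/ Rle (INR L) x -> v x = 0) ->
  (1 - psiF (- h)) ^+ j * dual_weight psiF L (fun n => u (INR n) +i* v (INR n)) h =
  \sum_(n < L + j) (Nat.iter j dif u (INR n) +i* Nat.iter j dif v (INR n)) * psiF (- h) ^+ n.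
Proof.
move=> u0 v0; have psin n : psiF (- (h * n%:R)) = psiF (- h) ^+ n.
  elim: n => [|n IHn]; first by rewrite mulr0 oppr0 /psiF mul0r eR0.
  by rewrite -natr1 mulrDr mulr1 opprD psiFD IHn exprSr.
elim: j => [|j IHj].
  by rewrite expr0 mul1r addn0; apply: eq_bigr => n _; rewrite psin.
rewrite exprS -mulrA IHj addnS; set z := psiF (- h).
pose D x := Nat.iter j dif u x +i* Nat.iter j dif v x : R[i].
have D0 x : Rlt x 0 \/ Rle (Rplus (INR L) (INR j)) x -> D x = 0.
  by move=> xL; rewrite /D (dif_iter_support j _ _ u0 _ xL) (dif_iter_support j _ _ v0 _ xL).
have DS n : Nat.iter j.+1 dif u (INR n) +i* Nat.iter j.+1 dif v (INR n) =
    D (INR n) - D (Rminus (INR n) 1).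
  by apply/eqP; rewrite eq_complex /= !eqxx.
under [RHS]eq_bigr => n _ do rewrite DS mulrBl.
rewrite sumrB mulrBl mul1r; congr (_ - _).
  by rewrite [RHS]big_ord_recr /= D0 ?mul0r ?addr0 //; right; rewrite plus_INR; apply: Rle_refl.
have Dm1 : D (Rminus (INR 0) 1) = 0 by apply: D0; left; apply: Rlt_minus; exact: Rlt_0_1.
rewrite [RHS]big_ord_recl Dm1 mul0r add0r.
rewrite mulr_sumr; apply: eq_bigr => n _; rewrite lift0 exprS mulrCA; congr (_ * _).
by congr D; rewrite S_INR /Rminus Rplus_assoc Rplus_opp_r Rplus_0_r.
Qed.

Lemma dual_weight_decay L (u v : Rdefinitions.R -> Rdefinitions.R) (h : 'F_p) (j : nat) (B : R) :
  smooth u -> smooth v ->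
  (forall x, Rlt x 0 \/ Rle (INR L) x -> u x = 0) ->
  (forall x, Rlt x 0 \/ Rle (INR L) x -> v x = 0) ->
  (forall x, Rle (Rabs (Derive_n u j x)) B) -> (forall x, Rle (Rabs (Derive_n v j x)) B) ->
  (2 * (absF h)%:R / p%:R) ^+ j *
    nrm (dual_weight psiF L (fun n => u (INR n) +i* v (INR n)) h) <= (L + j)%:R * (2 * B).
Proof.
move=> su sv u0 v0 uB vB.
apply: le_trans (_ : nrm ((1 - psiF (- h)) ^+ j) * _ <= _).
  apply: ler_wpM2r; first exact: nrm_ge0.
  rewrite nrmX lerXn2r ?nnegrE ?nrm_ge0 ?divr_ge0 ?mulr_ge0 ?(ltW p0) //.
  by rewrite -(absFN p_pr) nrm_one_sub_psiF.
rewrite -nrmM dual_weight_diff //; apply: le_trans (nrm_sum_le _ _ _) _.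
set T := 2 * B; rewrite mulr_natl; have -> : T *+ (L + j) = \sum_(n < L + j) T by rewrite sumr_const card_ord.
apply: ler_sum => n _; rewrite nrmM nrmX nrm_psiF expr1n mulr1; apply: nrm_Complex_le.
  by rewrite -RabsE; apply/RleP/dif_iter_bound.
by rewrite -RabsE; apply/RleP/dif_iter_bound.
Qed.

End Psi.

Lemma smallF_min p (p_pr : prime p) H : smallF p H = smallF p (minn H p.-1).
Proof.
apply/setP => h; rewrite !inE leq_min.
by rewrite -[X in _ && X]ltnS prednK ?prime_gt0 // absF_lt // andbT.
Qed.

(** The collision count asks for H < p. A larger H gives the same set of residues as p - 1, so the
    minimum is used and the bound is then relaxed to H. *)
Lemma core_bound_le (p : nat) (p_pr : prime p) (ms : {set 'F_p}) (M H K r l : nat) :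
  (M < p)%N -> (p <= 2 ^ l)%N -> (forall m, m \in ms -> (0 < m <= M)%N) ->
  core_bound (Rdefinitions.R : rcfType) ms H K r <=
  (M%:R * (2 * H%:R + 1)) ^+ (2 * r) *
  (2 * (M%:R * H%:R / p%:R + 1) * (M%:R ^+ 2 + 4 * (M%:R * l%:R * (H%:R * l%:R)))) *
  (r.+1%:R ^+ r.+1 * K%:R ^+ r.+1 * p%:R + K%:R ^+ (2 * r.+1) * (4 * r.+1%:R) * Num.sqrt p%:R).
Proof.
move=> Mp pl msM; have p0 := prime_gt0 p_pr; set H' := minn H p.-1.
have H'H : (H' <= H)%N by apply: geq_minl.
have H'p : (H' < p)%N by rewrite /H' -(ltn_predK p0) ltnS geq_minr.
have p0' : (0 : R) < p%:R by rewrite ltr0n.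
rewrite /core_bound smallF_min // -/H'; apply: ler_pM.
- by rewrite mulr_ge0 ?exprn_ge0.
- by rewrite /moment_value addr_ge0 ?mulr_ge0 ?sqrtr_ge0.
- apply: ler_pM; rewrite ?exprn_ge0 //.
    apply: lerXn2r; rewrite ?nnegrE ?mulr_ge0 ?addr_ge0 ?mulr_ge0 // cardsX.
    have -> : M%:R * (2 * H%:R + 1) = (M * (2 * H + 1))%:R :> R by rewrite !(natrM, natrD).
    rewrite ler_nat; apply: leq_mul; first exact: (card_ms msM).
    apply: leq_trans (card_smallF p_pr H') _; by rewrite leq_add2r leq_mul2l.
  apply: le_trans (_ : (2 * ((M * H') %/ p + 1) * (M ^ 2 + 4 * ((M * l) * (H' * l))))%N%:R <= _).
    by rewrite ler_nat; apply: (card_collisions p_pr Mp H'p pl msM).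
  have q0 : (0 : R) <= ((M * H') %/ p)%N%:R + 1 by rewrite addr_ge0.
  rewrite !(natrM, natrD, natrX); apply: ler_pM; rewrite ?mulr_ge0 ?addr_ge0 ?exprn_ge0 ?mulr_ge0 //.
    rewrite ler_pM2l // lerD2r ler_pdivlMr // -!natrM ler_nat.
    by apply: leq_trans (leq_divM _ _) _; rewrite leq_mul2l H'H orbT.
  by rewrite lerD2l !ler_wpM2l ?mulr_ge0 // ler_wpM2r // ler_nat.
- by rewrite /moment_value !(natrM, natrX).
Qed.

(** * One dyadic class over the prime field *)

Section Class.
Variables (p : nat) (p_pr : prime p) (p_odd : odd p).
Variables (a b lam : 'F_p).
Hypotheses (a0 : a != 0) (lam0 : lam != 0).
Variables (ms : {set 'F_p}) (M H1 K L r l j : nat).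
Hypotheses (K0 : (0 < K)%N) (Kp : (K <= p)%N) (rp : (r.+1 < p)%N) (Mp : (M < p)%N) (pl : (p <= 2 ^ l)%N).
Hypothesis msM : forall m, m \in ms -> (0 < m <= M)%N.
Variables (u v : nat -> Rdefinitions.R -> Rdefinitions.R) (B0 Bj : R).
Hypotheses (su : forall m, m \in ms -> smooth (u m)) (sv : forall m, m \in ms -> smooth (v m)).
Hypotheses (u0 : forall m, m \in ms -> forall x, Rlt x 0 \/ Rle (INR L) x -> u m x = 0)
  (v0 : forall m, m \in ms -> forall x, Rlt x 0 \/ Rle (INR L) x -> v m x = 0).
Hypotheses (uB0 : forall m, m \in ms -> forall x, Rle (Rabs (u m x)) B0)
  (vB0 : forall m, m \in ms -> forall x, Rle (Rabs (v m x)) B0)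
  (uBj : forall m, m \in ms -> forall x, Rle (Rabs (Derive_n (u m) j x)) Bj)
  (vBj : forall m, m \in ms -> forall x, Rle (Rabs (Derive_n (v m) j x)) Bj).

Definition class_term (m : 'F_p) : R[i] :=
  \sum_(n < L) (u m (INR n) +i* v m (INR n)) * root_sum (@psiF p) lam (a * m * n%:R + b).

Let H := (H1 + K * M)%N.
Let W : R := L%:R * (2 * B0).
Let V : R := L%:R * (2 * B0 * (8 * (M%:R * L%:R / p%:R))).
Let delta : R := (L + j)%:R * (2 * Bj) * (p%:R / (2 * H1.+1%:R)) ^+ j.

Let w (m h : 'F_p) := dual_weight (@psiF p) L (fun n => u m (INR n) +i* v m (INR n)) h.

Lemma class_core : (exists m, m \in ms) -> exists X : R, [/\ 0 <= X,
  X ^+ (2 * r.+1) <= (M%:R * (2 * H%:R + 1)) ^+ (2 * r) *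
    (2 * (M%:R * H%:R / p%:R + 1) * (M%:R ^+ 2 + 4 * (M%:R * l%:R * (H%:R * l%:R)))) *
    (r.+1%:R ^+ r.+1 * K%:R ^+ r.+1 * p%:R + K%:R ^+ (2 * r.+1) * (4 * r.+1%:R) * Num.sqrt p%:R) &
  K%:R * (p%:R * \sum_(m in ms) nrm (class_term m)) <=
    Num.sqrt p%:R * ((W + K%:R * V) * X + M%:R * p%:R * K%:R * delta)].
Proof.
case=> m1 m1s; have p0 : (0 : R) < p%:R by rewrite ltr0n prime_gt0.
have B00 : 0 <= B0 by apply/RleP; apply: Rle_trans (Rabs_pos _) (uB0 m1s 0).
have Bj0 : 0 <= Bj by apply/RleP; apply: Rle_trans (Rabs_pos _) (uBj m1s 0).
have W0 : 0 <= W by rewrite mulr_ge0 ?mulr_ge0.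
have V0 : 0 <= V by rewrite !mulr_ge0 // invr_ge0 ltW.
have d0 : 0 <= delta.
  by rewrite /delta !mulr_ge0 ?exprn_ge0 ?divr_ge0 ?mulr_ge0 // ltW.
have phiB m n : m \in ms -> nrm (u m (INR n) +i* v m (INR n)) <= 2 * B0.
  by move=> mm; apply: nrm_Complex_le; rewrite -RabsE; apply/RleP; [apply: uB0 | apply: vB0].
have p2 : (2 < p)%N by case: p p_pr p_odd => [|[|[|]]].
have wW m x : m \in ms -> nrm (w m x) <= W.
  by move=> mm; apply: dual_weight_le => n _; apply: phiB.
have wV m x : m \in ms -> nrm (w m (x + m) - w m x) <= V.
  move=> mm; have /andP[_ mM] := msM mm.
  apply: le_trans (dual_weight_shift_le (B := 2 * B0) p_pr _ _ _ _) _.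
  - by rewrite mulr_ge0.
  - by move=> n _; apply: phiB.
  rewrite !ler_wpM2l ?mulr_ge0 // ler_wpM2r ?invr_ge0 ?(ltW p0) // ler_wpM2r // ler_nat //.
have wd m x : m \in ms -> (H1 < absF x)%N -> nrm (w m x) <= delta.
  move=> mm hx; have := dual_weight_decay p_pr x (su mm) (sv mm) (u0 mm) (v0 mm) (uBj mm) (vBj mm).
  have x0 : 0 < 2 * H1.+1%:R / p%:R :> R by rewrite divr_gt0 // mulr_gt0.
  move=> dec; rewrite /delta -[p%:R / _]invf_div exprVn ler_pdivlMr ?exprn_gt0 // mulrC.
  apply: le_trans dec; apply: ler_wpM2r; first exact: nrm_ge0.
  apply: lerXn2r; rewrite ?nnegrE ?(ltW x0) ?divr_ge0 ?mulr_ge0 ?(ltW p0) //.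
  by rewrite ler_wpM2r ?invr_ge0 ?(ltW p0) // ler_wpM2l // ler_nat.
have [X [X0 Xb Xs]] := bilinear_core p_pr p_odd (R := Rdefinitions.R : rcfType) R_archi (psiFD p_pr) (@psiF_norm p)
  (psiF_nontriv p_pr p2) b a0 lam0 Kp rp msM (leqnn H) wW wV W0 V0 d0 wd.
exists X; split=> //.
  exact: le_trans Xb (core_bound_le p_pr H K r Mp pl msM).
apply: le_trans (_ : Num.sqrt p%:R * ((W + K%:R * V) * X + #|ms|%:R * p%:R * K%:R * delta) <= _); last first.
  rewrite ler_wpM2l ?sqrtr_ge0 // lerD2l ler_wpM2r // ler_wpM2r // ler_wpM2r ?(ltW p0) // ler_nat.
  exact: (card_ms msM).
apply: le_trans Xs; rewrite ler_wpM2l // mulr_sumr; apply: ler_sum => m mm.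
have m0 : m != 0 by have /andP[m_gt0 _] := msM mm; apply: contraTneq m_gt0 => ->.
have := weighted_root_sum_fourier p_pr (psiFD p_pr) (@psiF_norm p) (psiF_nontriv p_pr p2)
  b lam a0 L (fun n => u m (INR n) +i* v m (INR n)) m0.
rewrite -/(class_term m) -/(w m) => <-.
rewrite nrmM; have -> : nrm (p%:R : R[i]) = p%:R; last by [].
by apply: (@complexI R); rewrite -nrmE natrC normr_nat.
Qed.

End Class.

(** * Transfer from the integers to the prime field *)

Lemma eR_IZR (z : Z) : eR (IZR z) = 1.
Proof.
have pos n : eR (IZR (Z.of_nat n)) = 1 by rewrite -INR_IZR_INZ INRE eR_nat.
have [z0|z0] := Z_le_dec 0 z; first by rewrite -(Z2Nat.id z z0).
have -> : z = Z.opp (Z.of_nat (Z.to_nat (Z.opp z))) by rewrite Z2Nat.id; lia.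
by rewrite opp_IZR RoppE eRN pos conjc1.
Qed.

Lemma prime_to_nat (q : Z) : Znumtheory.prime q -> prime (Z.to_nat q).
Proof.
move=> qp; have q2 := prime_ge_2 _ qp; apply/primeP; split; first by lia.
move=> d /dvdnP[k kd]; have : Z.divide (Z.of_nat d) q.
  by exists (Z.of_nat k); rewrite -Nat2Z.inj_mul multE -kd Z2Nat.id; lia.
move=> /(prime_divisors _ qp); case=> [|[|[|]]] e; lia.
Qed.

Section Residue.
Variables (q : Z) (q_pr : Znumtheory.prime q).
Notation p := (Z.to_nat q).
Let p_pr : prime p := prime_to_nat q_pr.
Let q0 : (0 < q)%ZZ. Proof. by have := prime_ge_2 _ q_pr; lia. Qed.

Definition Zres (z : Z) : 'F_p := (Z.to_nat (Z.modulo z q))%:R.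

Lemma Zres_mod (x y : Z) : Z.modulo x q = Z.modulo y q -> Zres x = Zres y.
Proof. by rewrite /Zres => ->. Qed.

Lemma Zres_nat n : Zres (Z.of_nat n) = n%:R.
Proof.
rewrite /Zres -[RHS](Fp_nat_mod p_pr); congr (_ %:R).
apply: Nat2Z.inj; rewrite Z2Nat.id; last by have := Z.mod_pos_bound (Z.of_nat n) q q0; lia.
have pE : Z.of_nat p = q by rewrite Z2Nat.id; lia.
symmetry; apply: (Z.mod_unique _ _ (Z.of_nat (n %/ p))).
  by left; have := ltn_pmod n (prime_gt0 p_pr); lia.
rewrite -[X in Z.mul X _]pE -Nat2Z.inj_mul -Nat2Z.inj_add; congr Z.of_nat.
by rewrite multE plusE mulnC; exact: divn_eq.
Qed.

Lemma ZresE z : exists n : nat, z = (Z.of_nat n + q * Z.div z q)%ZZ /\ Zres z = n%:R.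
Proof.
exists (Z.to_nat (Z.modulo z q)); split=> //.
rewrite Z2Nat.id; last by have := Z.mod_pos_bound z q q0; lia.
by rewrite {1}(Z.div_mod z q); lia.
Qed.

Lemma ZresD x y : Zres (x + y) = Zres x + Zres y.
Proof.
have [m [ex ->]] := ZresE x; have [n [ey ->]] := ZresE y.
rewrite -natrD -Zres_nat; apply: Zres_mod.
rewrite {1}ex {1}ey.
have -> : (Z.of_nat m + q * (x / q) + (Z.of_nat n + q * (y / q)))%ZZ =
  (Z.of_nat (m + n) + (x / q + y / q) * q)%ZZ by lia.
by rewrite Z_mod_plus_full.
Qed.

Lemma ZresM x y : Zres (x * y) = Zres x * Zres y.
Proof.
have [m [ex ->]] := ZresE x; have [n [ey ->]] := ZresE y.
rewrite -natrM -Zres_nat; apply: Zres_mod.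
rewrite {1}ex {1}ey.
have -> : ((Z.of_nat m + q * (x / q)) * (Z.of_nat n + q * (y / q)))%ZZ =
  (Z.of_nat (m * n) + (Z.of_nat m * (y / q) + (x / q) * Z.of_nat n + (x / q) * q * (y / q)) * q)%ZZ.
  by rewrite Nat2Z.inj_mul; ring.
by rewrite Z_mod_plus_full.
Qed.

Lemma ZresB x y : Zres (x - y) = Zres x - Zres y.
Proof. by apply/eqP; rewrite eq_sym subr_eq -ZresD; apply/eqP; congr Zres; lia. Qed.

Lemma Zres_eq0 z : (Zres z == 0) = Z.eqb (Z.modulo z q) 0.
Proof.
rewrite /Zres -(dvdn_pcharf (pchar_Fp p_pr)).
have := Z.mod_pos_bound z q q0; move: (Z.modulo z q) => k k0.
apply/idP/Z.eqb_spec => [|->]; last exact: dvdn0.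
have [k1|k1] := posnP (Z.to_nat k); first by lia.
by rewrite gtnNdvd //; lia.
Qed.

Lemma psiF_Zres z : psiF (Zres z) = eR (IZR z / IZR q).
Proof.
have [n [-> ->]] := ZresE z.
have qR : IZR q = p%:R :> R by rewrite -INRE INR_IZR_INZ Z2Nat.id //; lia.
have p0 : (p%:R : R) != 0 by rewrite pnatr_eq0 -lt0n prime_gt0.
rewrite (psiF_nat p_pr) plus_IZR mult_IZR -INR_IZR_INZ INRE RplusE RmultE qR.
by rewrite mulrDl eRD [p%:R * _]mulrC mulfK // eR_IZR mulr1.
Qed.

Lemma Zres_coprime a lam : Z.gcd (a * lam) q = 1%ZZ -> Zres a != 0 /\ Zres lam != 0.
Proof.
move=> g; have : Zres (a * lam) != 0.
  rewrite Zres_eq0; apply/negP => /Z.eqb_spec d.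
  have : Z.divide q (Z.gcd (a * lam) q).
    by apply: Z.gcd_greatest; [apply: Zmod_divide; lia | exists 1%ZZ; lia].
  by rewrite g => /Z.divide_1_r_nonneg; have := prime_ge_2 _ q_pr; lia.
by rewrite ZresM mulf_eq0 negb_or => /andP[].
Qed.

Lemma sum_residues (V : nmodType) (g : 'F_p -> V) : \sum_(0 <= k < p) g k%:R = \sum_x g x.
Proof.
rewrite -{1}(Fp_cast p_pr) big_mkord; apply: eq_bigr => k _.
by rewrite natr_Zp.
Qed.

End Residue.

Definition toC (z : C) : R[i] := z.1 +i* z.2.

Lemma Cmod_toC z : Cmod z = nrm (toC z).
Proof. by case: z => x y; rewrite /Cmod /nrm RsqrtE !RpowE. Qed.

Lemma toC_mult z w : toC (Cmult z w) = toC z * toC w.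
Proof. by case: z => x y; case: w => x' y'; apply/eqP; rewrite eq_complex /= !eqxx. Qed.

Lemma toC_Csum lo hi f : toC (Csum lo hi f) = \sum_(lo <= k < hi.+1) toC (f k).
Proof.
rewrite /Csum; elim: hi => [|n IHn].
  case: lo => [|lo]; first by rewrite sum_n_n big_nat1.
  by rewrite sum_n_m_zero ?big_geq //; lia.
have [ln|nl] := leqP lo n.+1.
  rewrite sum_n_Sm; last by lia.
  by rewrite big_nat_recr //= -IHn.
by rewrite sum_n_m_zero ?big_geq //; lia.
Qed.

Lemma rsum_big n f : rsum n f = \sum_(1 <= k < n.+1) (f k : R).
Proof.
rewrite /rsum; elim: n => [|n IHn]; first by rewrite sum_n_m_zero ?big_geq //; lia.
by rewrite sum_n_Sm; [rewrite big_nat_recr //= -IHn | lia].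
Qed.

Lemma toC_e t : toC (e_C t) = eR t. Proof. by []. Qed.

Ltac nonneg := repeat first [done | apply: exprn_ge0 | apply: mulr_ge0 | apply: addr_ge0 |
  rewrite invr_ge0 | exact: sqrtr_ge0].

Section Rows.
Variables (q : Z) (q_pr : Znumtheory.prime q) (a b lam : Z).
Notation p := (Z.to_nat q).
Let p_pr : prime p := prime_to_nat q_pr.
Let q0 : (0 < q)%ZZ. Proof. by have := prime_ge_2 _ q_pr; lia. Qed.

Lemma inner_sumE (m n : nat) : toC (inner_sum q a b lam (Z.of_nat m) (Z.of_nat n)) =
  root_sum (@psiF p) (Zres q lam) (Zres q a * m%:R * n%:R + Zres q b).
Proof.
rewrite /inner_sum toC_Csum.
have -> : (Z.to_nat (q - 1)).+1 = p by lia.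
rewrite /root_sum [RHS]big_mkcond; apply: etrans (sum_residues q_pr _); apply: eq_bigr => k _ /=.
have -> : (k%:R ^+ 2 == Zres q a * m%:R * n%:R + Zres q b) =
   Z.eqb (Z.modulo (Z.of_nat k * Z.of_nat k - (a * Z.of_nat m * Z.of_nat n + b)) q) 0.
  by rewrite -Zres_eq0 // ZresB // ZresD // !ZresM // !Zres_nat // subr_eq0 expr2.
case: ifP => // _.
by rewrite toC_e -psiF_Zres // ZresM // Zres_nat.
Qed.

Lemma nrm_inner_sum_le (m n : nat) : odd p ->
  nrm (toC (inner_sum q a b lam (Z.of_nat m) (Z.of_nat n))) <= 2.
Proof.
move=> p_odd; rewrite inner_sumE /root_sum.
set y := (_ + _); apply: le_trans (nrm_sum_le _ _ _) _.
rewrite (eq_bigr (fun=> 1)); last by move=> x _; rewrite nrm_psiF.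
rewrite sumr_const; have [x0 /= x0y|no] := pickP (fun x : 'F_p => x ^+ 2 == y); last first.
  by rewrite eq_card0.
rewrite -[1 *+ _]/(_%:R) ler_nat; apply: leq_trans (_ : #|[set x0; - x0]| <= _)%N.
  apply/subset_leq_card/subsetP => x xy; have {xy} : x ^+ 2 == y := xy.
  by rewrite -(eqP x0y) eqf_sqr !inE.
by rewrite cards2; case: (_ == _).
Qed.

Lemma row_sumE Nn L (u v : Rdefinitions.R -> Rdefinitions.R) m : (L <= Nn.+1)%N ->
  (forall n, (L <= n)%N -> (u (INR n) = 0 /\ v (INR n) = 0)%RS) ->
  toC (row_sum q a b lam Nn u v m) = \sum_(n < L) (u (INR n) +i* v (INR n)) *
    root_sum (@psiF p) (Zres q lam) (Zres q a * m%:R * n%:R + Zres q b).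
Proof.
move=> LN uv0; rewrite /row_sum toC_Csum.
rewrite (big_cat_nat (n := L)) //= [X in _ + X]big1_seq ?addr0; last first.
  move=> n; rewrite mem_index_iota => /andP[_ /andP[Ln _]]; rewrite toC_mult /cfun.
  by have [-> ->] := uv0 n Ln; rewrite [toC (0, 0)]/(0 : R[i]) mul0r.
by rewrite big_mkord; apply: eq_bigr => n _; rewrite toC_mult inner_sumE.
Qed.

Lemma row_sum_le Nn L (u v : Rdefinitions.R -> Rdefinitions.R) (B : Rdefinitions.R) m : (2 < q)%ZZ ->
  (L <= S Nn)%coq_nat -> (forall n, (L <= n)%coq_nat -> (u (INR n) = 0 /\ v (INR n) = 0)%RS) ->
  (forall x, (Cmod (cfun u v x) <= B)%RS) ->
  (Cmod (row_sum q a b lam Nn u v m) <= INR L * (B * 2))%RS.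
Proof.
move=> q2 /ssrnat.leP LN uv0 uvB; apply/RleP; rewrite Cmod_toC (row_sumE _ LN); last first.
  by move=> n Ln; apply: uv0; apply/ssrnat.leP.
have p_odd : odd p by case: (even_prime p_pr) => // pE; lia.
apply: le_trans (nrm_sum_le _ _ _) _.
apply: le_trans (_ : \sum_(n < L) B * 2 <= _); last first.
  by rewrite sumr_const card_ord -[_ *+ L]mulr_natl !RmultE -INR_IZR2 !INRE.
apply: ler_sum => n _; rewrite nrmM; apply: ler_pM; rewrite ?nrm_ge0 //.
  by have /RleP := uvB (INR n); rewrite Cmod_toC.
by rewrite -inner_sumE nrm_inner_sum_le.
Qed.

Lemma V_le (M N : Rdefinitions.R) alpha phiRe phiIm :
  (Cmod (V q a b lam M N alpha phiRe phiIm) <=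
  rsum (Z.to_nat (Int_part M)) (fun m => Cmod (alpha m) *
    Cmod (row_sum q a b lam (Z.to_nat (Int_part N)) (phiRe m) (phiIm m) m)))%RS.
Proof.
apply/RleP; rewrite Cmod_toC /V toC_Csum rsum_big; apply: le_trans (nrm_sum_le _ _ _) _.
apply: ler_sum => m _; rewrite RmultE !Cmod_toC -nrmM; rewrite le_eqVlt; apply/orP; left; apply/eqP; congr nrm.
rewrite /row_sum !toC_Csum mulr_sumr; apply: eq_bigr => n _.
by rewrite !toC_mult mulrA.
Qed.

(** [class_core] in terms of Stdlib integers and reals. As Mn < q, the selected m correspond to
    distinct nonzero residues. *)
Lemma class_estimate (sel : nat -> bool) (Mn Nn H1 K L r l j : nat)
  (u v : nat -> Rdefinitions.R -> Rdefinitions.R) (B0 Bj : Rdefinitions.R) :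
  (2 < q)%ZZ -> Z.gcd (a * lam) q = 1%ZZ ->
  (INR K <= IZR q)%RS -> (INR (S r) < IZR q)%RS -> (INR Mn < IZR q)%RS ->
  (IZR q <= 2 ^ l)%RS -> (L <= S Nn)%coq_nat -> (0 <= B0)%RS -> (0 <= Bj)%RS ->
  (forall m, (1 <= m)%coq_nat -> (m <= Mn)%coq_nat -> sel m = true ->
    [/\ smooth (u m), smooth (v m),
     forall x, ((x < 0)%RS \/ (INR L <= x)%RS) -> (u m x = 0 /\ v m x = 0)%RS,
     forall x, (Cmod (cfun (u m) (v m) x) <= B0)%RS &
     forall x, (Cmod (cderiv (u m) (v m) j x) <= Bj)%RS]) ->
  let H := (H1 + K * Mn)%coq_nat in
  exists X, [/\ (0 <= X)%RS,
   (X ^ (2 * S r)%coq_nat <= (INR Mn * (2 * INR H + 1)) ^ (2 * r)%coq_nat *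
      (2 * (INR Mn * INR H / IZR q + 1) * (INR Mn ^ 2 + 4 * (INR Mn * INR l * (INR H * INR l)))) *
      (INR (S r) ^ S r * INR K ^ S r * IZR q + INR K ^ (2 * S r)%coq_nat * (4 * INR (S r)) * sqrt (IZR q)))%RS &
   (INR K * (IZR q * rsum Mn (fun m => if sel m then Cmod (row_sum q a b lam Nn (u m) (v m) m) else 0)) <=
    sqrt (IZR q) * ((INR L * (2 * B0) + INR K * (INR L * (2 * B0 * (8 * (INR Mn * INR L / IZR q))))) * X +
      INR Mn * IZR q * INR K * ((INR L + INR j) * (2 * Bj) * (IZR q / (2 * INR (S H1))) ^ j)))%RS].
Proof.
move=> q2 gcd1 Kq rq Mq ql /ssrnat.leP LN B00 Bj0 uvP H.
have qE : IZR q = p%:R :> R by rewrite -INRE INR_IZR_INZ Z2Nat.id //; lia.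
have p_odd : odd p by case: (even_prime p_pr) => // pE; lia.
have [a0 lam0] := Zres_coprime q_pr gcd1.
pose ms : {set 'F_p} := [set x : 'F_p | (0 < x <= Mn)%N && sel x].
have Kp : (K <= p)%N by rewrite -(ler_nat R) -qE -INRE; apply/RleP.
have rp : (r.+1 < p)%N by rewrite -(ltr_nat R) -qE -INRE; apply/RltP.
have Mp : (Mn < p)%N by rewrite -(ltr_nat R) -qE -INRE; apply/RltP.
have pl : (p <= 2 ^ l)%N.
  rewrite -(ler_nat R) natrX -qE; apply/RleP; move: ql; rewrite RpowE.
  by rewrite -[IZR 2]/(_ : R) -INR_IZR2 INRE.
have msM m : m \in ms -> (0 < m <= Mn)%N by rewrite inE => /andP[].
have msP m : m \in ms -> _ := fun mm => uvP m (elimT ssrnat.leP (proj1 (andP (msM m mm))))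
   (elimT ssrnat.leP (proj2 (andP (msM m mm)))) (proj2 (andP (etrans (esym (in_set _ _)) mm))).
have sumE (w : nat -> R) : rsum Mn (fun m => if sel m then w m else 0) = \sum_(m in ms) w m.
  rewrite rsum_big -big_mkcond /=.
  rewrite (big_nat_widen _ _ p) ?ltnS // (big_nat_widenl _ 0) //.
  rewrite -{1}(Fp_cast p_pr) big_mkord; apply: eq_bigl => x; rewrite inE; lia.
have termE m : m \in ms -> Cmod (row_sum q a b lam Nn (u m) (v m) m) =
    nrm (class_term (Zres q a) (Zres q b) (Zres q lam) L u v m).
  move=> mm; have [_ _ uv0 _ _] := msP m mm.
  rewrite Cmod_toC (row_sumE _ LN); first by rewrite /class_term; under eq_bigr do rewrite natr_Zp.
  by move=> n Ln; apply: uv0; right; apply: le_INR; apply/ssrnat.leP.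
have IZRn n : IZR (Z.of_nat n) = n%:R by rewrite -INR_IZR_INZ INRE.
have num := (IZRn 0, IZRn 1, IZRn 2, IZRn 4, IZRn 8).
have toR := (RpowE, INRE, RsqrtE, RdivE, RmultE, RplusE).
rewrite sumE (eq_bigr _ termE).
(* An empty class satisfies the estimate with X = 0; otherwise a member is available for
   [class_core]. *)
have [ms0|[m1 m1s]] := set_0Vmem ms.
  have p0 : (0 : R) <= p%:R by [].
  have B00' : 0 <= B0 by apply/RleP.
  have Bj0' : 0 <= Bj by apply/RleP.
  exists 0; split; [by apply/RleP| |]; apply/RleP; rewrite !toR !num qE.
    rewrite expr0n /=; nonneg.
  by rewrite ms0 big_set0 !mulr0 add0r; nonneg.
have bound x y B : (Cmod (x, y) <= B)%RS -> (Rabs x <= B)%RS /\ (Rabs y <= B)%RS.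
  move=> h; have := Rle_trans _ _ _ (Rmax_Cmod _) h.
  by split; apply: Rle_trans H0; [apply: Rmax_l | apply: Rmax_r].
have su m : m \in ms -> smooth (u m) by case/msP.
have sv m : m \in ms -> smooth (v m) by case/msP.
have u0 m : m \in ms -> forall x, Rlt x 0 \/ Rle (INR L) x -> u m x = 0 by case/msP=> _ _ h _ _ x /h[].
have v0 m : m \in ms -> forall x, Rlt x 0 \/ Rle (INR L) x -> v m x = 0 by case/msP=> _ _ h _ _ x /h[].
have uB m : m \in ms -> forall x, Rle (Rabs (u m x)) B0.
  by case/msP=> _ _ _ h _ x; have [] := bound _ _ _ (h x).
have vB m : m \in ms -> forall x, Rle (Rabs (v m x)) B0.
  by case/msP=> _ _ _ h _ x; have [] := bound _ _ _ (h x).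
have uBj m : m \in ms -> forall x, Rle (Rabs (Derive_n (u m) j x)) Bj.
  by case/msP=> _ _ _ _ h x; have [] := bound _ _ _ (h x).
have vBj m : m \in ms -> forall x, Rle (Rabs (Derive_n (v m) j x)) Bj.
  by case/msP=> _ _ _ _ h x; have [] := bound _ _ _ (h x).
have [X [X0 Xb Xs]] := class_core p_pr p_odd (Zres q b) a0 lam0 H1
  Kp rp Mp pl msM su sv u0 v0 uB vB uBj vBj (ex_intro _ m1 m1s).
exists X; split; [by apply/RleP| |]; apply/RleP; rewrite !toR !num qE.
  by rewrite -[(_ * _)%coq_nat]/(2 * r.+1)%N.
by move: Xs; rewrite natrD.
Qed.

End Rows.

End CharacterSums.

(** * Dyadic classes *)

Definition admissible_weight (Cj : nat -> R) (n : R) (u v : R -> R) : Prop :=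
  smooth u /\ smooth v /\
  (forall x, cfun u v x <> RtoC 0 -> 0 <= x <= n) /\
  (forall (j : nat) (x : R), Cmod (cderiv u v j x) <= Cj j / n ^ j).

Lemma row_sum_trivial (q a b lam : Z) (Nn L m : nat) (Cj : nat -> R) n u v :
  prime q -> (2 < q)%Z -> (L <= S Nn)%nat -> n < INR L -> admissible_weight Cj n u v ->
  Cmod (row_sum q a b lam Nn u v m) <= INR L * (Rabs (Cj 0%nat) * 2).
Proof.
intros Hp H2 HL Hn (_ & _ & Hs & Hd). apply CharacterSums.row_sum_le; try assumption.
- intros k Hk. apply (cfun_support u v n); [exact Hs|right].
  apply Rlt_le_trans with (1 := Hn), le_INR, Hk.
- intros x. assert (H := Hd 0%nat x). simpl in H. unfold cfun; unfold cderiv in H; simpl in H.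
  apply Rle_trans with (1 := H). rewrite Rdiv_1_r. apply Rle_abs.
Qed.

(** All N_m here lie in (N/2, N], so powers of N_m and of N agree up to constants. The trivial bound
    covers N <= M; otherwise the parameters of [class_parameters] are inserted, the tail
    contributing at most 1. *)
Lemma dyadic_class_bound (r : nat) (c1 de : R) (Cj : nat -> R) : 1 <= c1 -> 0 < de ->
  exists A Q, 0 <= A /\ forall q a b lam : Z, prime q -> Q <= IZR q -> Z.gcd (a * lam) q = 1%Z ->
  forall (M N : R) (Mn Nn : nat) (sel : nat -> bool) (Nm : nat -> R) (u v : nat -> R -> R),
  1 <= M -> INR Mn <= M -> 1 <= N -> N < INR Nn + 1 -> M * N <= c1 * IZR q ->
  (forall m, (1 <= m)%nat -> (m <= Mn)%nat -> sel m = true ->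
     N / 2 < Nm m <= N /\ admissible_weight Cj (Nm m) (u m) (v m)) ->
  rsum Mn (fun m => if sel m then Cmod (row_sum q a b lam Nn (u m) (v m) m) else 0) <=
    A * Rpower (IZR q) (2 * de) * (target1 r M N + target2 r M N (IZR q)).
Proof.
intros Hc1 Hde.
(* The number of differences: beyond y q/N each gains a factor y = q^de, and j >= 3/de of them gain
   q^3. *)
destruct (nfloor_ex (3 / de)) as [j0 [_ Hj0]]; [apply Rlt_le, Rdiv_lt_0_compat; lra|].
set (j := S j0).
assert (Hj : 3 <= de * INR j).
{ unfold j; rewrite S_INR. assert (E : 3 = de * (3 / de)) by (field; lra).
  rewrite E at 1. apply Rmult_le_compat_l; lra. }
set (C0 := Rabs (Cj 0%nat)). assert (HC0 : 0 <= C0) by apply Rabs_pos.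
destruct (class_numerics r c1 Hc1) as [Ac [HAc Hnum]].
destruct (log_square_small de 2 Hde ltac:(lra)) as [Q1 [HQ1 Hlog]].
destruct (decay_small de c1 j (Rabs (Cj j)) Hde Hc1 Hj (Rabs_pos _)) as [Q2 [HQ2 Hdec]].
exists (Ac * C0 + 1 + 4 * C0), (Q1 + Q2 + c1 + 3 + INR (S r)).
split; [nra|].
intros q a b lam Hq HQ Hg M N Mn Nn sel Nm u v HM HMn HN HNn HMN Hw.
assert (HrI := pos_INR (S r)).
set (qr := IZR q) in *.
assert (Hq1 : 3 < qr) by lra.
assert (Hq2 : (2 < q)%Z) by (apply lt_IZR; fold qr; lra).
set (TT := target1 r M N + target2 r M N qr).
assert (HT1 : 1 <= target1 r M N) by (apply Rle_trans with (1 := HM), le_M_target1; assumption).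
assert (HT2 := target2_pos r M N qr).
set (y := Rpower qr de). assert (Hy : 1 <= y) by (apply one_le_Rpower; lra).
assert (Hy2 : Rpower qr (2 * de) = y ^ 2).
{ unfold y; simpl; rewrite Rmult_1_r, <- Rpower_plus; f_equal; ring. }
rewrite Hy2. assert (Hy21 : 1 <= y ^ 2) by (apply pow_R1_Rle; lra).
assert (HTT : 1 <= y ^ 2 * TT) by (unfold TT; nra).
destruct (nfloor_ex N) as [n [HnN HNn1]]; [lra|]. set (L := S n).
assert (HL : INR L <= 2 * N) by (unfold L; rewrite S_INR; lra).
assert (HNL : N < INR L) by (unfold L; rewrite S_INR; lra).
assert (HLN : (L <= S Nn)%nat).
{ unfold L. assert (n < S Nn)%nat; [|lia]. apply INR_lt; rewrite S_INR; lra. }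
destruct (Rle_dec N M) as [HNM|HNM].
- apply Rle_trans with (M * (2 * N * (C0 * 2))).
  + apply rsum_le_select; [nra|exact HMn|]. intros m Hm1 Hm2 Hs.
    destruct (Hw m Hm1 Hm2 Hs) as [HNm Ha].
    apply Rle_trans with (INR L * (C0 * 2)).
    * apply (row_sum_trivial q a b lam Nn L m Cj (Nm m)); try assumption; lra.
    * apply Rmult_le_compat_r; lra.
  + assert (HMNT := mul_le_target1 r M N HN HNM).
    assert (M * N <= y ^ 2 * TT) by (unfold TT; nra).
    rewrite (Rmult_assoc _ (y ^ 2) TT).
    apply Rle_trans with (4 * C0 * (y ^ 2 * TT)); [nra|].
    apply Rmult_le_compat_r; [lra|nra].
- assert (HMN' : M <= N) by lra. clear HNM.
  (* M <= N gives M^2 <= c1 q < q^2, so every m <= M is invertible modulo q. *)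
  assert (HMq : M < qr).
  { assert (M * M <= M * N) by (apply Rmult_le_compat_l; lra).
    assert (c1 * qr < qr * qr) by (apply Rmult_lt_compat_r; lra).
    apply Rnot_le_lt; intros Hle. assert (qr * qr <= M * M) by (apply Rmult_le_compat; lra). lra. }
  destruct (pow_two_between qr) as [l [Hl1 Hl2]]; [lra|].
  assert (Hl : 1 <= INR l).
  { destruct l as [|l']; [simpl in Hl1; lra|]. rewrite S_INR; assert (H := pos_INR l'); lra. }
  assert (Hll : INR l * INR l <= y).
  { apply Rle_trans with (2 := Hlog qr ltac:(lra) l Hl2). nra. }
  destruct (class_parameters qr M N c1 y Mn ltac:(lra) HM HN Hc1 Hy HMN HMn)
    as (K & H1 & HK0 & HKq & HKc & HqK & HyH & HH).
  set (Bj := Rabs (Cj j) * (2 / N) ^ j).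
  assert (HBj : 0 <= Bj).
  { apply Rmult_le_pos; [apply Rabs_pos|]. apply pow_le, Rlt_le, Rdiv_lt_0_compat; lra. }
  destruct (@CharacterSums.class_estimate q Hq a b lam sel Mn Nn H1 K L r l j u v C0 Bj) as [X [HX0 HXb HXs]];
    try assumption; fold qr; try lra.
  { intros m Hm1 Hm2 Hs. destruct (Hw m Hm1 Hm2 Hs) as [HNm (Hu & Hv & Hsup & Hder)].
    split; try assumption.
    - intros x Hx; apply (cfun_support (u m) (v m) (Nm m)); [exact Hsup|]. lra.
    - intros x. assert (H := Hder 0%nat x). apply Rle_trans with (1 := H).
      simpl; rewrite Rdiv_1_r. apply Rle_abs.
    - intros x. apply (le_Rabs_div_pow _ (Nm m)); try lra. apply Hder. }
  set (D := (INR L + INR j) * (2 * Bj) * (qr / (2 * INR (S H1))) ^ j) in *.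
  assert (Hg1 : 0 < y * (qr / N)) by (apply Rmult_lt_0_compat; [|apply Rdiv_lt_0_compat]; lra).
  assert (HD : 0 <= D).
  { unfold D. apply Rmult_le_pos.
    - apply Rmult_le_pos; [assert (H := pos_INR L); assert (H' := pos_INR j)|]; lra.
    - apply pow_le, Rlt_le, Rdiv_lt_0_compat; lra. }
  assert (HMD : M * sqrt qr * D <= 1).
  { unfold D, Bj.
    apply (Hdec qr M N (INR L) y (INR (S H1))); try assumption; try reflexivity; try lra; apply pos_INR. }
  eapply Rle_trans.
  { eapply (Hnum qr M N y (INR l) (INR K) (INR (H1 + K * Mn)) (INR L) C0 X (INR Mn) _ D);
      try eassumption; try lra; try apply pos_INR. apply lt_0_INR, HK0. }
  fold TT. rewrite !(Rmult_assoc _ (y ^ 2) TT).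
  assert (0 <= C0 * (y ^ 2 * TT)) by (apply Rmult_le_pos; lra).
  apply Rle_trans with (Ac * C0 * (y ^ 2 * TT) + 1); [lra|]. lra.
Qed.

Lemma Int_part_nat x : 1 <= x -> INR (Z.to_nat (Int_part x)) <= x < INR (Z.to_nat (Int_part x)) + 1.
Proof.
intros Hx. destruct (base_Int_part x) as [H1 H2].
assert (0 < Int_part x + 1)%Z by (apply lt_IZR; rewrite plus_IZR; lra).
rewrite INR_IZR_INZ, Z2Nat.id by lia. lra.
Qed.

(** Indices i <= I are the dyadic ranges of the N_m >= 1. Index I + 1 collects the N_m < 1, for
    which n = 0 is the only possible term and the class bound, which needs N >= 1, is replaced by
    the trivial one. *)
Definition level (N : R) (Nm : nat -> R) (I i m : nat) : bool :=
  if Rlt_dec (Nm m) 1 then Nat.eqb i (S I) else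
  if Rle_dec (Nm m) (N / 2 ^ i) then if Rlt_dec (N / 2 ^ S i) (Nm m) then Nat.ltb i (S I) else false
  else false.

(** eps is split into four parts [de]: one pays for the number of classes, two for the bound on each
    class, one for all constants. *)
Lemma V_bound (r : nat) (c1 c2 : R) (Cj : nat -> R) (eps : R) : 0 < eps ->
  exists Q0 : R, forall q : Z, prime q -> Q0 <= IZR q ->
  forall M N : R, 1 <= M -> 1 <= N -> M * N <= c1 * IZR q ->
  forall (alpha : nat -> C) (Nm : nat -> R) (phiRe phiIm : nat -> R -> R),
  (forall m : nat, (1 <= m)%nat -> INR m <= M ->
     Cmod (alpha m) <= c2 /\ 0 < Nm m /\ Nm m <= N /\ admissible_weight Cj (Nm m) (phiRe m) (phiIm m)) ->
  forall a b lam : Z, Z.gcd (a * lam) q = 1%Z ->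
  Cmod (V q a b lam M N alpha phiRe phiIm) <=
    (target1 r M N + target2 r M N (IZR q)) * Rpower (IZR q) eps.
Proof.
intros Heps. set (c := Rmax 1 c1). assert (Hc : 1 <= c) by apply Rmax_l.
set (de := eps / 4). assert (Hde : 0 < de) by (unfold de; lra).
destruct (dyadic_class_bound r c de Cj Hc Hde) as (A & Q1 & HA & Hcls).
destruct (log_square_small de (2 * c) Hde ltac:(lra)) as [Q2 [HQ2 Hlog]].
set (C0 := Rabs (Cj 0%nat)). assert (HC0 : 0 <= C0) by apply Rabs_pos.
set (A' := A + 2 * C0).
set (c2' := Rabs c2). assert (Hc2 : 0 <= c2') by apply Rabs_pos.
destruct (large_power de (2 * c2' * A') Hde) as [Q3 [HQ3 Hlarge]].
exists (Rmax (Rmax 3 Q1) (Rmax Q2 Q3)).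
intros q Hq HQ M N HM HN HMN alpha Nm u v Hw a b lam Hg.
set (qr := IZR q) in *.
assert (HQ3' : 3 <= qr) by (apply Rle_trans with (2 := HQ), Rle_trans with (Rmax 3 Q1); apply Rmax_l).
assert (HQ1' : Q1 <= qr).
{ apply Rle_trans with (2 := HQ), Rle_trans with (Rmax 3 Q1); [apply Rmax_r|apply Rmax_l]. }
assert (HQ2' : Q2 <= qr).
{ apply Rle_trans with (2 := HQ), Rle_trans with (Rmax Q2 Q3); [apply Rmax_l|apply Rmax_r]. }
assert (HQ4' : Q3 <= qr) by (apply Rle_trans with (2 := HQ), Rle_trans with (Rmax Q2 Q3); apply Rmax_r).
assert (Hq2 : (2 < q)%Z) by (apply lt_IZR; fold qr; lra).
assert (HMNc : M * N <= c * qr).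
{ apply Rle_trans with (1 := HMN), Rmult_le_compat_r; [lra|apply Rmax_r]. }
destruct (Int_part_nat M HM) as [HMn HMn1]. destruct (Int_part_nat N HN) as [HNn HNn1].
apply Rle_trans with (1 := CharacterSums.V_le q a b lam M N alpha u v).
set (Mn := Z.to_nat (Int_part M)) in *. set (Nn := Z.to_nat (Int_part N)) in *.
assert (HmM : forall m, (m <= Mn)%nat -> INR m <= M).
{ intros m Hm. apply Rle_trans with (2 := HMn), le_INR, Hm. }
set (f := fun m => Cmod (row_sum q a b lam Nn (u m) (v m) m)).
set (TT := target1 r M N + target2 r M N qr).
assert (HT1 := le_M_target1 r M N HM HN). assert (HT2 := target2_pos r M N qr).
assert (HMT : M <= TT) by (unfold TT; lra).
apply Rle_trans with (c2' * rsum Mn f).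
{ rewrite <- rsum_scal. apply rsum_le; intros m Hm1 Hm2.
  destruct (Hw m Hm1 (HmM m Hm2)) as [Ha _].
  apply Rmult_le_compat_r; [apply Cmod_ge_0|]. apply Rle_trans with (1 := Ha), Rle_abs. }
destruct (pow_two_between N HN) as [I [HI1 HI2]].
set (y := Rpower qr de). assert (Hy : 1 <= y) by (apply one_le_Rpower; lra).
assert (Hy2 : Rpower qr (2 * de) = y ^ 2).
{ unfold y; simpl; rewrite Rmult_1_r, <- Rpower_plus; f_equal; ring. }
assert (Hy21 : 1 <= y ^ 2) by (apply pow_R1_Rle; lra).
assert (HB : 0 <= A' * y ^ 2 * TT).
{ unfold A'; apply Rmult_le_pos; [apply Rmult_le_pos|]; lra. }
assert (HS : rsum Mn f <= INR (S (S I)) * (A' * y ^ 2 * TT)).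
{ apply (rsum_cover Mn (S I) (level N Nm I)).
  - intros m; apply Cmod_ge_0.
  - intros m Hm1 Hm2. destruct (Hw m Hm1 (HmM m Hm2)) as (_ & Hn0 & HnN & _).
    unfold level. destruct (Rlt_dec (Nm m) 1) as [H1|H1].
    + exists (S I); split; [lia|apply Nat.eqb_refl].
    + destruct (dyadic_level (S I) (Nm m) N HnN) as (i & Hi & Hb1 & Hb2).
      { apply Rle_lt_trans with (1 / 2); [|lra]. apply div_le; [apply pow_lt; lra|].
        simpl; lra. }
      exists i; split; [lia|].
      destruct (Rle_dec _ _); [|contradiction]. destruct (Rlt_dec _ _); [|contradiction].
      apply Nat.ltb_lt, Hi.
  - intros i Hi. destruct (Nat.eq_dec i (S I)) as [->|Hn].
    + apply Rle_trans with (M * (1 * (C0 * 2))).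
      * apply rsum_le_select; [lra|exact HMn|]. intros m Hm1 Hm2 Hs.
        destruct (Hw m Hm1 (HmM m Hm2)) as (_ & Hn0 & HnN & Ha).
        (* One term per row, n = 0. *)
        change 1 with (INR 1).
        apply (row_sum_trivial q a b lam Nn 1 m Cj (Nm m)); try assumption; [lia|].
        unfold level in Hs. destruct (Rlt_dec (Nm m) 1) as [H1|H1]; [simpl; lra|].
        rewrite Nat.ltb_irrefl in Hs. destruct (Rle_dec _ _); [|discriminate].
        destruct (Rlt_dec _ _); discriminate.
      * assert (M <= y ^ 2 * TT) by nra. unfold A'.
        assert (0 <= A * (y ^ 2 * TT)) by (apply Rmult_le_pos; lra).
        assert (C0 * M <= C0 * (y ^ 2 * TT)) by (apply Rmult_le_compat_l; lra). lra.
    + set (N' := N / 2 ^ i). assert (H2i : 1 <= 2 ^ i) by (apply pow_R1_Rle; lra).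
      assert (HN'N : N' <= N) by (unfold N'; apply div_le; nra).
      assert (Hsel : forall m, level N Nm I i m = true -> 1 <= Nm m /\ N' / 2 < Nm m <= N').
      { intros m Hs; unfold level in Hs. destruct (Rlt_dec (Nm m) 1) as [H1|H1].
        - apply Nat.eqb_eq in Hs; contradiction.
        - destruct (Rle_dec _ _) as [H2|]; [|discriminate].
          destruct (Rlt_dec _ _) as [H3|]; [|discriminate]. split; [lra|split; [|exact H2]].
          replace (N' / 2) with (N / 2 ^ S i); [exact H3|]. unfold N'; simpl; field; lra. }
      destruct (Rlt_dec N' 1) as [HN'|HN'].
      * apply Rle_trans with (INR Mn * 0); [|lra]. apply rsum_le_select; [lra|lra|].
        intros m _ _ Hs; apply Hsel in Hs; lra.
      * apply Rle_trans with (A * Rpower qr (2 * de) * (target1 r M N' + target2 r M N' qr)).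
        { apply (Hcls q a b lam Hq HQ1' Hg M N' Mn Nn (level N Nm I i) Nm u v); try lra.
          - apply Rle_trans with (2 := HMNc). apply Rmult_le_compat_l; lra.
          - intros m Hm1 Hm2 Hs. destruct (Hw m Hm1 (HmM m Hm2)) as (_ & _ & _ & Ha).
            split; [apply Hsel, Hs|exact Ha]. }
        { assert (Ht := target_mono r M N' N qr HM ltac:(lra) HN'N ltac:(lra)). fold TT in Ht.
          rewrite Hy2. apply Rle_trans with (A * y ^ 2 * TT).
          - apply Rmult_le_compat_l; [apply Rmult_le_pos; lra|exact Ht].
          - apply Rmult_le_compat_r; [lra|]. apply Rmult_le_compat_r; unfold A'; lra. } }
assert (HII : INR (S (S I)) <= 2 * y).
{ rewrite !S_INR. assert (H := pos_INR I).
  assert ((INR I + 1) * (INR I + 1) <= y); [|nra].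
  apply Hlog; [exact HQ2'|]. apply Rle_trans with (1 := HI2). nra. }
assert (HL := Hlarge qr HQ4'). fold y in HL.
replace (Rpower qr eps) with (y * (y * y ^ 2)).
2: { rewrite <- Hy2. unfold y; rewrite <- !Rpower_plus; f_equal; unfold de; field. }
apply Rle_trans with (c2' * (2 * y * (A' * y ^ 2 * TT))).
- apply Rmult_le_compat_l; [exact Hc2|]. apply Rle_trans with (1 := HS).
  apply Rmult_le_compat_r; assumption.
- replace (c2' * (2 * y * (A' * y ^ 2 * TT))) with (2 * c2' * A' * (TT * (y * y ^ 2))) by ring.
  replace (TT * (y * (y * y ^ 2))) with (y * (TT * (y * y ^ 2))) by ring.
  apply Rmult_le_compat_r; [|exact HL].
  apply Rmult_le_pos; [lra|]. apply Rmult_le_pos; lra.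
Qed.

Theorem theorem2p3 :
  forall (r : nat), (2 <= r)%nat ->
  forall (c1 c2 : R) (Cj : nat -> R),
  forall eps : R, 0 < eps ->
  exists Q0 : Z,
  forall q : Z, prime q -> (Q0 <= q)%Z ->
  forall M N : R, 1 <= M -> 1 <= N -> M * N <= c1 * IZR q ->
  forall (alpha : nat -> C) (Nm : nat -> R) (phiRe phiIm : nat -> R -> R),
  (forall m : nat, (1 <= m)%nat -> INR m <= M ->
     Cmod (alpha m) <= c2 /\
     0 < Nm m /\ Nm m <= N /\
     smooth (phiRe m) /\ smooth (phiIm m) /\
     (forall x : R, cfun (phiRe m) (phiIm m) x <> RtoC 0 -> 0 <= x <= Nm m) /\
     (forall (j : nat) (x : R),
        Cmod (cderiv (phiRe m) (phiIm m) j x) <= Cj j / (Nm m ^ j))) ->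
  forall a b lam : Z, Z.gcd (a * lam) q = 1%Z ->
  Cmod (V q a b lam M N alpha phiRe phiIm) <=
    (Rpower M (3/2 - 1 / (2 * INR r)) * Rpower N (1/2 + 1 / (2 * INR r))
     + Rpower M (1 - 1 / (2 * INR r)) * Rpower N (1 / (2 * INR r))
       * Rpower (IZR q) (1/2 - 1 / (4 * INR r)))
    * Rpower (IZR q) eps.
Proof.
intros [|r] Hr c1 c2 Cj eps Heps; [lia|].
destruct (V_bound r c1 c2 Cj eps Heps) as [Q0 HQ0].
exists (up Q0). intros q Hq HQ.
apply HQ0; [exact Hq|].
apply Rle_trans with (IZR (up Q0)); [apply Rlt_le, archimed|apply IZR_le, HQ].
Qed.
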